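(* Let $n$ be a positive integer and $\tau\in\mathbb{H}$, and let $D_{2n}^-(p,q;\tau)$ and $R_{2n}^-(p,q;\tau)$ be as defined in the context. (1) For every $(p,q)\in V$, $$D_{2n}^-(p,q;\tau)=D_{2n}^-(p,q+p;\tau),\qquad D_{2n}^-(p,-q;\tau)=-D_{2n}^-(p,q;\tau).$$ (2) For every $(p,q)\in U$, the following reciprocity law holds: $$D_{2n}^-(p,q;\tau)+D_{2n}^-(q,p;\tau)=R_{2n}^-(p,q;\tau).$$
   Context: $\mathbb{H}=\{\tau\in\mathbb{C}: \operatorname{Im}\tau>0\}$; $V=\{(p,q)\in\mathbb{Z}^+\times\mathbb{Z}: \gcd(p,q)=1\}$; $U=\{(p,q)\in\mathbb{Z}^+\times\mathbb{Z}^+: \gcd(p,q)=1\}$. For $\tau\in\mathbb{H}$, the Weierstrass zeta function is $$\zeta(z;\tau)=\frac1z+\sum_{\gamma\in(\mathbb{Z}\tau+\mathbb{Z})\setminus\{0\}}\left(\frac{1}{z-\gamma}+\frac1\gamma+\frac{z}{\gamma^2}\right),$$ and $\zeta^{(k)}(z;\tau)=\partial^k\zeta(z;\tau)/\partial z^k$. The Eisenstein series are $E_{2m}(\tau)=\sum_{\gamma\in(\mathbb{Z}\tau+\mathbb{Z})\setminus\{0\}}\gamma^{-2m}$ for $m\ge2$; for all $m\ge1$ (and as the definition when $m=1$) $$E_{2m}(\tau)=2\zeta(2m)+\frac{2(2\pi i)^{2m}}{(2m-1)!}\sum_{k=1}^\infty\sigma_{2m-1}(k)e^{2\pi i k\tau},$$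 where $\sigma_\ell(k)=\sum_{d\mid k}d^\ell$ and $\zeta(2m)$ is a value of the Riemann zeta function. For $(p,q)\in V$, define (an empty sum being $0$) $$D_{2n}^-(p,q;\tau)=\frac{1}{(2\pi i)^2p\,(2n)!}\sum_{\substack{\lambda,\mu=0\\(\lambda,\mu)\neq(0,0)}}^{p-1}\zeta^{(2n)}\left(\frac{\lambda+\mu\tau}{p};\tau\right)\left[\zeta\left(\frac{q(\lambda+\mu\tau)}{p};\tau\right)-E_2(\tau)\frac{q(\lambda+\mu\tau)}{p}+2\pi i\frac{q\mu}{p}\right].$$ For $(p,q)\in U$, define $$R_{2n}^-(p,q;\tau)=-\frac{1}{(2\pi i)^2pq}\left[\sum_{j=1}^{n}E_{2j}(\tau)E_{2n+2-2j}(\tau)p^{2j}q^{2n+2-2j}-E_{2n+2}(\tau)(p^{2n+2}+q^{2n+2})-(2n+1)E_{2n+2}(\tau)\right]-\frac{1}{4\pi i n}\frac{\partial E_{2n}(\tau)}{\partial\tau}(p^{2n-1}q+pq^{2n-1}).$$ *)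

(* Defs.v *)
From HB Require Import structures.
From mathcomp Require Import all_boot all_order all_algebra.
From mathcomp Require Import all_classical all_reals all_analysis.
From mathcomp Require Import complex.
(* Not imported: [summability.sum] would otherwise shadow the type [sum]. *)
From mathcomp.analysis.showcase Require summability.

Set Implicit Arguments.
Unset Strict Implicit.
Unset Printing Implicit Defensive.

Import Order.TTheory GRing.Theory Num.Theory.
Import numFieldNormedType.Exports.

Local Open Scope classical_set_scope.
Local Open Scope ring_scope.
Local Open Scope complex_scope.

Section Definitions.
Variable R : realType.
Local Notation C := R[i].
Implicit Types (tau z : C) (n p : nat) (q : int).

Definition upper_half_plane tau : Prop := 0 < complex.Im tau.

Definition cexp z : C :=
  (expR (complex.Re z))%:C * (cos (complex.Im z) +i* sin (complex.Im z)).

Definition two_pi_i : C := (2 * pi)%:C * 'i.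

Definition lattice_pt tau (g : int * int) : C := g.1%:~R * tau + g.2%:~R.

(* Unordered sum over the nonzero points of Z tau + Z, i.e. the limit of the
   partial sums along the directed set of finite index sets; for tau in the
   upper half plane, [lattice_pt tau] is injective. *)
Definition lattice_sum tau (f : C -> C) : C :=
  @summability.sum _ C C^o (fun g : int * int =>
    if g == (0, 0) then 0 else f (lattice_pt tau g)).

Definition weierstrass_zeta tau z : C :=
  z^-1 + lattice_sum tau
    (fun gamma => (z - gamma)^-1 + gamma^-1 + z / gamma ^+ 2).

(* [C^o] is C as a normed space over itself, so these are complex derivatives. *)
Definition weierstrass_zeta_deriv (k : nat) tau z : C :=
  @derive1n C C^o k (weierstrass_zeta tau) z.

Definition divisor_sigma (l k : nat) : nat := \sum_(d <- divisors k) d ^ l.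

Definition riemann_zeta (s : nat) : R := limn (series (riemannR (s%:R : R))).

(* The summation index k >= 1 is shifted to k.+1. *)
Definition eisenstein_fourier (m : nat) tau : C :=
  2 * (riemann_zeta (2 * m))%:C +
  2 * two_pi_i ^+ (2 * m) / ((2 * m).-1)`!%:R *
  limn (series (fun k : nat =>
    (divisor_sigma (2 * m).-1 k.+1)%:R * cexp (two_pi_i * k.+1%:R * tau)) : nat -> C^o).

(* [eisenstein m] is the series of weight 2m. In weight 2 the lattice sum does
   not converge absolutely and the Fourier expansion is the definition. *)
Definition eisenstein (m : nat) tau : C :=
  if m == 1%N then eisenstein_fourier 1 tau
  else lattice_sum tau (fun gamma => gamma ^- (2 * m)).

Definition dedekind_D n p q tau : C :=
  (two_pi_i ^+ 2 * p%:R * (2 * n)`!%:R)^-1 *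
  \sum_(l < p) \sum_(m < p | ((l : nat), (m : nat)) != (0, 0)%N)
    let w := (l%:R + m%:R * tau) / p%:R in
    weierstrass_zeta_deriv (2 * n) tau w *
    (weierstrass_zeta tau (q%:~R * w) - eisenstein 1 tau * (q%:~R * w)
     + two_pi_i * (q%:~R * m%:R / p%:R)).

Definition dedekind_R n p (q : nat) tau : C :=
  - (two_pi_i ^+ 2 * p%:R * q%:R)^-1 *
    (\sum_(1 <= j < n.+1) eisenstein j tau * eisenstein (n.+1 - j) tau
        * p%:R ^+ (2 * j) * q%:R ^+ (2 * n + 2 - 2 * j)
     - eisenstein n.+1 tau * (p%:R ^+ (2 * n + 2) + q%:R ^+ (2 * n + 2))
     - (2 * n + 1)%:R * eisenstein n.+1 tau)
  - (2 * two_pi_i * n%:R)^-1 * @derive1 C C^o (eisenstein n) tau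
    * (p%:R ^+ (2 * n - 1) * q%:R + p%:R * q%:R ^+ (2 * n - 1)).

End Definitions.

(* The index sets V and U; p (and q, for U) is carried as a natural number. *)
Definition in_V (p : nat) (q : int) : Prop := (0 < p)%N /\ coprimez p%:Z q.

Definition in_U (p q : nat) : Prop := [/\ (0 < p)%N, (0 < q)%N & coprime p q].

(* Main.v *)
Require Import Defs.
From mathcomp Require Import all_boot all_order all_algebra.
From mathcomp Require Import finmap.
From mathcomp Require Import all_classical all_reals all_analysis.
From mathcomp Require Import complex ring lra zify.
From mathcomp.analysis.showcase Require summability.

Set Implicit Arguments.
Unset Strict Implicit.
Unset Printing Implicit Defensive.

Import Order.TTheory GRing.Theory Num.Theory.
Import numFieldNormedType.Exports.

Local Open Scope classical_set_scope.
Local Open Scope ring_scope.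
Local Open Scope complex_scope.

(* Limits along the finite subsets directed by inclusion are unique. *)
#[local] Existing Instance summability.totally_filter.

(** Throughout, the inverse of 0 is 0, and a sum over the integers is the limit of
    the sums over the symmetric windows [-N, N]. Put
    [psi k z = sum_n (z + n)^-k]; thus [psi 1 z] is [pi cot (pi z)].

    Summing the lattice row by row, the function
    [zhat w = zeta (w) - E_2 w] is the sum over [m] of [psi 1 (w + m tau)]
    ([weierstrass_rows]), and the derivative of order [2n] of [zeta] is the sum over
    [m] of [(2n)! psi (2n+1) (w + m tau)] ([zeta_derivE]). By the Legendre relation
    ([zhat_addtau]) the bracket [zhat (q w) + 2 pi i q m / p] of the Dedekind sum is
    a periodic function [zper] of the division point [w = (r + m tau) / p], it is
    odd in [q], and it does not change when [p] is added to [q]. This is part (1).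

    Part (2) is a summed version of an elementary identity ([partial_fractions]):
    [(X^-k - Y^-k) / (Y - X)] is the sum of the products [X^-i Y^-j] with [i, j > 0]
    and [i + j = k + 1]. Take [k = 2n + 1] and let [X] run over all lattice points
    divided by [p], and [Y] over all lattice points divided by [q]. The sum over
    integer translates of [X] and [Y] gives an addition formula for the functions
    [psi] ([psi_addition]); summing the latter over windows of rows gives
    [box_identity]. In it,
    - the products [X^-i Y^-j] factor into two Eisenstein series of weights [i] and
      [j], and odd weights cancel, which leaves the sum of the
      [E_(2j) E_(2n+2-2j) p^(2j) q^(2n+2-2j)];
    - the two quotients give sums over [p]- and [q]-division points: for fixed [X]
      the sum of [1 / (Y - X)] over all [Y] is [- q zhat (q X)], and symmetrically;
    - the pairs with [X = 0], [Y = 0] or [X = Y], where the identity has boundary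
      terms, give the multiples [p^(2n+2)], [q^(2n+2)] and [2n+1] of [E_(2n+2)]; for
      the last one, coprimality of [p] and [q] makes [X = Y] a lattice point.
    What separates these sums from the Dedekind sums is the term [2 pi i q m / p],
    linear in the row [m]. Its contribution is a sum of [m psi (2n+1) (m tau)], that
    is, the derivative of [E_(2n)] ([torsion_sumE], [eisenstein_derive1]).

    Many of these sums converge only conditionally, so each limit has to be taken in
    the stated order. Exponential decay of [psi k (z + m tau)] in [m] for [k > 1]
    and the limits [- pi i], [pi i] of [psi 1] far above and below the real axis are
    what make this possible, through dominated convergence ([tannery]); both come
    from the Lipschitz formula. That formula is proved in weight 2 by the duplication
    formula ([psi2E]); weight 1 follows since both sides have the same derivative
    ([psi1E]), higher weights by differentiation ([psi_qseries]). *)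

(** * Complex limits *)

Section Modulus.
Variable R : realType.
Local Notation C := R[i].
Implicit Types (x y z : C) (u v : nat -> C).

Definition cmod z : R := ComplexField.Normc.normc z.

Lemma cmodE z : `|z| = (cmod z)%:C. Proof. by case: z. Qed.

Lemma cmod_ge0 z : 0 <= cmod z.
Proof. by rewrite -ler0c -cmodE. Qed.

Lemma cmod0 : cmod 0 = 0. Proof. exact: ComplexField.Normc.normc0. Qed.

Lemma cmod1 : cmod 1 = 1. Proof. exact: ComplexField.Normc.normc1. Qed.

Lemma cmod_eq0 z : (cmod z == 0) = (z == 0).
Proof. by apply/eqP/eqP => [/ComplexField.Normc.eq0_normc|->] //; rewrite cmod0. Qed.

Lemma cmod_gt0 z : (0 < cmod z) = (z != 0).
Proof. by rewrite lt0r cmod_ge0 andbT cmod_eq0. Qed.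

Lemma cmodM x y : cmod (x * y) = cmod x * cmod y.
Proof. exact: ComplexField.Normc.normcM. Qed.

Lemma cmodV x : cmod x^-1 = (cmod x)^-1.
Proof. exact: ComplexField.Normc.normcV. Qed.

Lemma cmodX x n : cmod (x ^+ n) = cmod x ^+ n.
Proof. by elim: n => [|n IH]; rewrite ?expr0 ?cmod1 // !exprS cmodM IH. Qed.

Lemma cmodN x : cmod (- x) = cmod x.
Proof. by rewrite -[LHS]/(complex.Re (cmod (- x))%:C) -cmodE normrN cmodE. Qed.

Lemma cmodD x y : cmod (x + y) <= cmod x + cmod y.
Proof. by rewrite -lecR rmorphD /= -!cmodE ler_normD. Qed.

Lemma cmodB x y : cmod (x - y) <= cmod x + cmod y.
Proof. by rewrite -(cmodN y) cmodD. Qed.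

Lemma cmod_subC x y : cmod (x - y) = cmod (y - x).
Proof. by rewrite -opprB cmodN. Qed.

Lemma cmod_sub_ge x y : cmod x - cmod y <= cmod (x - y).
Proof. by rewrite lerBlDr (le_trans _ (cmodD _ _))// subrK. Qed.

Lemma cmod_add_ge x y : cmod x - cmod y <= cmod (x + y).
Proof. by rewrite -(cmodN y) -[y in x + y]opprK cmod_sub_ge. Qed.

Lemma cmod_sum (I : Type) (r : seq I) (P : pred I) (F : I -> C) :
  cmod (\sum_(i <- r | P i) F i) <= \sum_(i <- r | P i) cmod (F i).
Proof.
elim: r => [|i r IH]; first by rewrite !big_nil cmod0.
rewrite !big_cons; case: ifP => // _.
by rewrite (le_trans (cmodD _ _))// lerD.
Qed.

Lemma cmod_real (r : R) : cmod r%:C = `|r|.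
Proof. by rewrite /cmod /= expr0n /= addr0 sqrtr_sqr. Qed.

Lemma cmod_nat n : cmod n%:R = n%:R.
Proof. by rewrite -(rmorph_nat (real_complex R)) cmod_real normr_nat. Qed.

Lemma cmod_int (n : int) : cmod n%:~R = `|n|%N%:R.
Proof. by case: n => n; rewrite ?NegzE ?mulrNz ?cmodN cmod_nat. Qed.

Lemma Re_le_cmod z : `|complex.Re z| <= cmod z.
Proof.
by case: z => a b; rewrite /cmod /= -sqrtr_sqr ler_wsqrtr// lerDl sqr_ge0.
Qed.

Lemma Im_le_cmod z : `|complex.Im z| <= cmod z.
Proof.
by case: z => a b; rewrite /cmod /= -[leLHS]sqrtr_sqr ler_wsqrtr// lerDr sqr_ge0.
Qed.

Lemma cmod_le_ReIm z : cmod z <= `|complex.Re z| + `|complex.Im z|.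
Proof.
rewrite [z in leLHS]complexE (le_trans (cmodD _ _))// cmodM !cmod_real.
by rewrite [X in X * _](_ : _ = 1) ?mul1r// /cmod /= expr0n expr1n /= add0r sqrtr1.
Qed.

Lemma Re_sum (I : Type) (r : seq I) (P : pred I) (F : I -> C) :
  complex.Re (\sum_(i <- r | P i) F i) = \sum_(i <- r | P i) complex.Re (F i).
Proof. by apply: (big_morph (@complex.Re R)) => // -[a b] [c d]. Qed.

Lemma Im_sum (I : Type) (r : seq I) (P : pred I) (F : I -> C) :
  complex.Im (\sum_(i <- r | P i) F i) = \sum_(i <- r | P i) complex.Im (F i).
Proof. by apply: (big_morph (@complex.Im R)) => // -[a b] [c d]. Qed.

(** The norm of [C] as a normed space over itself is [C]-valued; estimates are made
    with the real modulus instead. *)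
Definition tends u (l : C) : Prop :=
  forall e : R, 0 < e -> exists N, forall n, (N <= n)%N -> cmod (u n - l) < e.

Lemma tends_ext u v l : u =1 v -> tends u l -> tends v l.
Proof. by move=> /funext ->. Qed.

Lemma tends_cst l : tends (fun=> l) l.
Proof. by move=> e e0; exists 0%N => n _; rewrite subrr cmod0. Qed.

Lemma tends_eventually u v l N : (forall n, (N <= n)%N -> u n = v n) ->
  tends u l -> tends v l.
Proof.
move=> uv ul e /ul[M HM]; exists (maxn N M) => n; rewrite geq_max => /andP[Nn Mn].
by rewrite -uv// HM.
Qed.

Lemma tendsD u v l k : tends u l -> tends v k -> tends (fun n => u n + v n) (l + k).
Proof.
move=> ul vk e e0; have e2 : 0 < e / 2 by rewrite divr_gt0.
have [N HN] := ul _ e2; have [M HM] := vk _ e2.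
exists (maxn N M) => n; rewrite geq_max => /andP[Nn Mn].
have -> : u n + v n - (l + k) = (u n - l) + (v n - k) by ring.
by rewrite (le_lt_trans (cmodD _ _))// [e]splitr ltrD ?HN ?HM.
Qed.

Lemma tendsN u l : tends u l -> tends (fun n => - u n) (- l).
Proof.
move=> ul e /ul[N HN]; exists N => n /HN.
by rewrite -opprD cmodN.
Qed.

Lemma tendsB u v l k : tends u l -> tends v k -> tends (fun n => u n - v n) (l - k).
Proof. by move=> ul vk; apply: tendsD => //; exact: tendsN. Qed.

Lemma tends_squeeze u l (K : R) v k : 0 <= K ->
  (forall n, cmod (u n - l) <= K * cmod (v n - k)) -> tends v k -> tends u l.
Proof.
move=> K0 H vk e e0; have K1 : 0 < K + 1 by lra.
have [N HN] := vk (e / (K + 1)) (divr_gt0 e0 K1).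
exists N => n /HN Hn; rewrite (le_lt_trans (H n))//.
move: Hn; rewrite ltr_pdivlMr// mulrC => Hn; rewrite (le_lt_trans _ Hn)//.
by rewrite ler_wpM2r ?cmod_ge0//; lra.
Qed.

Lemma tendsZ (c : C) u l : tends u l -> tends (fun n => c * u n) (c * l).
Proof.
by apply: (@tends_squeeze _ _ (cmod c)) => [|n]; rewrite ?cmod_ge0// -mulrBr cmodM.
Qed.

Lemma tends_bounded u l : tends u l -> exists B : R, 0 <= B /\ forall n, cmod (u n) <= B.
Proof.
move=> /(_ 1 ltr01)[N HN].
exists (\sum_(k < N) cmod (u k) + (cmod l + 1)); split.
  by rewrite addr_ge0 ?sumr_ge0// => *; rewrite ?addr_ge0 ?cmod_ge0.
move=> n; case: (ltnP n N) => [nN|/HN Hn].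
  rewrite (bigD1 (Ordinal nN))//= -addrA lerDl addr_ge0//.
    by rewrite sumr_ge0// => *; rewrite cmod_ge0.
  by rewrite addr_ge0 ?cmod_ge0.
have : cmod (u n) <= cmod (u n - l) + cmod l.
  by rewrite (le_trans _ (cmodD _ _))// subrK.
have : 0 <= \sum_(k < N) cmod (u k) by rewrite sumr_ge0// => *; rewrite cmod_ge0.
lra.
Qed.

Lemma tendsM u v l k : tends u l -> tends v k -> tends (fun n => u n * v n) (l * k).
Proof.
move=> ul vk; have [B [B0 HB]] := tends_bounded vk.
have H : tends (fun n => (u n - l) * v n) 0.
  apply: (@tends_squeeze _ _ B (fun n => u n)  l) => // n.
  by rewrite subr0 cmodM mulrC ler_wpM2r ?cmod_ge0.
have := tendsD H (tendsZ l vk); rewrite add0r.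
by apply: tends_ext => n; ring.
Qed.

Lemma tends_unique u l k : tends u l -> tends u k -> l = k.
Proof.
move=> ul uk; apply/eqP; rewrite -subr_eq0 -cmod_eq0; apply/negPn/negP => n0.
have e0 : 0 < cmod (l - k) by rewrite lt0r n0 cmod_ge0.
have [N HN] := tendsB ul uk e0.
have := HN N (leqnn _); rewrite (_ : _ - _ = - (l - k)); last by ring.
by rewrite cmodN ltxx.
Qed.

Lemma tends_sub u l (phi : nat -> nat) : (forall n, (n <= phi n)%N) ->
  tends u l -> tends (u \o phi) l.
Proof.
move=> H ul e /ul[N HN]; exists N => n Nn; apply: HN.
by rewrite (leq_trans Nn).
Qed.

Lemma tends_sum (I : Type) (r : seq I) (F : I -> nat -> C) (l : I -> C) :
  (forall i, tends (F i) (l i)) ->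
  tends (fun n => \sum_(i <- r) F i n) (\sum_(i <- r) l i).
Proof.
move=> H; elim: r => [|i r IH].
  by rewrite big_nil; apply: tends_ext (tends_cst 0) => n; rewrite big_nil.
rewrite big_cons; apply: tends_ext (tendsD (H i) IH) => n.
by rewrite big_cons.
Qed.

Lemma tends_le u l (B : R) : (forall n, cmod (u n) <= B) -> tends u l -> cmod l <= B.
Proof.
move=> HB ul; rewrite leNgt; apply/negP => Bl.
have e0 : 0 < cmod l - B by lra.
have [N HN] := ul _ e0; have := HN N (leqnn _); have := HB N.
have := cmodD (u N) (l - u N); rewrite subrKC cmod_subC; lra.
Qed.

Lemma tends_cvg (u : nat -> C) (l : C) : tends u l -> (u : nat -> C^o) @ \oo --> (l : C^o).
Proof.
move=> ul; apply/cvgrPdist_lt => e; rewrite ltcE => /andP[/= /eqP Ie e0].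
have [N HN] := ul _ e0; exists N => // n /= Nn.
rewrite distrC cmodE ltcE /= Ie eqxx /=; exact: HN.
Qed.

Lemma tends_of_ReIm (u : nat -> C) (a b : R) :
  (fun n => complex.Re (u n)) @ \oo --> a ->
  (fun n => complex.Im (u n)) @ \oo --> b -> tends u (a +i* b).
Proof.
move=> /cvgrPdist_lt Ha /cvgrPdist_lt Hb e e0.
have e2 : 0 < e / 2 by rewrite divr_gt0.
have [N _ HN] := Ha _ e2; have [M _ HM] := Hb _ e2.
exists (maxn N M) => n; rewrite geq_max => /andP[Nn Mn].
rewrite (le_lt_trans (cmod_le_ReIm _))// [e]splitr ltrD//.
  by have := HN n Nn; rewrite distrC; case: (u n).
by have := HM n Mn; rewrite distrC; case: (u n).
Qed.

End Modulus.

(** * Symmetric summation over the integers *)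

Section Summation.
Variable R : realType.
Local Notation C := R[i].
Implicit Types (z : C) (b : nat -> R) (f g : int -> C).

Definition bsum b : Prop :=
  (forall n, 0 <= b n) /\ exists B : R, forall N, \sum_(k < N) b k <= B.

Lemma bsum_ge0 b n : bsum b -> 0 <= b n. Proof. by case. Qed.

Lemma bsumZ b (K : R) : 0 <= K -> bsum b -> bsum (fun n => K * b n).
Proof.
move=> K0 [b0 [B HB]]; split=> [n|]; first by rewrite mulr_ge0.
by exists (K * B) => N; rewrite -mulr_sumr ler_wpM2l.
Qed.

Lemma bsum_tail b (e : R) : bsum b -> 0 < e ->
  exists N, forall M, (N <= M)%N -> \sum_(N <= k < M) b k < e.
Proof.
move=> [b0 [B HB]] e0; pose E := range (fun N => \sum_(k < N) b k).
have supE : has_sup E.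
  split; first by exists (\sum_(k < 0) b k), 0%N.
  by exists B => _ [N _ <-].
have [_ [N _ <-] HN] := sup_adherent e0 supE.
exists N => M NM; have : \sum_(k < M) b k <= sup E.
  by apply: ub_le_sup; [case: supE|exists M].
rewrite -!(big_mkord xpredT) (big_cat_nat _ NM)//=.
by move: HN; rewrite -!(big_mkord xpredT); lra.
Qed.

Lemma abs_series_cvg (f : nat -> C) b : bsum b -> (forall k, cmod (f k) <= b k) ->
  exists l, tends (fun N => \sum_(k < N) f k) l.
Proof.
move=> [b0 [B HB]] Hf.
have cb : cvgn (series b).
  apply: nondecreasing_is_cvgn.
    by apply: nondecreasing_series => n _ _; exact: b0.
  by exists B => _ [N _ <-]; rewrite seriesEord; exact: HB.
have aux (u : nat -> R) : (forall k, `|u k| <= b k) -> cvgn (series u).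
  by move=> Hu; apply: normed_cvg; apply: series_le_cvg cb => // k; exact: normr_ge0.
have cRe : cvgn (series (fun k => complex.Re (f k))).
  by apply: aux => k; rewrite (le_trans (Re_le_cmod _)).
have cIm : cvgn (series (fun k => complex.Im (f k))).
  by apply: aux => k; rewrite (le_trans (Im_le_cmod _)).
exists (limn (series (fun k => complex.Re (f k))) +i*
        limn (series (fun k => complex.Im (f k)))).
apply: tends_of_ReIm.
  under eq_fun do rewrite Re_sum; move: cRe.
  by rewrite seriesEord.
under eq_fun do rewrite Im_sum; move: cIm.
by rewrite seriesEord.
Qed.

Fixpoint zr (N : nat) : seq int :=
  if N is M.+1 then [:: N%:Z, - N%:Z & zr M] else [:: 0].

Lemma mem_zr N (n : int) : (n \in zr N) = (`|n|%N <= N)%N.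
Proof.
elim: N => [|N IH] /=; first by rewrite inE; lia.
rewrite !inE IH; lia.
Qed.

Lemma zr_uniq N : uniq (zr N).
Proof. by elim: N => //= N ->; rewrite !inE !mem_zr; lia. Qed.

(** Windows are symmetric because the sums of weight 1 converge only conditionally. *)
Definition zs N f : C := \sum_(n <- zr N) f n.

Lemma zs0 f : zs 0 f = f 0. Proof. by rewrite /zs /= big_seq1. Qed.

Lemma zsS N f : zs N.+1 f = f N.+1%:Z + f (- N.+1%:Z) + zs N f.
Proof. by rewrite /zs /= !big_cons addrA. Qed.

Lemma eq_zs N f g : (forall n, f n = g n) -> zs N f = zs N g.
Proof. by move=> /funext ->. Qed.

Lemma zsD N f g : zs N (fun n => f n + g n) = zs N f + zs N g.
Proof. exact: big_split. Qed.

Lemma zsB N f g : zs N (fun n => f n - g n) = zs N f - zs N g.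
Proof. exact: sumrB. Qed.

Lemma zsZ N (c : C) f : zs N (fun n => c * f n) = c * zs N f.
Proof. by rewrite /zs mulr_sumr. Qed.

Lemma zsZr N (c : C) f : zs N (fun n => f n * c) = zs N f * c.
Proof. by rewrite /zs mulr_suml. Qed.

Lemma zs_opp N f : zs N (fun n => f (- n)) = zs N f.
Proof.
elim: N => [|N IH]; first by rewrite !zs0 oppr0.
by rewrite !zsS IH opprK [f (- _) + _]addrC.
Qed.

Lemma zs_odd N f : (forall n, f (- n) = - f n) -> zs N f = 0.
Proof.
move=> H; have := zs_opp N f; rewrite (eq_zs _ H).
rewrite -[X in X = _](_ : -1 * zs N f = _); last by rewrite -zsZ; apply: eq_zs => n; ring.
move=> /eqP; rewrite mulN1r -subr_eq0 -opprD oppr_eq0 -mulr2n mulrn_eq0 /=.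
by move/eqP.
Qed.

Lemma zs_exchange N M (f : int -> int -> C) :
  zs N (fun n => zs M (f n)) = zs M (fun m => zs N (f^~ m)).
Proof. exact: exchange_big. Qed.

Lemma zs_sum N (I : Type) (r : seq I) (f : I -> int -> C) :
  zs N (fun n => \sum_(i <- r) f i n) = \sum_(i <- r) zs N (f i).
Proof. exact: exchange_big. Qed.

Lemma zs_pred1 N (n0 : int) (f : int -> C) : (`|n0| <= N)%N ->
  (forall n, n != n0 -> f n = 0) -> zs N f = f n0.
Proof.
move=> Hn H; rewrite /zs (bigD1_seq n0) ?zr_uniq ?mem_zr//=.
by rewrite big1 ?addr0// => i /H.
Qed.

Lemma zs_shift N f : zs N (fun n => f (n + 1)) = zs N f - f (- N%:Z) + f N.+1%:Z.
Proof.
elim: N => [|N IH]; first by rewrite !zs0 /= !oppr0 subrr !add0r.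
rewrite !zsS IH.
have -> : N.+1%:Z + 1 = N.+2%:Z :> int by lia.
have -> : - N.+1%:Z + 1 = - N%:Z :> int by lia.
ring.
Qed.

(** Moving the window by one exchanges one term at each end. *)
Lemma zs_shift_bound N f (K : R) (j : int) : (forall n, cmod (f n) <= K) ->
  cmod (zs N (fun n => f (n + j)) - zs N f) <= 2 * K * `|j|%N%:R.
Proof.
move=> HK.
have K0 : 0 <= K by rewrite (le_trans _ (HK 0)) ?cmod_ge0.
have pos (g : int -> C) (k : nat) : (forall n, cmod (g n) <= K) ->
    cmod (zs N (fun n => g (n + k%:Z)) - zs N g) <= 2 * K * k%:R.
  move=> Hg; elim: k => [|k IH].
    by rewrite (eq_zs _ (g := g)) ?subrr ?cmod0 ?mulr0// => n; rewrite addr0.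
  have -> : zs N (fun n => g (n + k.+1%:Z)) = zs N (fun n => (fun n => g (n + k%:Z)) (n + 1)).
    by apply: eq_zs => n; congr g; lia.
  rewrite (zs_shift N (fun n => g (n + k%:Z))).
  set A := zs N _ in IH *; set a := g _; set c := g _.
  have -> : A - a + c - zs N g = (A - zs N g) + (c - a) by ring.
  rewrite (le_trans (cmodD _ _))// -[k.+1]addn1 natrD mulrDr mulr1 lerD// (le_trans (cmodB _ _))//.
  by have := Hg (N.+1%:Z + k%:Z); have := Hg (- N%:Z + k%:Z); rewrite /a /c; lra.
case: j => j; first exact: pos.
rewrite NegzE abszN /= cmod_subC.
have -> : zs N f = zs N (fun n => (fun n => f (n - j.+1%:Z)) (n + j.+1%:Z)).
  by apply: eq_zs => n; congr f; lia.
by apply: pos.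
Qed.

Definition zsum f (l : C) : Prop := tends (zs^~ f) l.

Definition zlim f : C := xget 0 [set l | zsum f l].

Lemma zlim_eq f l : zsum f l -> zlim f = l.
Proof. by move=> fl; apply: xget_unique => // k fk; exact: tends_unique fk fl. Qed.

Lemma zsum_ext f g l : (forall n, f n = g n) -> zsum f l -> zsum g l.
Proof. by move=> /funext ->. Qed.

Lemma zsumD f g l k : zsum f l -> zsum g k -> zsum (fun n => f n + g n) (l + k).
Proof. by move=> fl gk; apply: tends_ext (tendsD fl gk) => N; rewrite zsD. Qed.

Lemma zsumB f g l k : zsum f l -> zsum g k -> zsum (fun n => f n - g n) (l - k).
Proof. by move=> fl gk; apply: tends_ext (tendsB fl gk) => N; rewrite zsB. Qed.

Lemma zsumZ (c : C) f l : zsum f l -> zsum (fun n => c * f n) (c * l).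
Proof. by move=> fl; apply: tends_ext (tendsZ c fl) => N; rewrite zsZ. Qed.

Lemma zsum_opp f l : zsum f l -> zsum (fun n => f (- n)) l.
Proof. by apply: tends_ext => N; rewrite zs_opp. Qed.

Lemma zsum_sum (I : Type) (r : seq I) (f : I -> int -> C) (l : I -> C) :
  (forall i, zsum (f i) (l i)) ->
  zsum (fun n => \sum_(i <- r) f i n) (\sum_(i <- r) l i).
Proof.
by move=> H; apply: tends_ext (tends_sum r H) => N; rewrite zs_sum.
Qed.

Lemma zsum_odd f : (forall n, f (- n) = - f n) -> zsum f 0.
Proof. by move=> H; apply: tends_ext (tends_cst 0) => N; rewrite zs_odd. Qed.

(** Pairing [n] with [- n] turns symmetric sums into one-sided ones. *)
Definition fold f (k : nat) : C := if k is 0%N then f 0 else f k%:Z + f (- k%:Z).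

Lemma zs_fold N f : zs N f = \sum_(k < N.+1) fold f k.
Proof.
elim: N => [|N IH]; first by rewrite zs0 big_ord1.
by rewrite zsS IH [RHS]big_ord_recr /= addrC.
Qed.

Lemma zs_sub_fold N M f : (N <= M)%N -> zs M f - zs N f = \sum_(N.+1 <= k < M.+1) fold f k.
Proof.
move=> NM; rewrite !zs_fold -!(big_mkord xpredT) (@big_cat_nat _ _ _ N.+1)//=.
by rewrite addrAC subrr add0r.
Qed.

Definition zdom f b := forall n, cmod (f n) <= b `|n|%N.

Lemma cmod_fold f b k : (forall n, 0 <= b n) -> zdom f b -> cmod (fold f k) <= 2 * b k.
Proof.
move=> b0 H; case: k => [|k] /=.
  by have := H 0; have := b0 0%N; rewrite /=; lra.
have := cmodD (f k.+1%:Z) (f (- k.+1%:Z)); have := H k.+1%:Z; have := H (- k.+1%:Z).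
by rewrite abszN /=; lra.
Qed.

Lemma zsum_abs f b : bsum b -> zdom f b -> exists l, zsum f l.
Proof.
move=> bb H.
have [l Hl] := @abs_series_cvg (fold f) (fun k => 2 * b k) (bsumZ (ler0n _ 2) bb)
  (fun k => cmod_fold k (bb.1) H).
exists l; apply: tends_ext (tends_sub _ Hl) => [N|N]; last exact: leqnSn.
by rewrite /= zs_fold.
Qed.

Lemma zlimP f b : bsum b -> zdom f b -> zsum f (zlim f).
Proof. by move=> bb /(zsum_abs bb)[l fl]; rewrite (zlim_eq fl). Qed.

Definition bbound b : R := 2 * sup (range (fun N => \sum_(k < N) b k)).

Lemma bbound_ge b N : bsum b -> 2 * \sum_(k < N) b k <= bbound b.
Proof.
move=> [b0 [B HB]]; rewrite ler_wpM2l//; apply: ub_le_sup; last by exists N.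
by exists B => _ [M _ <-].
Qed.

Lemma bbound_ge0 b : bsum b -> 0 <= bbound b.
Proof. by move=> bb; rewrite (le_trans _ (bbound_ge 0 bb))// big_ord0 mulr0. Qed.

Lemma zs_le f b (c : R) N : bsum b -> 0 <= c -> zdom f (fun n => c * b n) ->
  cmod (zs N f) <= c * bbound b.
Proof.
move=> bb c0 H; rewrite (le_trans _ (ler_wpM2l c0 (bbound_ge N.+1 bb)))// zs_fold.
rewrite (le_trans (cmod_sum _ _ _))// !mulr_sumr ler_sum// => i _.
rewrite mulrCA; apply: (cmod_fold i _ H) => n.
by rewrite mulr_ge0 ?(bsum_ge0 _ bb).
Qed.

Lemma zsum_le f b (c : R) l : bsum b -> 0 <= c -> zdom f (fun n => c * b n) ->
  zsum f l -> cmod l <= c * bbound b.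
Proof. by move=> bb c0 H; apply: tends_le => N; exact: zs_le. Qed.

(** Dominated convergence for series (Tannery). The window grows along with the
    parameter, which is what sums over growing boxes need. *)
Lemma tannery (F : nat -> int -> C) g b : bsum b -> (forall N, zdom (F N) b) ->
  (forall n, tends (F^~ n) (g n)) -> tends (fun N => zs N (F N)) (zlim g).
Proof.
move=> bb HF Hg.
have Hgb : zdom g b by move=> n; apply: tends_le (Hg n) => N; exact: HF.
have gl := zlimP bb Hgb.
suff H : tends (fun N => zs N (fun n => F N n - g n)) 0.
  have := tendsD H gl; rewrite add0r; apply: tends_ext => N.
  by rewrite zsB subrK.
move=> e e0; have e8 : 0 < e / 8 by rewrite divr_gt0.
have [N0 HN0] := bsum_tail bb e8.
have : tends (fun N => zs N0 (fun n => F N n - g n)) 0.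
  rewrite -[0](_ : \sum_(n <- zr N0) (g n - g n) = 0); last first.
    by rewrite big1// => n _; rewrite subrr.
  by apply: tends_sum => n; apply: tendsB => //; exact: tends_cst.
move=> /(_ (e / 2)) []; first by rewrite divr_gt0.
move=> N1 HN1; exists (maxn N0 N1) => N; rewrite geq_max => /andP[N0N N1N].
rewrite subr0; set h := fun n => F N n - g n.
rewrite -[zs N h](subrK (zs N0 h)) zs_sub_fold//.
have hdom : zdom h (fun k => 2 * b k).
  move=> n; rewrite (le_trans (cmodB _ _))//.
  by have := HF N n; have := Hgb n; lra.
have tail : cmod (\sum_(N0.+1 <= k < N.+1) fold h k) <= 4 * \sum_(N0 <= k < N.+1) b k.
  rewrite (le_trans (cmod_sum _ _ _))// mulr_sumr [leRHS]big_ltn ?ltnS//.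
  rewrite ler_wpDl ?mulr_ge0 ?(bsum_ge0 _ bb)// ler_sum_nat// => k _.
  rewrite (le_trans (cmod_fold _ _ hdom))//; last by lra.
  by move=> n; rewrite mulr_ge0 ?(bsum_ge0 _ bb).
have := HN0 N.+1 (leqW N0N); have := HN1 N N1N; rewrite subr0 -/h.
have := cmodD (\sum_(N0.+1 <= k < N.+1) fold h k) (zs N0 h).
lra.
Qed.

Definition zdom2 (f : int -> int -> C) b c := forall m n, cmod (f m n) <= b `|m|%N * c `|n|%N.

Lemma zdom2_row (f : int -> int -> C) b c : zdom2 f b c -> forall m, zdom (f m) (fun n => b `|m|%N * c n).
Proof. by move=> H m n; exact: H. Qed.

Lemma zdom2_zs (f : int -> int -> C) b c N : bsum b -> bsum c -> zdom2 f b c ->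
  zdom (fun m => zs N (f m)) (fun m => bbound c * b m).
Proof.
move=> bb bc H m; rewrite /= mulrC; apply: zs_le => //; first exact: bsum_ge0.
Qed.

Lemma zdom2_zlim (f : int -> int -> C) b c : bsum b -> bsum c -> zdom2 f b c ->
  zdom (fun m => zlim (f m)) (fun m => bbound c * b m).
Proof.
move=> bb bc H m; apply: (tends_le (u := fun N => zs N (f m))) => [N|].
  exact: (zdom2_zs N bb bc H m).
apply: zlimP (zdom2_row H m).
by apply: bsumZ => //; exact: bsum_ge0.
Qed.

(** Under a product majorant, sums over growing boxes tend to the iterated sum. *)
Lemma tannery2 (F : nat -> int -> int -> C) (g : int -> int -> C) b c : bsum b -> bsum c ->
  (forall N, zdom2 (F N) b c) ->
  (forall m n, tends (fun N => F N m n) (g m n)) ->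
  tends (fun N => zs N (fun m => zs N (F N m))) (zlim (fun m => zlim (g m))).
Proof.
move=> bb bc HF Hg; apply: (@tannery _ _ (fun m => bbound c * b m)).
- by apply: bsumZ => //; exact: bbound_ge0.
- by move=> N; exact: zdom2_zs.
- move=> m; apply: (@tannery _ _ (fun n => b `|m|%N * c n)) => //.
    by apply: bsumZ => //; exact: bsum_ge0.
  by move=> N; exact: zdom2_row.
Qed.

Lemma zs_add a k f : zs (a + k) f =
  zs a f + \sum_(i < k) (f (a + i.+1)%:Z + f (- (a + i.+1)%:Z)).
Proof.
elim: k => [|k IH]; first by rewrite addn0 big_ord0 addr0.
by rewrite addnS zsS IH big_ord_recr /= addnS; ring.
Qed.

Lemma zs_regroup (p : nat) N f :
  zs N (fun k => \sum_(m < p.+1) f (m%:Z + p.+1%:Z * k)) =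
  zs (p.+1 * N) f + \sum_(m < p) f (p.+1 * N + m.+1)%:Z.
Proof.
elim: N => [|N IH].
  rewrite zs0 muln0 zs0 big_ord_recl; congr (f _ + _); first by rewrite mulr0 addr0.
  by apply: eq_bigr => i _; congr f; rewrite lift0 mulr0 addr0.
rewrite zsS IH mulnSr zs_add big_split /=.
have -> : \sum_(m < p.+1) f (m%:Z + p.+1%:Z * N.+1%:Z) =
   f (p.+1 * N + p.+1)%:Z + \sum_(m < p) f (p.+1 * N + p.+1 + m.+1)%:Z.
  rewrite big_ord_recl; congr (f _ + _); first by rewrite /=; lia.
  by apply: eq_bigr => i _; congr f; rewrite lift0; lia.
have -> : \sum_(m < p.+1) f (m%:Z + p.+1%:Z * (- N.+1%:Z)) =
   \sum_(i < p.+1) f (- (p.+1 * N + i.+1)%:Z).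
  rewrite (reindex_inj rev_ord_inj); apply: eq_bigr => i _; congr f.
  by rewrite /= ; have := ltn_ord i; lia.
by rewrite [\sum_(i < p.+1) f (p.+1 * N + i.+1)%:Z]big_ord_recr /=; ring.
Qed.

(** Sorting the terms of a two-sided series into residue classes modulo [p] is
    legitimate even without absolute convergence, because the blocks are
    consecutive and the terms tend to zero. *)
Lemma zsum_regroup (p : nat) f l : (0 < p)%N -> tends (fun n => f n%:Z) 0 -> zsum f l ->
  zsum (fun k => \sum_(m < p) f (m%:Z + p%:Z * k)) l.
Proof.
case: p => // p _ f0 fl.
have H1 : tends (fun N => zs (p.+1 * N) f) l.
  by apply: (tends_sub _ fl) => N; rewrite mulSn leq_addr.
have H2 : tends (fun N => \sum_(m < p) f (p.+1 * N + m.+1)%:Z) 0.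
  have Hm (m : 'I_p) : tends (fun N => f (p.+1 * N + m.+1)%:Z) 0.
    apply: (tends_sub (phi := fun N => (p.+1 * N + m.+1)%N) _ f0) => N.
    by rewrite mulSn -addnA leq_addr.
  by have := tends_sum (index_enum 'I_p) Hm; rewrite [X in tends _ X]big1.
have := tendsD H1 H2; rewrite addr0; apply: tends_ext => N.
by rewrite zs_regroup.
Qed.

End Summation.

(** * Derivatives with quadratic remainder *)

Section Derivative.
Variable R : realType.
Local Notation C := R[i].
Implicit Types (z h l : C) (f g : C -> C).

(** A quadratic remainder, unlike a little-o, can be added up over the terms of a
    series. *)
Definition qderiv f z l : Prop := exists K r : R, [/\ 0 <= K, 0 < r &
  forall h, cmod h < r -> cmod (f (z + h) - f z - h * l) <= K * cmod h ^+ 2].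

Lemma qderiv_derive1 f z l : qderiv f z l -> @derive1 C C^o f z = l.
Proof.
move=> [K [r [K0 r0 H]]]; apply: cvg_lim; first exact: norm_hausdorff.
apply/cvgrPdist_lt => e; rewrite ltcE => /andP[/= /eqP Ie e0].
have d0 : 0 < Num.min r (complex.Re e / (K + 1)).
  by rewrite lt_min r0 divr_gt0//; lra.
apply/nbhs_ballP; exists (Num.min r (complex.Re e / (K + 1)))%:C.
  by rewrite /= ltcR.
move=> h; rewrite -ball_normE /= sub0r normrN cmodE ltcR lt_min => /andP[hr he] h0.
have hh0 : 0 < cmod h by rewrite cmod_gt0.
rewrite cmodE ltcE /= Ie eqxx /=.
have -> : l - h^-1 *: (f (h + z) - f z : C^o) = - h^-1 * (f (z + h) - f z - h * l).
  have -> : h^-1 *: (f (h + z) - f z : C^o) = h^-1 * (f (z + h) - f z).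
    by rewrite (addrC z).
  by field.
rewrite cmodM cmodN cmodV mulrC ltr_pdivrMr//.
apply: le_lt_trans (H _ hr) _; rewrite expr2 mulrA ltr_pM2r//.
move: he; rewrite ltr_pdivlMr; last by lra.
by apply: le_lt_trans; nra.
Qed.

Lemma qderiv_unique f z l k : qderiv f z l -> qderiv f z k -> l = k.
Proof. by move=> /qderiv_derive1 <- /qderiv_derive1 <-. Qed.

Lemma qderiv_near f g z l (r : R) : 0 < r ->
  (forall h, cmod h < r -> f (z + h) = g (z + h)) -> qderiv f z l -> qderiv g z l.
Proof.
move=> r0 fg [K [s [K0 s0 H]]]; exists K, (Num.min r s); split=> //.
  by rewrite lt_min r0.
move=> h; rewrite lt_min => /andP[hr hs]; rewrite -fg//.
by rewrite -[z in g z]addr0 -fg ?cmod0// addr0 H.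
Qed.

Lemma qderivD f g z l k : qderiv f z l -> qderiv g z k ->
  qderiv (fun w => f w + g w) z (l + k).
Proof.
move=> [K [r [K0 r0 Hf]]] [L [s [L0 s0 Hg]]]; exists (K + L), (Num.min r s).
split; rewrite ?addr_ge0// ?lt_min ?r0// => h; rewrite lt_min => /andP[/Hf {}Hf /Hg {}Hg].
have -> : f (z + h) + g (z + h) - (f z + g z) - h * (l + k) =
  (f (z + h) - f z - h * l) + (g (z + h) - g z - h * k) by ring.
by rewrite (le_trans (cmodD _ _))// mulrDl lerD.
Qed.

Lemma qderivZ (c : C) f z l : qderiv f z l -> qderiv (fun w => c * f w) z (c * l).
Proof.
move=> [K [r [K0 r0 Hf]]]; exists (cmod c * K), r; split=> //.
  by rewrite mulr_ge0 ?cmod_ge0.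
move=> h /Hf {}Hf.
have -> : c * f (z + h) - c * f z - h * (c * l) = c * (f (z + h) - f z - h * l) by ring.
by rewrite cmodM -mulrA ler_wpM2l ?cmod_ge0.
Qed.

Lemma qderiv_id z : qderiv id z 1.
Proof.
exists 0, 1; split=> // h _; rewrite (_ : _ - _ = 0) ?cmod0 ?mul0r//.
by rewrite mulr1; ring.
Qed.

Lemma qderiv_cst (c : C) z : qderiv (fun=> c) z 0.
Proof.
by exists 0, 1; split=> // h _; rewrite mulr0 subr0 subrr cmod0 mul0r.
Qed.

(** The assumption on [h] keeps [x + h] away from 0: its inverse is at most twice that
    of [x], whence the factors 2 in the induction on [k]. *)
Lemma inv_taylor (k : nat) : exists2 B : R, 0 <= B & forall x h,
  x != 0 -> 2 * cmod h <= cmod x ->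
  cmod ((x + h)^-1 ^+ k - x^-1 ^+ k + k%:R * h * x^-1 ^+ k.+1) <=
    B * cmod h ^+ 2 * cmod x^-1 ^+ k.+2.
Proof.
elim: k => [|k [B B0 IH]].
  by exists 0 => // x h _ _; rewrite !expr0 subrr !mul0r addr0 cmod0.
exists (2 * B + 2 * k%:R + 2) => [|x h x0 xh]; first by rewrite !addr_ge0// mulr_ge0.
have {}IH := IH x h x0 xh.
have cx : 0 < cmod x by rewrite cmod_gt0.
have xh_ge : cmod x <= 2 * cmod (x + h) by have := cmod_add_ge x h; lra.
have xh0 : x + h != 0 by rewrite -cmod_gt0; lra.
set V := (x + h)^-1 in IH *; set a := x^-1 in IH *.
have Va : cmod V <= 2 * cmod a.
  by rewrite /V /a !cmodV ler_pdivlMr// mulrC ler_pdivrMr ?cmod_gt0.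
have aV : V - a = - h * a * V by rewrite /V /a; field; rewrite x0 xh0.
have aVb : cmod (V - a) <= 2 * cmod h * cmod a ^+ 2.
  have -> : 2 * cmod h * cmod a ^+ 2 = cmod h * cmod a * (2 * cmod a) by ring.
  by rewrite aV !cmodM cmodN ler_wpM2l ?mulr_ge0 ?cmod_ge0.
have V1 : V - a + h * a ^+ 2 = h ^+ 2 * a ^+ 2 * V by rewrite /V /a; field; rewrite x0 xh0.
have V1b : cmod (V - a + h * a ^+ 2) <= 2 * cmod h ^+ 2 * cmod a ^+ 3.
  have -> : 2 * cmod h ^+ 2 * cmod a ^+ 3 = cmod h ^+ 2 * cmod a ^+ 2 * (2 * cmod a).
    by ring.
  by rewrite V1 2!cmodM !cmodX ler_wpM2l ?mulr_ge0 ?exprn_ge0 ?cmod_ge0.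
have -> : V ^+ k.+1 - a ^+ k.+1 + k.+1%:R * h * a ^+ k.+2 =
  V * (V ^+ k - a ^+ k + k%:R * h * a ^+ k.+1) - k%:R * h * a ^+ k.+1 * (V - a)
   + a ^+ k * (V - a + h * a ^+ 2).
  by rewrite -[k.+1%:R]natr1 !exprS; ring.
rewrite (le_trans (cmodD _ _))// (le_trans (lerD (cmodB _ _) (lexx _)))//.
rewrite !(cmodX, cmodM) cmod_nat.
set H := cmod h in xh IH aVb V1b *; set A := cmod a in Va IH aVb V1b *.
have A0 : 0 <= A := cmod_ge0 _; have H0 : 0 <= H := cmod_ge0 _.
have -> : (2 * B + 2 * k%:R + 2) * H ^+ 2 * A ^+ k.+3 =
  (2 * A) * (B * H ^+ 2 * A ^+ k.+2) + k%:R * H * A ^+ k.+1 * (2 * H * A ^+ 2)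
   + A ^+ k * (2 * H ^+ 2 * A ^+ 3) by rewrite !exprS; ring.
rewrite !lerD//.
- by rewrite ler_pM ?cmod_ge0.
- by rewrite ler_wpM2l ?mulr_ge0 ?exprn_ge0.
- by rewrite ler_wpM2l ?exprn_ge0.
Qed.

End Derivative.

(** * Decay of inverse powers on the lattice *)

Section Lattice.
Variable R : realType.
Local Notation C := R[i].
Implicit Types (z h : C) (m n : int) (k : nat).

(** The sequence [(n + 1)^(-3/2)]: the exponent is half of 3, so that cubic decay on the
    lattice has the product majorant of [wt3_le], and still larger than 1. *)
Definition b32 (n : nat) : R := (Num.sqrt n.+1%:R)^-1 ^+ 3.

Lemma b32_ge0 (n : nat) : 0 <= b32 n.
Proof. by rewrite exprn_ge0// invr_ge0 sqrtr_ge0. Qed.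

Lemma bsum_b32 : bsum b32.
Proof.
split=> [n|]; first exact: b32_ge0.
(* Telescoping, with the primitive [- 2 x^(-1/2)] of [x^(-3/2)]. *)
suff H N : \sum_(k < N.+1) b32 k <= 3 - 2 * (Num.sqrt N.+1%:R)^-1.
  exists 3 => -[|N]; first by rewrite big_ord0.
  rewrite (le_trans (H N))// gerBl mulr_ge0// invr_ge0 sqrtr_ge0//.
elim: N => [|N IH]; first by rewrite big_ord1 /b32 sqrtr1 invr1 expr1n; lra.
rewrite big_ord_recr /= (le_trans (lerD IH (lexx _)))// /b32.
set s := Num.sqrt N.+1%:R; set t := Num.sqrt N.+2%:R.
have s0 : 0 < s by rewrite sqrtr_gt0 ltr0n.
have t0 : 0 < t by rewrite sqrtr_gt0 ltr0n.
have st : s <= t by rewrite ler_wsqrtr// ler_nat.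
have ts : t ^+ 2 = s ^+ 2 + 1.
  by rewrite !sqr_sqrtr ?ler0n// -[N.+2]addn1 natrD.
suff : t^-1 ^+ 3 <= 2 * s^-1 - 2 * t^-1 by lra.
have -> : 2 * s^-1 - 2 * t^-1 = 2 * (t ^+ 2 - s ^+ 2) / (s * t * (s + t)).
  by field; rewrite !gt_eqF// addr_gt0.
rewrite ts [_ + 1]addrC addrK mulr1 ler_pdivlMr ?mulr_gt0 ?addr_gt0//.
by rewrite exprVn mulrC ler_pdivrMr ?exprn_gt0//; nra.
Qed.

Definition wt (m n : int) : R := (1 + `|m| + `|n|)%N%:R.

Lemma wt_ge1 m n : 1 <= wt m n. Proof. by rewrite ler1n. Qed.

Lemma wt3_le m n : (wt m n)^-1 ^+ 3 <= b32 `|m| * b32 `|n|.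
Proof.
rewrite /b32 -exprMn -invfM lerXn2r// ?nnegrE ?invr_ge0 ?mulr_ge0 ?sqrtr_ge0//.
rewrite -sqrtrM// lef_pV2 ?posrE ?(lt_le_trans ltr01 (wt_ge1 _ _))// ?sqrtr_gt0 ?mulr_gt0 ?ltr0n//.
rewrite -[leRHS]ger0_norm ?ler0n// -sqrtr_sqr ler_wsqrtr//.
rewrite -natrM -natrX ler_nat; nia.
Qed.

Lemma wt2_le n : (wt 0 n)^-1 ^+ 2 <= b32 `|n|.
Proof.
rewrite /b32 /wt /= !addn0 add1n; set s := Num.sqrt _.
have s1 : 1 <= s by rewrite -sqrtr1 ler_wsqrtr// ler1n.
have -> : (`|n|%N.+1%:R : R) = s ^+ 2 by rewrite sqr_sqrtr.
rewrite !exprVn -exprM lef_pV2 ?posrE ?exprn_gt0//; [|lra..].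
exact: ler_weXn2l.
Qed.

Section Tau.
Variable tau : C.
Hypothesis htau : 0 < complex.Im tau.

(** The imaginary part of [m tau + n] bounds [m]; then the real part bounds [n]. *)
Lemma lattice_lower : exists2 K : R, 0 < K & forall m n,
  `|m|%N%:R + `|n|%N%:R <= K * cmod (m%:~R * tau + n%:~R).
Proof.
case: tau htau => x y /= y0.
exists (1 + (1 + `|x|) / y); first by rewrite ltr_wpDr// divr_ge0 ?addr_ge0// ltW.
move=> m n; set g := (_ * _ + _).
have reint (k : int) : (k%:~R : C) = k%:~R%:C by rewrite rmorph_int.
have mE (k : int) : `|k|%N%:R = `|k%:~R : R|.
  by rewrite -cmod_real -reint cmod_int.
have Reg : complex.Re g = m%:~R * x + n%:~R by rewrite /g !reint /= mul0r subr0.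
have Img : complex.Im g = m%:~R * y by rewrite /g !reint /= mul0r !addr0.
have H1 : `|m|%N%:R * y <= cmod g.
  by rewrite mE -{1}(ger0_norm (ltW y0)) -normrM -Img Im_le_cmod.
have H2 : `|n|%N%:R <= cmod g + `|m|%N%:R * `|x|.
  rewrite !mE -normrM -[n%:~R](addKr (m%:~R * x)) -Reg addrC.
  by rewrite (le_trans (ler_normB _ _))// lerD2r Re_le_cmod.
have H3 : `|m|%N%:R <= cmod g / y by rewrite ler_pdivlMr.
have := normr_ge0 x; have := cmod_ge0 g.
have -> : (1 + (1 + `|x|) / y) * cmod g = cmod g + (1 + `|x|) * (cmod g / y) by ring.
nra.
Qed.

(** With the convention that the inverse of 0 is 0 this holds for lattice points
    [z] as well, only finitely many terms being concerned. *)
Lemma inv_bound z : exists2 K : R, 0 < K & forall m n,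
  cmod (z + m%:~R * tau + n%:~R)^-1 <= K * (wt m n)^-1.
Proof.
have [K0 K00 H0] := lattice_lower.
(* Beyond [N] the lattice point is at least twice as large as [z]; the sum [S] takes
   care of the finitely many others. *)
pose N := Num.truncn (2 * K0 * cmod z + 1).
pose F m n := wt m n * cmod (z + m%:~R * tau + n%:~R)^-1.
have F0 m n : 0 <= F m n by rewrite mulr_ge0 ?cmod_ge0 ?ler0n.
pose S := \sum_(m <- zr N) \sum_(n <- zr N) F m n.
have S0 : 0 <= S by apply: sumr_ge0 => m _; apply: sumr_ge0.
exists (4 * K0 + S) => [|m n]; first by rewrite ltr_wpDr// mulr_gt0.
have w0 : 0 < wt m n := lt_le_trans ltr01 (wt_ge1 m n).
rewrite ler_pdivlMr// mulrC -/(F m n).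
have [mnN|mnN] := leqP (`|m| + `|n|) N.
  suff : F m n <= S by lra.
  rewrite /S (bigD1_seq m) ?zr_uniq ?mem_zr//=; last by lia.
  rewrite (bigD1_seq n) ?zr_uniq ?mem_zr//=; last by lia.
  rewrite -addrA lerDl addr_ge0// ?sumr_ge0// => i _.
  by rewrite sumr_ge0.
suff : F m n <= 4 * K0 by lra.
have {}mnN : 2 * K0 * cmod z + 1 < `|m|%N%:R + `|n|%N%:R.
  rewrite -natrD -truncn_lt_nat//.
  by rewrite addr_ge0// !mulr_ge0 ?cmod_ge0 ?(ltW K00).
rewrite /F /wt -addnA natrD natrD; set s := (`|m|%N%:R + _) in mnN *.
have Hg := H0 m n; rewrite -/s in Hg.
have Hz := cmod_add_ge (m%:~R * tau + n%:~R) z.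
rewrite [_ + z]addrC addrA in Hz.
have Kz0 : 0 <= K0 * cmod z by rewrite mulr_ge0 ?cmod_ge0 ?ltW.
have Kz := ler_wpM2l (ltW K00) Hz; rewrite mulrBr in Kz.
have lower : s <= 2 * K0 * cmod (z + m%:~R * tau + n%:~R) by lra.
have c0 : 0 < cmod (z + m%:~R * tau + n%:~R) by rewrite -(pmulr_rgt0 _ K00); lra.
by rewrite cmodV ler_pdivrMr//; lra.
Qed.

End Tau.

Lemma inv_bound1 z : exists2 K : R, 0 < K & forall n,
  cmod (z + n%:~R)^-1 <= K * (wt 0 n)^-1.
Proof.
(* A row of any lattice will do. *)
have [|K K0 H] := @inv_bound 'i%C _ z; first by rewrite /= ltr01.
by exists K => // n; have := H 0 n; rewrite mul0r addr0.
Qed.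

End Lattice.

(** * Sums of inverse powers along a row *)

Section RowSums.
Variable R : realType.
Local Notation C := R[i].
Implicit Types (z h : C) (m n : int) (k : nat).

Lemma wt_gt0 m n : 0 < wt R m n. Proof. exact: lt_le_trans ltr01 (wt_ge1 _ _ _). Qed.

Lemma wtV_ge0 m n : 0 <= (wt R m n)^-1. Proof. by rewrite invr_ge0 ltW// wt_gt0. Qed.

Lemma wtV_le1 m n : (wt R m n)^-1 <= 1.
Proof. by rewrite invf_le1 ?wt_gt0// wt_ge1. Qed.

Lemma tends0_harm (u : nat -> C) (K : R) :
  (forall n : nat, cmod (u n) <= K * (wt R 0 n%:Z)^-1) -> tends u 0.
Proof.
move=> H e e0; exists (Num.truncn (K / e)) => n Hn; rewrite subr0.
apply: le_lt_trans (H n) _; rewrite ltr_pdivrMr ?wt_gt0// mulrC -ltr_pdivrMr//.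
rewrite /wt /= addn0 add1n; apply: lt_le_trans (truncnS_gt _) _.
by rewrite ler_nat ltnS.
Qed.

(** For integral [z] the singular term contributes 0; in particular [psi k 0] is the sum
    over the nonzero integers. *)
Definition psi k z : C := zlim (fun n => (z + n%:~R)^-1 ^+ k).

Lemma wtVX_le m n k j : (j <= k)%N -> (wt R m n)^-1 ^+ k <= (wt R m n)^-1 ^+ j.
Proof. by move=> jk; rewrite ler_wiXn2l ?wtV_ge0 ?wtV_le1. Qed.

Lemma cmodVX_le (x : C) (K w : R) k : 0 <= w -> cmod x <= K * w -> cmod (x ^+ k) <= K ^+ k * w ^+ k.
Proof.
move=> w0 H; rewrite cmodX -exprMn lerXn2r// ?nnegrE ?cmod_ge0//.
exact: le_trans (cmod_ge0 _) H.
Qed.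

Lemma psi_dom k z : (1 < k)%N -> exists2 K : R, 0 <= K &
  zdom (fun n => (z + n%:~R)^-1 ^+ k) (fun j => K * b32 R j).
Proof.
move=> k1; have [K K0 H] := inv_bound1 z; exists (K ^+ k) => [|n].
  by rewrite exprn_ge0// ltW.
apply: le_trans (cmodVX_le k (wtV_ge0 0 n) (H n)) _.
rewrite ler_wpM2l ?exprn_ge0 ?(ltW K0)//.
exact: le_trans (wtVX_le _ _ k1) (wt2_le _ _).
Qed.

(** The bound that makes the Weierstrass regularization converge; it also covers
    the cases where [g] or [z + g] vanishes and the inverse is 0 by convention. *)
Lemma inv_sub_bound (z g : C) (K L w : R) : 0 <= w ->
  cmod (z + g)^-1 <= K * w -> cmod g^-1 <= L * w -> (g = 0 -> w = 1) ->
  cmod ((z + g)^-1 - g^-1) <= (cmod z * L * (K + L) + cmod z^-1) * w ^+ 2.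
Proof.
move=> w0 HK HL Hw.
have Kw : 0 <= K * w := le_trans (cmod_ge0 _) HK.
have Lw : 0 <= L * w := le_trans (cmod_ge0 _) HL.
have [g0|g0] := eqVneq g 0.
  move: HK HL Kw Lw; rewrite (Hw g0) g0 addr0 invr0 subr0 !mulr1 expr1n cmod0 mulr1 => HK HL _ _.
  have K0 : 0 <= K := le_trans (cmod_ge0 _) HK.
  by rewrite lerDr !(mulr_ge0, addr_ge0) ?cmod_ge0.
have zV : 0 <= cmod z^-1 * w ^+ 2 by rewrite mulr_ge0 ?cmod_ge0 ?exprn_ge0.
have -> : (cmod z * L * (K + L) + cmod z^-1) * w ^+ 2 =
  cmod z * (L * w) * (K * w) + cmod z * (L * w) * (L * w) + cmod z^-1 * w ^+ 2 by ring.
have [zg0|zg0] := eqVneq (z + g) 0.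
  have gz : z = - g by apply/eqP; rewrite -subr_eq0 opprK zg0.
  have gp : 0 < cmod g by rewrite cmod_gt0.
  rewrite zg0 invr0 sub0r cmodN.
  have -> : cmod g^-1 = cmod z * cmod g^-1 * cmod g^-1.
    by rewrite gz cmodN !cmodV; field; rewrite gt_eqF.
  have A : cmod z * cmod g^-1 * cmod g^-1 <= cmod z * (L * w) * (L * w).
    by rewrite -!mulrA ler_wpM2l ?cmod_ge0// !mulrA -expr2 -[leRHS]mulrA -expr2 lerXn2r ?nnegrE ?cmod_ge0.
  have : 0 <= cmod z * (L * w) * (K * w).
    by apply: mulr_ge0 => //; apply: mulr_ge0 => //; exact: cmod_ge0.
  lra.
have -> : (z + g)^-1 - g^-1 = - z * g^-1 * (z + g)^-1 by field; rewrite g0 zg0.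
rewrite !cmodM cmodN.
have A : cmod z * cmod g^-1 * cmod (z + g)^-1 <= cmod z * (L * w) * (K * w).
  by rewrite ler_pM ?mulr_ge0 ?cmod_ge0// ler_wpM2l ?cmod_ge0.
have : 0 <= cmod z * (L * w) * (L * w).
  by apply: mulr_ge0 => //; apply: mulr_ge0 => //; exact: cmod_ge0.
lra.
Qed.

Lemma psiP k z : (0 < k)%N -> zsum (fun n => (z + n%:~R)^-1 ^+ k) (psi k z).
Proof.
case: k => // -[|k] _; last first.
  have [K K0 H] := @psi_dom k.+2 z isT.
  exact: zlimP (bsumZ K0 (bsum_b32 R)) H.
(* For [k = 1], subtracting the odd series [1 / n] restores absolute convergence. *)
suff [l Hl] : exists l, zsum (fun n => (z + n%:~R)^-1 ^+ 1) l by rewrite /psi (zlim_eq Hl).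
have [K K0 HK] := inv_bound1 z; have [L L0 HL] := inv_bound1 (0 : C).
pose B := cmod z * L * (K + L) + cmod z^-1.
have B0 : 0 <= B by rewrite addr_ge0 ?mulr_ge0 ?cmod_ge0 ?addr_ge0// ltW.
have [l Hl] : exists l, zsum (fun n => (z + n%:~R)^-1 - (n%:~R)^-1) l.
  apply: (zsum_abs (bsumZ B0 (bsum_b32 R))) => n.
  have HLn : cmod (n%:~R : C)^-1 <= L * (wt R 0 n)^-1 by have := HL n; rewrite add0r.
  have Hw : n%:~R = 0 :> C -> (wt R 0 n)^-1 = 1.
    by move=> /eqP; rewrite intr_eq0 => /eqP ->; rewrite /wt /= invr1.
  apply: le_trans (inv_sub_bound (wtV_ge0 0 n) (HK n) HLn Hw) _.
  by rewrite ler_wpM2l// wt2_le.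
exists l; have Hodd : zsum (fun n => (n%:~R)^-1 : C) 0.
  by apply: zsum_odd => n; rewrite mulrNz invrN.
have := zsumD Hl Hodd; rewrite addr0; apply: zsum_ext => n.
by rewrite subrK expr1.
Qed.

Lemma psi_eq k z l : (0 < k)%N -> zsum (fun n => (z + n%:~R)^-1 ^+ k) l -> psi k z = l.
Proof. by move=> k0 H; apply: zlim_eq. Qed.

Lemma psi_opp k z : (0 < k)%N -> psi k (- z) = (-1) ^+ k * psi k z.
Proof.
move=> k0; apply: psi_eq => //; have := zsum_opp (zsumZ ((-1) ^+ k) (psiP z k0)).
apply: zsum_ext => n; rewrite -exprMn; congr (_ ^+ k).
by rewrite mulN1r -invrN mulrNz opprD opprK.
Qed.

Lemma zsum_shift (f : int -> C) l : tends (fun n : nat => f n%:Z) 0 ->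
  tends (fun n : nat => f (- n%:Z)) 0 ->
  zsum f l -> zsum (fun n => f (n + 1)) l.
Proof.
move=> H1 H2 fl; have H3 := tends_sub (phi := S) leqnSn H1.
have := tendsD (tendsB fl H2) H3; rewrite subr0 addr0; apply: tends_ext => N.
by rewrite zs_shift.
Qed.

Lemma psi_term0 k z : (0 < k)%N ->
  tends (fun n : nat => (z + n%:Z%:~R)^-1 ^+ k) 0 /\
  tends (fun n : nat => (z + (- n%:Z)%:~R)^-1 ^+ k) 0.
Proof.
move=> k0; have [K K0 HK] := inv_bound1 z.
have H n : cmod ((z + n%:~R)^-1 ^+ k) <= K ^+ k * (wt R 0 n)^-1.
  apply: le_trans (cmodVX_le k (wtV_ge0 0 n) (HK n)) _.
  by rewrite ler_wpM2l ?exprn_ge0 ?(ltW K0)// -[leRHS]expr1 wtVX_le.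
split; apply: (@tends0_harm _ (K ^+ k)) => n; first exact: H.
by apply: le_trans (H _) _; rewrite /wt abszN.
Qed.

Lemma psi_add1 k z : (0 < k)%N -> psi k (z + 1) = psi k z.
Proof.
move=> k0; apply: psi_eq => //; have [H1 H2] := psi_term0 z k0.
have := zsum_shift H1 H2 (psiP z k0); apply: zsum_ext => n.
by rewrite intrD addrA addrAC.
Qed.

Lemma psi_addn k z (n : nat) : (0 < k)%N -> psi k (z + n%:R) = psi k z.
Proof.
move=> k0; elim: n => [|n IH]; first by rewrite addr0.
by rewrite -natr1 addrA psi_add1.
Qed.

Lemma psi_addz k z n : (0 < k)%N -> psi k (z + n%:~R) = psi k z.
Proof.
move=> k0; case: n => n; first exact: psi_addn.
by rewrite NegzE -[LHS](psi_addn _ n.+1)// mulrNz pmulrn subrK.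
Qed.

(** The distribution relation: the terms of the right hand side are sorted by their
    residue modulo [p]. *)
Lemma psi_dist k (p : nat) z : (0 < k)%N -> (0 < p)%N ->
  \sum_(r < p) psi k ((z + r%:R) / p%:R) = p%:R ^+ k * psi k z.
Proof.
move=> k0 p0; have pn : (p%:R : C) != 0 by rewrite pnatr_eq0 -lt0n.
have H1 := zsum_regroup p0 (proj1 (psi_term0 z k0)) (psiP z k0).
have H2 : zsum (fun n => \sum_(r < p) ((z + r%:R) / p%:R + n%:~R)^-1 ^+ k)
               (\sum_(r < p) psi k ((z + r%:R) / p%:R)).
  by apply: zsum_sum => r; exact: psiP.
apply: (tends_unique H2); have := zsumZ (p%:R ^+ k) H1; apply: zsum_ext => n.
rewrite mulr_sumr; apply: eq_bigr => r _; rewrite -exprMn; congr (_ ^+ k).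
rewrite intrD intrM -pmulrn.
rewrite -[p%:R in LHS]invrK -invfM; congr (_^-1).
by rewrite -[p%:Z%:~R]pmulrn; field.
Qed.

(** Termwise Taylor expansion. The constant [B] depends on [k] only and the weight [w] is
    that of the whole row, so that these estimates can be summed over rows. *)
Lemma psi_taylor k : (0 < k)%N -> exists2 B : R, 0 <= B & forall (K w : R) z h,
  0 < K -> 0 <= w -> (forall n, z + n%:~R != 0) ->
  (forall n, cmod (z + n%:~R)^-1 ^+ k.+2 <= K * (w * b32 R `|n|)) ->
  (forall n, 2 * cmod h <= cmod (z + n%:~R)) ->
  cmod (psi k (z + h) - psi k z - h * (- k%:R * psi k.+1 z)) <= B * cmod h ^+ 2 * K * w.
Proof.
move=> k0; have [B B0 HB] := inv_taylor R k; exists (B * bbound (b32 R)).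
  by rewrite mulr_ge0// bbound_ge0//; exact: bsum_b32.
move=> K w z h K0 w0 z0 HK Hh.
have -> : B * bbound (b32 R) * cmod h ^+ 2 * K * w =
  (B * cmod h ^+ 2 * K * w) * bbound (b32 R) by ring.
have S1 := psiP (z + h) k0; have S2 := psiP z k0.
have S3 := zsumZ (k%:R * h) (psiP z (ltn0Sn k)).
have -> : psi k (z + h) - psi k z - h * (- k%:R * psi k.+1 z) =
  psi k (z + h) - psi k z + k%:R * h * psi k.+1 z by ring.
apply: zsum_le (zsumD (zsumB S1 S2) S3); first exact: bsum_b32.
  by rewrite !mulr_ge0 ?exprn_ge0 ?cmod_ge0 ?(ltW K0).
move=> n; rewrite (addrAC z h); apply: le_trans (HB _ _ (z0 n) (Hh n)) _.
by rewrite -!mulrA ler_wpM2l// ler_wpM2l ?cmod_ge0// ler_wpM2l ?cmod_ge0.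
Qed.

Lemma inv_lower (x : C) (K w : R) : 0 < K -> 0 < w -> w <= 1 -> x != 0 ->
  cmod x^-1 <= K * w -> K^-1 <= cmod x.
Proof.
move=> K0 w0 w1 x0; rewrite cmodV => H.
have cx : 0 < cmod x by rewrite cmod_gt0.
rewrite -[cmod x]invrK lef_pV2 ?posrE ?invr_gt0//.
by rewrite (le_trans H)// ger_pMr.
Qed.

Lemma psi_qderiv k z : (0 < k)%N -> (forall n, z + n%:~R != 0) ->
  qderiv (psi k) z (- k%:R * psi k.+1 z).
Proof.
move=> k0 z0; have [B B0 HB] := psi_taylor k0; have [K K0 HK] := inv_bound1 z.
exists (B * K ^+ k.+2), (K^-1 / 2).
split; first by rewrite mulr_ge0 ?exprn_ge0 ?(ltW K0).
  by rewrite divr_gt0 ?invr_gt0.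
move=> h hr; have := HB (K ^+ k.+2) 1 z h; rewrite mulr1 mulrAC; apply=> //.
- by rewrite exprn_gt0.
- move=> n; rewrite mul1r -cmodX.
  apply: le_trans (cmodVX_le k.+2 (wtV_ge0 0 n) (HK n)) _.
  rewrite ler_wpM2l ?exprn_ge0 ?(ltW K0)//.
  by apply: le_trans (wtVX_le _ _ _) (wt2_le _ _).
- move=> n; have := inv_lower K0 _ (wtV_le1 0 n) (z0 n) (HK n).
  rewrite invr_gt0 wt_gt0 => /(_ isT); move: hr; rewrite ltr_pdivlMr//; lra.
Qed.

End RowSums.

(** * Estimates for the exponential function *)

Section RealBounds.
Variable R : realType.
Implicit Types s t x : R.

Lemma mean_value (f df : R -> R) (a b : R) : a <= b ->
  (forall x, is_derive x (1 : R) f (df x)) ->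
  exists2 c, a <= c <= b & f b - f a = df c * (b - a).
Proof.
move=> ab H.
have fc : {within `[a, b], continuous f}.
  apply: continuous_subspaceT => y.
  by apply: differentiable_continuous; apply/derivable1_diffP; have [] := H y.
have [c] := MVT_segment ab (fun x _ => H x) fc.
by rewrite in_itv /= => Hc E; exists c.
Qed.

Lemma sin_le_id t : 0 <= t -> `|sin t| <= t.
Proof.
move=> t0; have [c _] := mean_value t0 (fun x => is_derive_sin x).
rewrite sin0 !subr0 => ->; rewrite normrM (ger0_norm t0).
by rewrite ler_piMl// cos_max.
Qed.

Lemma sin_norm_le t : `|sin t| <= `|t|.
Proof.
have [t0|t0] := leP 0 t; first by rewrite [leRHS]ger0_norm// sin_le_id.
by rewrite -normrN -sinN (ltr0_norm t0) sin_le_id// oppr_ge0 ltW.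
Qed.

Lemma cos_half t : 1 - cos t = 2 * sin (t / 2) ^+ 2.
Proof.
have -> : cos t = cos (t / 2 *+ 2) by congr cos; rewrite -mulr_natr divfK.
by rewrite cos_mulr2n cos2sin2; ring.
Qed.

Lemma cos_sub1_sqr t : 0 <= 1 - cos t <= t ^+ 2.
Proof.
rewrite cos_half mulr_ge0 ?sqr_ge0//=.
have := sin_norm_le (t / 2); rewrite -(@ler_pXn2r _ 2) ?nnegrE//.
rewrite !real_normK ?num_real// expr_div_n; have := sqr_ge0 t; lra.
Qed.

Lemma cos_sub1_norm t : 1 - cos t <= `|t|.
Proof.
rewrite cos_half; have := sin_norm_le (t / 2).
rewrite normrM [ `|2^-1|]ger0_norm//; have := sin_max (t / 2).
have := normr_ge0 (sin (t / 2)); rewrite -[sin _ ^+ 2]real_normK ?num_real// expr2.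
nra.
Qed.

Lemma sin_sub_id t : `|sin t - t| <= t ^+ 2.
Proof.
have pos (u : R) : 0 <= u -> `|sin u - u| <= u ^+ 2.
  move=> u0; have [c /andP[c0 cu]] := mean_value u0 (fun x => is_derive_sin x).
  rewrite sin0 !subr0 => ->; rewrite -[X in _ - X]mul1r -mulrBl normrM (ger0_norm u0) expr2.
  rewrite ler_wpM2r// distrC ger0_norm; last by rewrite subr_ge0 cos_le1.
  by rewrite (le_trans (cos_sub1_norm c))// ger0_norm.
have [t0|t0] := leP 0 t; first exact: pos.
rewrite -[t]opprK sinN -opprD normrN sqrrN; apply: pos.
by rewrite oppr_ge0 ltW.
Qed.

(** Below [pi / 4] the cosine is at least [1 / 2]; above it the sine is at least [1 / 2]
    and [t] is less than 2. *)
Lemma sin_ge_quarter t : 0 <= t <= pi / 2 -> t / 4 <= sin t.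
Proof.
move=> /andP[t0 tpi]; have ph := @pihalf_lt2 R; have pg := @pi_gt0 R.
have c4 : cos (pi / 4 : R) ^+ 2 = 1 / 2.
  have := cos_mulr2n (pi / 4 : R); rewrite (_ : pi / 4 *+ 2 = pi / 2) ?cos_pihalf.
    by move=> /eqP; rewrite eq_sym subr_eq0 -mulr_natr => /eqP H; lra.
  by rewrite -mulr_natr; field.
have c4g : 1 / 2 <= cos (pi / 4 : R).
  have : 0 < cos (pi / 4 : R) by apply: cos_gt0_pihalf; lra.
  nra.
have s4g : 1 / 2 <= sin (pi / 4 : R).
  have : 0 < sin (pi / 4 : R) by apply: sin_gt0_pihalf; lra.
  have := sin2cos2 (pi / 4 : R); rewrite c4; nra.
have [t4|t4] := leP t (pi / 4).
  have [c /andP[c0 ct]] := mean_value t0 (fun x => is_derive_sin x).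
  rewrite sin0 !subr0 => ->.
  suff : cos (pi / 4) <= cos c by nra.
  rewrite leNgt ltr_cos -?leNgt ?in_itv /=; lra.
suff : sin (pi / 4) <= sin t by lra.
by rewrite leNgt ltr_sin -?leNgt ?in_itv /=; lra.
Qed.

Lemma expR_sub1_ge s : `|s| * expR (- `|s|) <= `|expR s - 1|.
Proof.
have [s0|s0] := leP 0 s.
  rewrite ger0_norm// ger0_norm; last by rewrite subr_ge0 -expR0 ler_expR.
  have : expR (- s) <= 1 by rewrite -expR0 ler_expR oppr_le0.
  have := expR_ge1Dx s; have := expR_ge0 (- s); nra.
rewrite ltr0_norm// opprK ltr0_norm; last by rewrite subr_lt0 -expR0 ltr_expR.
have := expR_ge1Dx (- s); have := expRxMexpNx_1 s; have := expR_gt0 s; nra.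
Qed.

Lemma expR_sub1_le s : `|expR s - 1| <= `|s| * expR `|s|.
Proof.
have [s0|s0] := leP 0 s.
  rewrite !ger0_norm//; last by rewrite subr_ge0 -expR0 ler_expR.
  have := expR_ge1Dx (- s); have := expRxMexpNx_1 s; have := expR_gt0 s; nra.
rewrite !ltr0_norm//; last by rewrite subr_lt0 -expR0 ltr_expR.
have := expR_ge1Dx s; have : 1 <= expR (- s) by rewrite -expR0 ler_expR; lra.
nra.
Qed.

Lemma expR_sub1_id s : `|expR s - 1 - s| <= s ^+ 2 * expR `|s|.
Proof.
have H0 : 0 <= expR s - 1 - s by have := expR_ge1Dx s; lra.
rewrite ger0_norm//.
have : expR s - 1 - s <= s * (expR s - 1).
  have := expR_ge1Dx (- s); have := expRxMexpNx_1 s; have := expR_gt0 s; nra.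
move=> /le_trans; apply; apply: le_trans (ler_norm _) _; rewrite normrM.
rewrite -[s ^+ 2]real_normK ?num_real// expr2 -mulrA ler_wpM2l//.
exact: expR_sub1_le.
Qed.

End RealBounds.

Section Exponential.
Variable R : realType.
Local Notation C := R[i].
Implicit Types (x y z h : C).

Lemma cmod_sqr z : cmod z ^+ 2 = complex.Re z ^+ 2 + complex.Im z ^+ 2.
Proof. by case: z => a b; rewrite /cmod /= sqr_sqrtr// addr_ge0 ?sqr_ge0. Qed.

Lemma cexpE z : cexp z = (expR (complex.Re z) * cos (complex.Im z)) +i*
   (expR (complex.Re z) * sin (complex.Im z)).
Proof. by rewrite /cexp; apply/eqP; rewrite eq_complex /= !mul0r subr0 addr0 !eqxx. Qed.

Lemma cexpD x y : cexp (x + y) = cexp x * cexp y.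
Proof.
rewrite !cexpE; case: x => a b; case: y => c d /=.
by rewrite expRD cosD sinD; apply/eqP; rewrite eq_complex /=; apply/andP; split; apply/eqP; ring.
Qed.

Lemma cexp0 : cexp 0 = 1 :> C.
Proof. by rewrite cexpE /= expR0 cos0 sin0 mulr0 mulr1. Qed.

Lemma cmod_cexp z : cmod (cexp z) = expR (complex.Re z).
Proof.
apply/eqP; rewrite -(@eqrXn2 _ 2) ?cmod_ge0 ?expR_ge0//.
by rewrite cmod_sqr cexpE /= !exprMn -mulrDr cos2Dsin2 mulr1.
Qed.

Lemma cexp_neq0 z : cexp z != 0.
Proof. by rewrite -cmod_gt0 cmod_cexp expR_gt0. Qed.

Lemma cexpMn z (n : nat) : cexp (n%:R * z) = cexp z ^+ n.
Proof.
elim: n => [|n IH]; first by rewrite mul0r cexp0 expr0.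
by rewrite -natr1 mulrDl mul1r cexpD IH exprSr.
Qed.

Lemma cexp_taylor x : cmod (cexp x - 1 - x) <= 3 * cmod x ^+ 2 * expR (cmod x).
Proof.
rewrite (le_trans (cmod_le_ReIm _))// cmod_sqr.
have sx := Re_le_cmod x.
rewrite cexpE; move: (cmod x) sx => N; case: x => s t /= sx.
have E1 : 1 <= expR N by rewrite -expR0 ler_expR (le_trans _ sx).
have es : expR `|s| <= expR N by rewrite ler_expR.
have es' : expR s <= expR N by rewrite ler_expR (le_trans (ler_norm s)).
have A : `|expR s * cos t - 1 - s| <= s ^+ 2 * expR N + expR N * t ^+ 2.
  have -> : expR s * cos t - 1 - s = (expR s - 1 - s) - expR s * (1 - cos t) by ring.
  rewrite (le_trans (ler_normB _ _))// lerD//.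
    by rewrite (le_trans (expR_sub1_id s))// ler_wpM2l ?sqr_ge0.
  have /andP[c0 c1] := cos_sub1_sqr t.
  by rewrite ger0_norm ?mulr_ge0 ?expR_ge0// ler_pM ?expR_ge0.
have B : `|expR s * sin t - 0 - t| <= `|s| * expR N * `|t| + expR N * t ^+ 2.
  have -> : expR s * sin t - 0 - t = (expR s - 1) * sin t + (sin t - t) by ring.
  rewrite (le_trans (ler_normD _ _))// lerD//.
    rewrite normrM ler_pM ?sin_norm_le// (le_trans (expR_sub1_le s))//.
    by rewrite ler_wpM2l.
  by rewrite (le_trans (sin_sub_id t))// ler_peMl// sqr_ge0.
apply: le_trans (lerD A B) _.
have -> : s ^+ 2 * expR N + expR N * t ^+ 2 + (`|s| * expR N * `|t| + expR N * t ^+ 2) =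
  (s ^+ 2 + 2 * t ^+ 2 + `|s| * `|t|) * expR N by ring.
rewrite ler_wpM2r ?expR_ge0//.
have := real_normK (num_real s); have := real_normK (num_real t).
have := sqr_ge0 (`|s| - `|t|); rewrite sqrrB; nra.
Qed.

(** A quantitative form of the fact that 0 is the only zero of [exp x - 1] in this strip,
    and a simple one. It follows from
    [|exp x - 1|^2 = (exp s - 1)^2 + 2 exp s (1 - cos t)] for [x = s + i t]. *)
Lemma cexp_sub1_ge x : `|complex.Im x| <= pi ->
  cmod x * expR (- `|complex.Re x|) / 4 <= cmod (cexp x - 1).
Proof.
move=> xpi; rewrite -(@ler_pXn2r _ 2) ?nnegrE ?cmod_ge0//; last first.
  by rewrite divr_ge0// mulr_ge0 ?cmod_ge0 ?expR_ge0.
rewrite !exprMn !cmod_sqr cexpE.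
case: x xpi => s t /= tpi; rewrite subr0.
have -> : (expR s * cos t - 1) ^+ 2 + (expR s * sin t) ^+ 2 =
  (expR s - 1) ^+ 2 + 2 * expR s * (1 - cos t).
  have := cos2Dsin2 t => H.
  have -> : (expR s * cos t - 1) ^+ 2 + (expR s * sin t) ^+ 2 =
    expR s ^+ 2 * (cos t ^+ 2 + sin t ^+ 2) - 2 * expR s * cos t + 1 by ring.
  by rewrite H; ring.
have H1 : s ^+ 2 * expR (- `|s|) ^+ 2 <= (expR s - 1) ^+ 2.
  have := expR_sub1_ge s; rewrite -(@ler_pXn2r _ 2) ?nnegrE ?mulr_ge0 ?expR_ge0//.
  by rewrite exprMn !real_normK ?num_real.
have H2 : t ^+ 2 / 32 <= 1 - cos t.
  have tt : 0 <= `|t| / 2 <= pi / 2 by rewrite divr_ge0//=; lra.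
  have := sin_ge_quarter tt; rewrite -(cos_norm t) cos_half -(real_normK (num_real t)).
  have := normr_ge0 t; nra.
have e1 : expR (- `|s|) <= 1 by rewrite -expR0 ler_expR oppr_le0.
have H3 : expR (- `|s|) ^+ 2 <= expR s.
  have : expR (- `|s|) <= expR s by rewrite ler_expR lerNl -normrN ler_norm.
  have := expR_ge0 (- `|s|); nra.
have H4 : expR (- `|s|) ^+ 2 * (t ^+ 2 / 32) <= expR s * (1 - cos t).
  by rewrite ler_pM ?sqr_ge0// divr_ge0 ?sqr_ge0.
have := mulr_ge0 (sqr_ge0 s) (sqr_ge0 (expR (- `|s|))).
rewrite exprVn; nra.
Qed.

End Exponential.

(** * Cotangent and cosecant near their poles *)

Section Cotangent.
Variable R : realType.
Local Notation C := R[i].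
Implicit Types (x y z h : C) (k : nat).

Local Notation tpi := (two_pi_i R).

Definition ee z : C := cexp (tpi * z).

Lemma tpiE z : tpi * z = (- (2 * pi * complex.Im z)) +i* (2 * pi * complex.Re z).
Proof.
rewrite /two_pi_i; case: z => a b; apply/eqP; rewrite eq_complex /=.
by apply/andP; split; apply/eqP; ring.
Qed.

Lemma cmod_tpi : cmod tpi = 2 * pi.
Proof.
rewrite /two_pi_i cmodM cmod_real (_ : cmod 'i%C = 1) ?mulr1.
  by rewrite ger0_norm// mulr_ge0// pi_ge0.
by rewrite /cmod /= expr0n expr1n /= add0r sqrtr1.
Qed.

Lemma tpi_neq0 : tpi != 0.
Proof. by rewrite -cmod_gt0 cmod_tpi mulr_gt0// pi_gt0. Qed.

Lemma eeD x y : ee (x + y) = ee x * ee y.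
Proof. by rewrite /ee mulrDr cexpD. Qed.

Lemma ee_neq0 z : ee z != 0. Proof. exact: cexp_neq0. Qed.

Lemma cmod_ee z : cmod (ee z) = expR (- (2 * pi * complex.Im z)).
Proof. by rewrite /ee cmod_cexp tpiE. Qed.

Lemma eeMn (n : nat) z : ee (n%:R * z) = ee z ^+ n.
Proof. by rewrite /ee mulrCA cexpMn. Qed.

Lemma ee1 : ee 1 = 1.
Proof.
rewrite /ee tpiE cexpE /= mulr0 oppr0 expR0 !mul1r mulr1 mulr_natl cos2pi sin2pi.
by [].
Qed.

Lemma ee_half : ee 2^-1 = -1.
Proof.
have -> : (2^-1 : C) = (2^-1 : R)%:C by rewrite fmorphV rmorph_nat.
rewrite /ee tpiE cexpE /= mulr0 oppr0 expR0 !mul1r (_ : 2 * pi / 2 = pi); last by field.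
by rewrite cospi sinpi; apply/eqP; rewrite eq_complex /= oppr0 !eqxx.
Qed.

Lemma ee_addz z (n : int) : ee (z + n%:~R) = ee z.
Proof.
have nat1 w (j : nat) : ee (w + j%:R) = ee w.
  by rewrite eeD -[j%:R]mulr1 eeMn ee1 expr1n mulr1.
case: n => n; first exact: nat1.
by rewrite NegzE -[LHS](nat1 _ n.+1) mulrNz pmulrn subrK.
Qed.

Definition pi_cot z : C := tpi / 2 * (ee z + 1) / (ee z - 1).
Definition pi_csc_sqr z : C := tpi ^+ 2 * ee z / (1 - ee z) ^+ 2.

(** The same duplication formula holds for [psi 2], by [psi_dist]. *)
Lemma pi_csc_sqr_half z : ee z != 1 -> pi_csc_sqr z = (pi_csc_sqr (z / 2) + pi_csc_sqr ((z + 1) / 2)) / 4.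
Proof.
move=> z1; have Ez : ee z = ee (z / 2) ^+ 2.
  by rewrite -eeMn; congr ee; field.
have Ez1 : ee ((z + 1) / 2) = - ee (z / 2).
  by rewrite mulrDl eeD mul1r ee_half mulrN1.
rewrite Ez in z1; rewrite /pi_csc_sqr Ez Ez1; set v := ee _ in z1 *.
have v1 : 1 - v != 0 by apply: contra z1; rewrite subr_eq0 => /eqP <-; rewrite expr1n.
have v2 : 1 + v != 0 by apply: contra z1; rewrite addrC addr_eq0 => /eqP ->; rewrite sqrrN expr1n.
by field; rewrite opprK v1 v2 subr_eq0 eq_sym z1.
Qed.

Lemma ee_sub1_ge z (Y : R) : `|complex.Re z| <= 1 / 2 -> `|complex.Im z| <= Y ->
  cmod (tpi * z) * expR (- (2 * pi * Y)) / 4 <= cmod (ee z - 1).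
Proof.
move=> rz iz; have pg := @pi_gt0 R.
have := @cexp_sub1_ge R (tpi * z); rewrite -/(ee z).
have -> : `|complex.Im (tpi * z)| = 2 * pi * `|complex.Re z|.
  by rewrite tpiE /= normrM ger0_norm// mulr_ge0// ltW.
have -> : `|complex.Re (tpi * z)| = 2 * pi * `|complex.Im z|.
  by rewrite tpiE /= normrN normrM ger0_norm// mulr_ge0// ltW.
move=> H; apply: le_trans (H _); last by nra.
rewrite ler_pM2r// ler_wpM2l ?cmod_ge0// ler_expR lerN2.
by rewrite ler_wpM2l// mulr_ge0// ltW.
Qed.

Lemma ee_neq1 z : `|complex.Re z| <= 1 / 2 -> z != 0 -> ee z != 1.
Proof.
move=> rz z0; rewrite -subr_eq0 -cmod_gt0.
apply: lt_le_trans (ee_sub1_ge rz (lexx _)).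
by rewrite divr_gt0// mulr_gt0 ?expR_gt0// cmodM mulr_gt0 ?cmod_gt0// tpi_neq0.
Qed.

(** With [x = 2 pi i z] and [exp x = 1 + x + r], the numerator of the difference is of
    order [x^3] and its denominator of order [x^4]. *)
Lemma pi_csc_sqr_pole (Y : R) : exists2 K : R, 0 <= K & forall z, z != 0 ->
  `|complex.Re z| <= 1 / 2 -> `|complex.Im z| <= Y ->
  cmod (pi_csc_sqr z - z^-1 ^+ 2) <= K * (cmod z)^-1.
Proof.
have pg := @pi_gt0 R.
pose E := expR (2 * pi * (1 + `|Y|)); pose c := expR (- (2 * pi * Y)) / 4.
have c0 : 0 < c by rewrite divr_gt0// expR_gt0.
have E0 : 0 <= E := expR_ge0 _.
pose N := 2 * pi * (1 + `|Y|).
have N0 : 0 <= N by rewrite mulr_ge0 ?addr_ge0// mulr_ge0// ltW.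
pose D := 1 + 3 * E * N + 6 * E + 9 * E ^+ 2 * N.
have D0 : 0 <= D.
  by have := mulr_ge0 E0 N0; have := mulr_ge0 E0 (mulr_ge0 E0 N0); rewrite /D; lra.
exists ((2 * pi) ^+ 2 * D / c ^+ 2 / (2 * pi)) => [|z z0 rz iz].
  have tp0 : 0 <= 2 * pi :> R by rewrite mulr_ge0// ltW.
  apply: divr_ge0 => //; apply: divr_ge0; last exact: sqr_ge0.
  by apply: mulr_ge0 => //; exact: sqr_ge0.
set x := tpi * z; set e := ee z; pose r := e - 1 - x.
have x0 : x != 0 by rewrite mulf_neq0// tpi_neq0.
have e1 : e - 1 != 0 by rewrite subr_eq0; apply: ee_neq1.
have cx : cmod x = 2 * pi * cmod z by rewrite cmodM cmod_tpi.
have X0 : 0 < cmod x by rewrite cmod_gt0.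
have xN : cmod x <= N.
  rewrite cx ler_wpM2l ?mulr_ge0 ?(ltW pg)//.
  by rewrite (le_trans (cmod_le_ReIm z))// lerD//; [lra|rewrite (le_trans iz) ?ler_norm].
have rb : cmod r <= 3 * cmod x ^+ 2 * E.
  apply: le_trans (cexp_taylor x) _.
  by rewrite ler_wpM2l ?mulr_ge0 ?exprn_ge0 ?cmod_ge0// ler_expR.
have eb : cmod x * c <= cmod (e - 1).
  by have := ee_sub1_ge rz iz; rewrite -/x -/e /c mulrA.
have -> : pi_csc_sqr z - z^-1 ^+ 2 = tpi ^+ 2 * (x ^+ 3 + x ^+ 2 * r - 2 * x * r - r ^+ 2) /
   (x ^+ 2 * (e - 1) ^+ 2).
  rewrite /pi_csc_sqr -/e; have -> : z^-1 = tpi * x^-1 by rewrite /x; field; rewrite z0 tpi_neq0.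
  rewrite /r; field.
  by rewrite x0 e1 -(opprB e) oppr_eq0 e1.
have num : cmod (x ^+ 3 + x ^+ 2 * r - 2 * x * r - r ^+ 2) <= cmod x ^+ 3 * D.
  have tri (a b : C) : cmod (a ^+ 3 + a ^+ 2 * b - 2 * a * b - b ^+ 2) <=
      cmod a ^+ 3 + cmod a ^+ 2 * cmod b + 2 * cmod a * cmod b + cmod b ^+ 2.
    rewrite (le_trans (cmodB _ _))// (le_trans (lerD (cmodB _ _) (lexx _)))//.
    rewrite (le_trans (lerD (lerD (cmodD _ _) (lexx _)) (lexx _)))//.
    by rewrite !(cmodX, cmodM) cmod_nat.
  apply: le_trans (tri _ _) _; move: (cmod x) (cmod r) X0 xN rb (cmod_ge0 r) => X q X0 xN rb q0.
  have -> : X ^+ 3 * D = X ^+ 3 + X ^+ 2 * (3 * (X * N) * E) + 2 * X * (3 * X ^+ 2 * E) +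
     3 * X ^+ 2 * E * (3 * (X * N) * E) by rewrite /D; ring.
  have qN : q <= 3 * (X * N) * E.
    apply: le_trans rb _; rewrite ler_wpM2r// ler_wpM2l// expr2 ler_wpM2l// ltW//.
  rewrite !lerD//.
  - by rewrite ler_wpM2l// exprn_ge0// ltW.
  - by rewrite ler_wpM2l// mulr_ge0// ltW.
  - by rewrite expr2 ler_pM.
rewrite cmodM (cmodM (tpi ^+ 2)) cmodV (cmodM (x ^+ 2)) !cmodX cmod_tpi.
have den : cmod x ^+ 2 * (cmod x * c) ^+ 2 <= cmod x ^+ 2 * cmod (e - 1) ^+ 2.
  by rewrite ler_wpM2l ?exprn_ge0 ?cmod_ge0// lerXn2r ?nnegrE ?mulr_ge0 ?cmod_ge0// ltW.
have dpos : 0 < cmod x ^+ 2 * (cmod x * c) ^+ 2 by rewrite mulr_gt0 ?exprn_gt0// mulr_gt0.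
have -> : (2 * pi) ^+ 2 * D / c ^+ 2 / (2 * pi) / cmod z =
  (2 * pi) ^+ 2 * (cmod x ^+ 3 * D) / (cmod x ^+ 2 * (cmod x * c) ^+ 2).
  have pn : 2 * pi != 0 :> R by rewrite gt_eqF// mulr_gt0.
  have cn : c != 0 by rewrite gt_eqF.
  have zn : cmod z != 0 by rewrite cmod_eq0.
  by rewrite cx; move: (2 * pi) pn => P pn; field; rewrite cn zn pn.
apply: ler_pM.
- by apply: mulr_ge0; [exact: sqr_ge0|exact: cmod_ge0].
- by rewrite invr_ge0; apply: mulr_ge0; exact: sqr_ge0.
- by rewrite ler_wpM2l// sqr_ge0.
- by rewrite lef_pV2// posrE (lt_le_trans dpos).
Qed.

(** Off the term [n = 0] the distance of [z] to an integer [n] is at least a quarter of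
    [1 + |n|]. *)
Lemma psi2_pole : exists2 K : R, 0 <= K & forall z, `|complex.Re z| <= 1 / 2 ->
  cmod (psi 2 z - z^-1 ^+ 2) <= K.
Proof.
exists (16 * bbound (b32 R)) => [|z rz].
  by rewrite mulr_ge0// bbound_ge0//; exact: bsum_b32.
have H1 : zsum (fun n : int => if n == 0 then z^-1 ^+ 2 else 0) (z^-1 ^+ 2).
  apply: tends_ext (tends_cst _) => N.
  by rewrite (zs_pred1 (n0 := 0)) ?eqxx// => n /negbTE ->.
apply: zsum_le (zsumB (psiP z (isT : (0 < 2)%N)) H1) => [|//|n]; first exact: bsum_b32.
case: eqVneq => [->|n0]; first by rewrite addr0 subrr cmod0 mulr_ge0// b32_ge0.
rewrite subr0; apply: le_trans (_ : 16 * (wt R 0 n)^-1 ^+ 2 <= _); last first.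
  by rewrite ler_wpM2l// wt2_le.
have -> : 16 = 4 ^+ 2 :> R by ring.
apply: cmodVX_le; first exact: wtV_ge0.
have reint : (n%:~R : C) = (n%:~R : R)%:C by rewrite rmorph_int.
have n1 : 1 <= `|n%:~R : R| by rewrite -intr_norm -[1]/(1%:~R) ler_int; lia.
have nw : wt R 0 n = 1 + `|n%:~R : R|.
  by rewrite /wt /= addn0 natrD -intr_norm; congr (_ + _); rewrite -abszE pmulrn.
have lower : wt R 0 n / 4 <= cmod (z + n%:~R).
  rewrite nw; apply: le_trans (Re_le_cmod _).
  have -> : complex.Re (z + n%:~R) = complex.Re z + n%:~R by rewrite reint; case: (z).
  have := lerB_normD (n%:~R : R) (complex.Re z); rewrite (addrC n%:~R); lra.
have zn0 : 0 < cmod (z + n%:~R) by apply: lt_le_trans lower; rewrite divr_gt0// wt_gt0.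
rewrite cmodV ler_pdivlMr ?wt_gt0// mulrC ler_pdivrMr//; lra.
Qed.

End Cotangent.

(** * Partial fractions of the squared cosecant *)

Section Lipschitz.
Variable R : realType.
Local Notation C := R[i].
Implicit Types (x y z h : C) (k : nat).
Local Notation tpi := (two_pi_i R).

Lemma geometric_le0 (a B : R) : (forall j : nat, a <= B * (3 / 4) ^+ j) -> a <= 0.
Proof.
move=> H; rewrite leNgt; apply/negP => a0.
have B0 : 0 < B by have := H 0%N; rewrite expr0 mulr1; lra.
have [N _ HN] : \forall n \near \oo, `|(3 / 4 : R) ^+ n| < a / B.
  have /cvgr0_norm_lt : (fun n => (3 / 4 : R) ^+ n) @ \oo --> (0 : R).
    by apply: cvg_expr; rewrite ger0_norm//; lra.
  by apply; rewrite divr_gt0.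
have := HN N (leqnn N); rewrite /= ger0_norm ?exprn_ge0// ltr_pdivlMr// mulrC.
by have := H N; lra.
Qed.

Lemma psi2_half z : psi 2 z = (psi 2 (z / 2) + psi 2 ((z + 1) / 2)) / 4.
Proof.
have := @psi_dist R 2 2 z isT isT; rewrite 2!big_ord_recr big_ord0 /= add0r addr0 => ->.
by field.
Qed.

(** A majorant for functions with simple poles at 0 and 1. The constant 4 is the least [c]
    with [(4 + 2 c) / 4 <= 3 c / 4]; the left hand side is what [c] and the two bounded
    inverses contribute to the average in [pole_weight_half]. *)
Definition pole_weight z : R := (cmod z)^-1 + (cmod (1 - z))^-1 + 4.

Lemma ReD x y : complex.Re (x + y) = complex.Re x + complex.Re y.
Proof. by case: x => a b; case: y. Qed.

Lemma ImD x y : complex.Im (x + y) = complex.Im x + complex.Im y.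
Proof. by case: x => a b; case: y. Qed.

Lemma ReN x : complex.Re (- x) = - complex.Re x. Proof. by case: x. Qed.
Lemma ImN x : complex.Im (- x) = - complex.Im x. Proof. by case: x. Qed.

Lemma Re_int (n : int) : complex.Re (n%:~R : C) = n%:~R.
Proof. by rewrite -(rmorph_int (real_complex R)). Qed.

Lemma Im_int (n : int) : complex.Im (n%:~R : C) = 0.
Proof. by rewrite -(rmorph_int (real_complex R)). Qed.

Lemma Re_nat (n : nat) : complex.Re (n%:R : C) = n%:R.
Proof. by rewrite -(rmorph_nat (real_complex R)). Qed.

Lemma Re_realM (r : R) x : complex.Re (r%:C * x) = r * complex.Re x.
Proof. by case: x => a b /=; rewrite mul0r subr0. Qed.

Lemma Im_realM (r : R) x : complex.Im (r%:C * x) = r * complex.Im x.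
Proof. by case: x => a b /=; rewrite mul0r addr0. Qed.

Lemma natC (n : nat) : n%:R = (n%:R : R)%:C. Proof. by rewrite rmorph_nat. Qed.
Lemma intC (n : int) : n%:~R = (n%:~R : R)%:C. Proof. by rewrite rmorph_int. Qed.

Lemma half_re x : complex.Re (x / 2) = complex.Re x / 2.
Proof. by rewrite natC -fmorphV mulrC Re_realM mulrC. Qed.

Lemma half_im x : complex.Im (x / 2) = complex.Im x / 2.
Proof. by rewrite natC -fmorphV mulrC Im_realM mulrC. Qed.

Section Contraction.
Variable Y : R.

Definition strip z := [/\ 0 <= complex.Re z <= 1, `|complex.Im z| <= Y, z != 0 & z != 1].

Definition gap z : C := pi_csc_sqr z - psi 2 z.

Lemma strip_ee z : strip z -> ee z != 1.
Proof.
move=> [/andP[r0 r1] _ z0 z1]; have [rz|rz] := leP (complex.Re z) (1 / 2).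
  by apply: ee_neq1; rewrite ?ger0_norm.
rewrite -(ee_addz z (-1)); apply: ee_neq1; last by rewrite subr_eq0.
by rewrite ReD Re_int ler0_norm; lra.
Qed.

Lemma strip_half z : strip z -> strip (z / 2) /\ strip ((z + 1) / 2).
Proof.
move=> [/andP[r0 r1] iz z0 z1].
have iz2 : `|complex.Im z / 2| <= Y by rewrite normrM [ `|2^-1|]ger0_norm//; have := normr_ge0 (complex.Im z); lra.
have n2 : (2 : C) != 0 by rewrite pnatr_eq0.
split; split.
- by rewrite half_re; lra.
- by rewrite half_im.
- by rewrite mulf_neq0// invr_eq0.
- by apply: contraTneq r1 => /(congr1 (@complex.Re R)); rewrite half_re /= -ltNge; lra.
- by rewrite half_re ReD /=; lra.
- by rewrite half_im ImD /= addr0.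
- by apply: contraTneq r0 => /(congr1 (@complex.Re R)); rewrite half_re ReD /= -ltNge; lra.
- apply: contra z1 => /eqP H; apply/eqP.
  have := congr1 (fun w => w * 2) H; rewrite divfK// mul1r => /eqP.
  by rewrite -[2](natrD _ 1 1) (inj_eq (addIr _)) => /eqP.
Qed.

Lemma gap_half z : strip z -> gap z = (gap (z / 2) + gap ((z + 1) / 2)) / 4.
Proof.
by move=> zS; rewrite /gap (pi_csc_sqr_half (strip_ee zS)) psi2_half; ring.
Qed.

Lemma cmod_ge_re z : complex.Re z <= cmod z.
Proof. exact: le_trans (ler_norm _) (Re_le_cmod z). Qed.

(** Halving doubles the inverses, but each of the poles 0 and 1 is close to only one of the
    two half points, so that the average over both has half the poles. *)
Lemma pole_weight_half z : strip z ->
  (pole_weight (z / 2) + pole_weight ((z + 1) / 2)) / 4 <= 3 / 4 * pole_weight z.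
Proof.
move=> [/andP[r0 r1] iz z0 z1]; rewrite /pole_weight.
have n2 : (2 : C) != 0 by rewrite pnatr_eq0.
have -> : 1 - z / 2 = (2 - z) / 2 by field.
have -> : 1 - (z + 1) / 2 = (1 - z) / 2 by field.
have c2 w : (cmod (w / 2))^-1 = 2 * (cmod w)^-1.
  by rewrite cmodM cmodV cmod_nat invfM invrK mulrC.
rewrite !c2.
have inv1 w : 1 <= cmod w -> (cmod w)^-1 <= 1.
  by move=> w1; rewrite invf_le1// (lt_le_trans ltr01).
have A : (cmod (2 - z))^-1 <= 1.
  by apply/inv1/(le_trans _ (cmod_ge_re _)); rewrite ReD ReN Re_nat; lra.
have B : (cmod (z + 1))^-1 <= 1.
  by apply/inv1/(le_trans _ (cmod_ge_re _)); rewrite ReD /=; lra.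
have : 0 <= (cmod z)^-1 by rewrite invr_ge0 cmod_ge0.
have : 0 <= (cmod (1 - z))^-1 by rewrite invr_ge0 cmod_ge0.
lra.
Qed.

Lemma gap_pole : exists2 B : R, 0 <= B & forall z, strip z -> cmod (gap z) <= B * pole_weight z.
Proof.
have [K K0 HK] := pi_csc_sqr_pole Y; have [L L0 HL] := psi2_pole R.
have main z : z != 0 -> `|complex.Re z| <= 1 / 2 -> `|complex.Im z| <= Y ->
    cmod (gap z) <= K * (cmod z)^-1 + L.
  move=> z0 rz iz.
  have -> : gap z = (pi_csc_sqr z - z^-1 ^+ 2) - (psi 2 z - z^-1 ^+ 2) by rewrite /gap; ring.
  by rewrite (le_trans (cmodB _ _))// lerD ?HK ?HL.
exists (K + L) => [|z [/andP[r0 r1] iz z0 z1]]; first by rewrite addr_ge0.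
have H0 : 0 <= (cmod z)^-1 by rewrite invr_ge0 cmod_ge0.
have H1 : 0 <= (cmod (1 - z))^-1 by rewrite invr_ge0 cmod_ge0.
rewrite /pole_weight; have [rz|rz] := leP (complex.Re z) (1 / 2).
  apply: le_trans (main z z0 _ iz) _; first by rewrite ger0_norm.
  nra.
have -> : gap z = gap (z - 1).
  rewrite /gap /pi_csc_sqr (_ : ee (z - 1) = ee z); last exact: (ee_addz z (-1)).
  by congr (_ - _); rewrite -[in LHS](subrK 1 z) psi_add1.
apply: le_trans (main (z - 1) _ _ _) _.
- by rewrite subr_eq0.
- by rewrite ReD ReN /= ler0_norm; lra.
- by rewrite ImD ImN /= subr0.
- by rewrite (cmod_subC z); nra.
Qed.

(** Both functions satisfy the duplication formula [gap_half]. Iterating it, the bound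
    [gap_pole] improves by a factor [3/4] each time: a variant of the trick of Herglotz
    in which poles of first order are tolerated in place of a continuous extension. *)
Lemma gap0 z : strip z -> gap z = 0.
Proof.
have [B B0 HB] := gap_pole => zS.
suff H (j : nat) : forall w, strip w -> cmod (gap w) <= B * pole_weight w * (3 / 4) ^+ j.
  apply/eqP; rewrite -cmod_eq0 eq_le cmod_ge0 andbT.
  by apply: geometric_le0 => j; exact: H.
elim: j => [|j IH] w wS; first by rewrite expr0 mulr1 HB.
have [S1 S2] := strip_half wS; rewrite gap_half// cmodM cmodV cmod_nat.
have P := ler_wpM2l (mulr_ge0 B0 (exprn_ge0 j (_ : 0 <= 3 / 4 :> R))) (pole_weight_half wS).
have {P} : B * (3 / 4) ^+ j * ((pole_weight (w / 2) + pole_weight ((w + 1) / 2)) / 4) <=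
  B * (3 / 4) ^+ j * (3 / 4 * pole_weight w) by apply: P.
have := cmodD (gap (w / 2)) (gap ((w + 1) / 2)); have := IH _ S1; have := IH _ S2.
rewrite exprS; lra.
Qed.

End Contraction.

(** The Lipschitz formula in weight 2. Both sides have period 1, which moves [z] to the
    strip where [gap0] applies. *)
Lemma psi2E z : (forall n : int, z + n%:~R != 0) -> psi 2 z = pi_csc_sqr z.
Proof.
move=> z0; pose n := Num.floor (complex.Re z).
have /andP[n1 n2] := real_floor_itv (num_real (complex.Re z)).
pose w := z + (- n)%:~R.
have -> : psi 2 z = psi 2 w by rewrite psi_addz.
have -> : pi_csc_sqr z = pi_csc_sqr w by rewrite /pi_csc_sqr ee_addz.
apply/eqP; rewrite eq_sym -subr_eq0; apply/eqP; apply: (gap0 (Y := `|complex.Im w|)); split=> //.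
- by rewrite /w ReD Re_int mulrNz; move: n1 n2; rewrite intrD -/n; lra.
- exact: z0.
- have := z0 (- n - 1); rewrite intrD addrA; apply: contra => /eqP H.
  by rewrite -/w H /= subrr.
Qed.

End Lipschitz.

(** * Partial fractions of the cotangent *)

Section Fourier.
Variable R : realType.
Local Notation C := R[i].
Implicit Types (x y z : C) (k : nat).
Local Notation tpi := (two_pi_i R).

Lemma quadratic_cst (phi : R -> R) :
  (forall t, exists K r : R, [/\ 0 <= K, 0 < r &
     forall h : R, `|h| < r -> `|phi (t + h) - phi t| <= K * h ^+ 2]) ->
  forall s t, phi s = phi t.
Proof.
move=> H s t; apply: is_derive_0_is_cst => x.
have [K [r [K0 r0 Hx]]] := H x.
have lim0 : (fun h : R => h^-1 *: (phi (h *: (1 : R) + x) - phi x)) @ 0^' --> (0 : R).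
  apply/cvgrPdist_lt => e e0.
  have d0 : 0 < Num.min r (e / (K + 1)) by rewrite lt_min r0 divr_gt0//; lra.
  apply/nbhs_ballP; exists (Num.min r (e / (K + 1))) => //= h.
  rewrite -ball_normE /= sub0r normrN lt_min => /andP[hr he] h0.
  have hh : 0 < `|h| by rewrite normr_gt0.
  rewrite sub0r normrN normrZ normfV [_%:A]mulr1 (addrC h) mulrC ltr_pdivrMr//.
  apply: le_lt_trans (Hx _ hr) _; rewrite -real_normK ?num_real// expr2 mulrA ltr_pM2r//.
  move: he; rewrite ltr_pdivlMr; last by lra.
  by apply: le_lt_trans; nra.
by apply: DeriveDef; [apply/cvg_ex; exists 0|exact: cvg_lim].
Qed.

(** Along the segment, the real and the imaginary part are real functions with derivative
    zero. *)
Lemma qderiv0_line (d : C -> C) (a w : C) :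
  (forall t : R, qderiv d (a + t%:C * w) 0) -> d (a + w) = d a.
Proof.
move=> H.
have bound (t : R) : exists K r : R, [/\ 0 <= K, 0 < r &
     forall h : R, `|h| < r -> cmod (d (a + (t + h)%:C * w) - d (a + t%:C * w)) <= K * h ^+ 2].
  have [K [r [K0 r0 Hd]]] := H t; exists (K * cmod w ^+ 2), (r / (cmod w + 1)).
  have w1 : 0 < cmod w + 1 by have := cmod_ge0 w; lra.
  split; [by rewrite mulr_ge0 ?exprn_ge0 ?cmod_ge0|by rewrite divr_gt0|move=> h].
  rewrite ltr_pdivlMr// => hr; have := Hd (h%:C * w).
  rewrite cmodM cmod_real mulr0 subr0 -addrA -mulrDl -rmorphD exprMn real_normK ?num_real//.
  rewrite -mulrA [_ ^+ 2 * h ^+ 2]mulrC; apply.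
  by apply: le_lt_trans hr; have := normr_ge0 h; nra.
have E (F : C -> R) : (forall x y, F (x - y) = F x - F y) -> (forall x, `|F x| <= cmod x) ->
   F (d (a + w)) = F (d a).
  move=> FB Fle; have := @quadratic_cst (fun t => F (d (a + t%:C * w))) _ 1 0.
  rewrite mul1r mul0r addr0; apply => t.
  have [K [r [K0 r0 Hd]]] := bound t; exists K, r; split=> // h hr.
  by rewrite -FB (le_trans (Fle _))// Hd.
have eR : complex.Re (d (a + w)) = complex.Re (d a).
  by apply: E => [x y|]; [rewrite ReD ReN|exact: Re_le_cmod].
have eI : complex.Im (d (a + w)) = complex.Im (d a).
  by apply: E => [x y|]; [rewrite ImD ImN|exact: Im_le_cmod].
by apply/eqP; rewrite eq_complex eR eI !eqxx.
Qed.

Lemma qderivN (f : C -> C) z l : qderiv f z l -> qderiv (fun w => - f w) z (- l).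
Proof.
by move=> /(qderivZ (-1)); rewrite mulN1r; under eq_fun do rewrite mulN1r.
Qed.

Lemma cmod_ee_le1 (h : C) : cmod h <= 1 -> cmod (ee h - 1 - tpi * h) <= 3 * (2 * pi) ^+ 2 * expR (2 * pi) * cmod h ^+ 2.
Proof.
move=> h1; apply: le_trans (cexp_taylor _) _; rewrite cmodM cmod_tpi exprMn.
have p0 : 0 <= 2 * pi :> R by rewrite mulr_ge0// pi_ge0.
move: (2 * pi) p0 => P P0.
have -> : 3 * P ^+ 2 * expR P * cmod h ^+ 2 = 3 * (P ^+ 2 * cmod h ^+ 2) * expR P by ring.
rewrite ler_wpM2l ?ler_expR ?ler_piMr// mulr_ge0// -exprMn.
by rewrite exprn_ge0// mulr_ge0// cmod_ge0.
Qed.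

Lemma pi_cot_qderiv z : ee z != 1 -> qderiv (@pi_cot R) z (- pi_csc_sqr z).
Proof.
move=> z1; have u1 : ee z - 1 != 0 by rewrite subr_eq0.
set u := ee z in z1 u1.
pose E := 3 * (2 * pi) ^+ 2 * expR (2 * pi) : R.
have pg := @pi_gt0 R.
have E0 : 0 <= E by rewrite !mulr_ge0// ?expR_ge0// ltW.
have P0 : 0 <= 2 * pi :> R by rewrite mulr_ge0// ltW.
pose L := E + 2 * pi; have L0 : 0 < L by rewrite ltr_wpDl// mulr_gt0.
have v1 (h : C) : cmod h <= 1 -> cmod (ee h - 1) <= L * cmod h.
  move=> h1; have := cmodD (ee h - 1 - tpi * h) (tpi * h); rewrite subrK cmodM cmod_tpi.
  have H2 : E * cmod h ^+ 2 <= E * cmod h.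
    by rewrite ler_wpM2l// expr2 ler_piMr ?cmod_ge0.
  by have := cmod_ee_le1 h1; rewrite -/E /L; lra.
have cu : 0 < cmod (u - 1) by rewrite cmod_gt0.
have cu0 : 0 < cmod u by rewrite cmod_gt0 ee_neq0.
pose r := Num.min 1 (cmod (u - 1) / (2 * L * cmod u)).
have r0 : 0 < r by rewrite lt_min ltr01 divr_gt0// !mulr_gt0.
pose K := 2 * pi * cmod u / cmod (u - 1) ^+ 3 * 2 * (E * cmod (u - 1) + 2 * pi * cmod u * L).
exists K, r; split=> //.
  have uP : 0 <= 2 * pi * cmod u by rewrite mulr_ge0 ?cmod_ge0.
  rewrite /K; apply: mulr_ge0.
    by rewrite mulr_ge0//; apply: divr_ge0 => //; rewrite exprn_ge0 ?cmod_ge0.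
  by apply: addr_ge0; apply: mulr_ge0; rewrite ?cmod_ge0 ?(ltW L0).
move=> h; rewrite lt_min => /andP[h1 hr].
have hc := v1 h (ltW h1); have hE := cmod_ee_le1 (ltW h1); rewrite -/E in hE.
set v := ee h in hc hE.
have uv : cmod (u - 1) / 2 <= cmod (u * v - 1).
  have -> : u * v - 1 = (u - 1) + u * (v - 1) by ring.
  apply: le_trans (cmod_add_ge _ _); rewrite cmodM.
  move: hr; rewrite ltr_pdivlMr ?mulr_gt0// => hr.
  have := ler_wpM2l (ltW cu0) hc; nra.
have uv0 : u * v - 1 != 0 by rewrite -cmod_gt0 (lt_le_trans _ uv)// divr_gt0.
have -> : pi_cot (z + h) - pi_cot z - h * - pi_csc_sqr z =
   - (tpi * u / ((u - 1) ^+ 2 * (u * v - 1))) *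
   ((v - 1 - tpi * h) * (u - 1) - tpi * h * u * (v - 1)).
  rewrite /pi_cot /pi_csc_sqr eeD -/u -/v; field.
  by rewrite u1 uv0 -(opprB u) oppr_eq0 u1.
rewrite cmodM cmodN (cmodM (tpi * u)) (cmodM tpi) cmod_tpi cmodV (cmodM (_ ^+ 2)) cmodX.
have A : cmod ((v - 1 - tpi * h) * (u - 1) - tpi * h * u * (v - 1)) <=
   (E * cmod (u - 1) + 2 * pi * cmod u * L) * cmod h ^+ 2.
  rewrite (le_trans (cmodB _ _))// cmodM (cmodM (tpi * h * u)) (cmodM (tpi * h)).
  rewrite (cmodM tpi) cmod_tpi [leRHS]mulrDl lerD//.
    by rewrite [leRHS]mulrAC ler_wpM2r ?cmod_ge0.
  have -> : 2 * pi * cmod u * L * cmod h ^+ 2 = 2 * pi * cmod h * cmod u * (L * cmod h) by ring.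
  by rewrite ler_wpM2l//; apply: mulr_ge0; [exact: mulr_ge0 (cmod_ge0 _)|exact: cmod_ge0].
have B : 2 * pi * cmod u / (cmod (u - 1) ^+ 2 * cmod (u * v - 1)) <=
   2 * pi * cmod u / cmod (u - 1) ^+ 3 * 2.
  have -> : 2 * pi * cmod u / cmod (u - 1) ^+ 3 * 2 =
    2 * pi * cmod u / (cmod (u - 1) ^+ 2 * (cmod (u - 1) / 2)).
    by move: (cmod (u - 1)) cu => w w0; move: (pi : R) => P; field; rewrite gt_eqF.
  rewrite ler_wpM2l//; first exact: mulr_ge0 (cmod_ge0 _).
  have cuv : 0 < cmod (u * v - 1) by rewrite cmod_gt0.
  rewrite lef_pV2 ?posrE ?mulr_gt0 ?exprn_gt0 ?divr_gt0//.
  by rewrite ler_wpM2l// exprn_ge0// cmod_ge0.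
rewrite /K -[leRHS]mulrA; apply: ler_pM => //; rewrite ?cmod_ge0//.
apply: divr_ge0; first exact: mulr_ge0 (cmod_ge0 _).
by rewrite mulr_ge0 ?exprn_ge0 ?cmod_ge0.
Qed.

(** By oddness and periodicity. *)
Lemma psi1_half : psi 1 (2^-1 : C) = 0.
Proof.
have := psi_opp (2^-1 : C) (isT : (0 < 1)%N); rewrite -[in LHS]psi_add1//.
rewrite (_ : - 2^-1 + 1 = 2^-1 :> C); last by field.
rewrite expr1 mulN1r => /eqP; rewrite -subr_eq0 opprK -mulr2n mulrn_eq0 /=.
by move/eqP.
Qed.

(** The segment from [1/2] to a nonreal [z] avoids the poles. *)
Lemma int_line (z : C) (n : int) : complex.Im z != 0 -> forall t : R,
  2^-1 + t%:C * (z - 2^-1) + n%:~R != 0.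
Proof.
move=> iz t; apply/eqP => H.
have i2 : complex.Im (2^-1 : C) = 0 by rewrite natC -fmorphV.
have r2 : complex.Re (2^-1 : C) = 2^-1 by rewrite natC -fmorphV.
have := congr1 (@complex.Im R) H; rewrite !ImD Im_int Im_realM ImD ImN i2 !addr0 oppr0 add0r addr0.
move=> /eqP; rewrite mulf_eq0 (negbTE iz) orbF => /eqP t0.
have := congr1 (@complex.Re R) H; rewrite !ReD Re_int Re_realM t0 mul0r addr0 r2 /=.
move=> H2; have : (1 + 2 * n)%:~R = (0 : R) by rewrite intrD intrM; lra.
by move=> /eqP; rewrite intr_eq0; lia.
Qed.

Lemma ee_neq1_int z : (forall n : int, z + n%:~R != 0) -> ee z != 1.
Proof.
move=> z0; have [/andP[r0 r1]|] := boolP (0 <= complex.Re z <= 1).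
  apply: (@strip_ee _ `|complex.Im z|); split; rewrite ?r0//.
    by have := z0 0; rewrite addr0.
  by have := z0 (-1); rewrite subr_eq0.
move=> _; pose n := Num.floor (complex.Re z).
have /andP[n1 n2] := real_floor_itv (num_real (complex.Re z)).
rewrite -(ee_addz z (- n)); set w := z + _.
apply: (@strip_ee _ `|complex.Im w|); split=> //.
- by rewrite /w ReD Re_int mulrNz; move: n1 n2; rewrite intrD -/n; lra.
- exact: z0.
- have := z0 (- n - 1); rewrite intrD addrA; apply: contra => /eqP H.
  by rewrite -/w H /= subrr.
Qed.

(** The difference of both sides has derivative zero by [psi2E] and vanishes at [1/2]. *)
Lemma psi1E z : complex.Im z != 0 -> psi 1 z = pi_cot z.
Proof.
move=> iz; pose d (w : C) : C := psi 1 w - pi_cot w.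
have H (t : R) : qderiv d (2^-1 + t%:C * (z - 2^-1)) 0.
  set w := _ + _; have w0 n : w + n%:~R != 0 by exact: int_line.
  have := qderivD (psi_qderiv (isT : (0 < 1)%N) w0) (qderivN (pi_cot_qderiv (ee_neq1_int w0))).
  by rewrite opprK mulN1r psi2E// addNr.
have := qderiv0_line H; rewrite addrC subrK /d psi1_half => /eqP.
rewrite /pi_cot ee_half addNr mulr0 mul0r subr0 subr_eq0.
by move/eqP.
Qed.

End Fourier.

(** * Fourier expansion and decay of the row sums *)

Section FourierSeries.
Variable R : realType.
Local Notation C := R[i].
Implicit Types (x y z : C) (k : nat).
Local Notation tpi := (two_pi_i R).

(** The majorants of Fourier series; the power [j] comes from differentiating [j] times. *)
Definition polyexp (j : nat) (c : R) (d : nat) : R := d%:R ^+ j * expR (- (c * d%:R)).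

Lemma polyexp_ge0 j c d : 0 <= polyexp j c d.
Proof. by rewrite mulr_ge0 ?expR_ge0 ?exprn_ge0. Qed.

Lemma bsum_polyexp j c : 0 < c -> bsum (polyexp j c).
Proof.
move=> c0; split=> [d|]; first exact: polyexp_ge0.
(* Half of the exponential absorbs the power of [d], the other half is geometric. *)
pose rho := expR (- (c / 2)).
have rho1 : rho < 1 by rewrite expR_lt1 oppr_lt0 divr_gt0.
have rho0 : 0 <= rho := expR_ge0 _.
pose K := j.+1`!%:R * (2 / c) ^+ j.+1 + 1.
have K0 : 0 <= K by rewrite addr_ge0// mulr_ge0// exprn_ge0// divr_ge0// ltW.
have H d : polyexp j c d <= K * rho ^+ d.
  have -> : rho ^+ d = expR (c / 2 * d%:R) * expR (- (c * d%:R)).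
    by rewrite -expRM_natl -expRD; congr expR; field.
  rewrite mulrA ler_wpM2r ?expR_ge0//.
  have x0 : 0 <= c / 2 * d%:R by rewrite mulr_ge0// divr_ge0// ltW.
  have := expR_ge1Dxn j x0; set E := expR _ => HE.
  have E1 : 1 <= E by rewrite -expR0 ler_expR.
  have f0 : (0 : R) < j.+1`!%:R by rewrite ltr0n fact_gt0.
  have dj : d%:R ^+ j.+1 <= j.+1`!%:R * (2 / c) ^+ j.+1 * E.
    have : (c / 2 * d%:R) ^+ j.+1 <= j.+1`!%:R * E.
      by rewrite [leRHS]mulrC -ler_pdivrMr//; lra.
    move=> Hx; have -> : d%:R ^+ j.+1 = (2 / c) ^+ j.+1 * (c / 2 * d%:R) ^+ j.+1.
      by rewrite -exprMn; congr (_ ^+ _); field; rewrite gt_eqF.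
    by rewrite [X in _ <= X * E]mulrC -[leRHS]mulrA ler_wpM2l// exprn_ge0// divr_ge0// ltW.
  case: d => [|d] in x0 E HE E1 dj *.
    rewrite expr0n; case: (j == 0)%N; rewrite /K; last by rewrite mulr_ge0// ltW// (lt_le_trans ltr01).
    have : 0 <= j.+1`!%:R * (2 / c) ^+ j.+1 by rewrite mulr_ge0// exprn_ge0// divr_ge0// ltW.
    by move=> F0; have := mulr_ge0 F0 (le_trans ler01 E1); rewrite mulrDl mul1r /=; lra.
  rewrite /K mulrDl mul1r; apply: le_trans (_ : d.+1%:R ^+ j.+1 <= _).
    by rewrite ler_weXn2l// ler1n.
  by lra.
exists (K / (1 - rho)) => N; apply: le_trans (ler_sum _ (fun (i : 'I_N) _ => H i)) _.
rewrite -mulr_sumr ler_wpM2l// -[leRHS]mul1r ler_pdivlMr ?subr_gt0//.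
suff -> : (\sum_(i < N) rho ^+ i) * (1 - rho) = 1 - rho ^+ N by rewrite gerBl exprn_ge0.
elim: N => [|N IH]; first by rewrite big_ord0 mul0r expr0 subrr.
by rewrite big_ord_recr mulrDl IH exprSr /=; ring.
Qed.

Lemma bsum_tends0 (u : nat -> C) b : bsum b -> (forall n, cmod (u n) <= b n) -> tends u 0.
Proof.
move=> bb H e e0; have [N HN] := bsum_tail bb e0; exists N => n Nn.
rewrite subr0 (le_lt_trans (H n))// (le_lt_trans _ (HN n.+1 (leqW Nn)))//.
by rewrite big_nat_recr//= lerDr sumr_ge0// => i _; exact: bsum_ge0.
Qed.

Lemma im_neq_int z (n : int) : complex.Im z != 0 -> z + n%:~R != 0.
Proof.
by apply: contra => /eqP /(congr1 (@complex.Im R)); rewrite ImD Im_int addr0 => /= ->.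
Qed.

(** One-sided series are written as two-sided ones supported on [n > 0], so that the
    results on symmetric summation apply to them. *)
Definition qterm k z (n : int) : C :=
  if (0 < n)%R then `|n|%N%:R ^+ k.-1 * ee z ^+ `|n|%N else 0.

Definition qcoef k : C := (- tpi) ^+ k / (k.-1)`!%:R.

(** The right hand side of the Lipschitz formula. *)
Definition qseries k z : C := qcoef k * zlim (qterm k z).

(** Since [d >= 1], [y d >= y + y0 d - y0]: this separates decay in [y] from summability
    in [d]. *)
Lemma exp_split (y0 y : R) (d : nat) : (0 < d)%N -> y0 <= y ->
  expR (- (pi * y * d%:R)) <= expR (pi * y0) * expR (- (pi * y)) * expR (- (pi * y0 * d%:R)).
Proof.
move=> d0 yy; rewrite -!expRD ler_expR.
have d1 : (1 : R) <= d%:R by rewrite ler1n.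
have : 0 <= pi * ((y - y0) * (d%:R - 1)).
  by rewrite mulr_ge0 ?pi_ge0// mulr_ge0// subr_ge0.
by move: (pi : R) => P; lra.
Qed.

Lemma cmod_eeX z (d : nat) : cmod (ee z ^+ d) = expR (- (2 * pi * complex.Im z * d%:R)).
Proof. by rewrite cmodX cmod_ee -expRM_natr mulNr. Qed.

Lemma qterm_dom k z (y0 : R) : 0 < y0 -> y0 <= complex.Im z ->
  zdom (qterm k z) (fun d => expR (pi * y0) * expR (- (pi * complex.Im z)) * polyexp k.-1 (pi * y0) d).
Proof.
move=> y00 yz n; have pg := @pi_gt0 R.
rewrite /qterm; case: ifP => n0; last first.
  by rewrite cmod0 mulr_ge0 ?polyexp_ge0// mulr_ge0 ?expR_ge0.
have d0 : (0 < `|n|)%N by lia.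
rewrite cmodM cmodX cmod_nat cmod_eeX /polyexp mulrCA ler_wpM2l ?exprn_ge0//.
apply: le_trans (exp_split d0 yz); rewrite ler_expR lerN2.
have d1 : (0 : R) <= `|n|%N%:R by [].
have : 0 <= pi * complex.Im z * `|n|%N%:R by rewrite !mulr_ge0// ltW// (lt_le_trans y00).
by move: (pi : R) => P; lra.
Qed.

Lemma bsum_qterm (y0 y : R) k : 0 < y0 ->
  bsum (fun d => expR (pi * y0) * expR (- (pi * y)) * polyexp k (pi * y0) d).
Proof.
move=> y00; apply: bsumZ; first by rewrite mulr_ge0 ?expR_ge0.
by apply: bsum_polyexp; rewrite mulr_gt0// pi_gt0.
Qed.

Lemma qtermP k z : 0 < complex.Im z -> zsum (qterm k z) (zlim (qterm k z)).
Proof.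
by move=> z0; apply: zlimP (qterm_dom k z0 (lexx _)); exact: bsum_qterm.
Qed.

Lemma qseries_bound k (y0 : R) : 0 < y0 -> exists2 B : R, 0 <= B &
  forall z, y0 <= complex.Im z -> cmod (qseries k z) <= B * expR (- (pi * complex.Im z)).
Proof.
move=> y00; have bp : bsum (polyexp k.-1 (pi * y0)) by apply: bsum_polyexp; rewrite mulr_gt0// pi_gt0.
exists (cmod (qcoef k) * (expR (pi * y0) * bbound (polyexp k.-1 (pi * y0)))) => [|z yz].
  by rewrite mulr_ge0 ?cmod_ge0// mulr_ge0 ?expR_ge0// bbound_ge0.
rewrite cmodM -mulrA ler_wpM2l ?cmod_ge0// mulrAC.
apply: zsum_le bp _ (qterm_dom k y00 yz) (qtermP k (lt_le_trans y00 yz)).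
by rewrite mulr_ge0 ?expR_ge0.
Qed.

Lemma qcoefS k : (0 < k)%N -> - k%:R * qcoef k.+1 = tpi * qcoef k.
Proof.
case: k => // k _; rewrite /qcoef /= factS natrM exprS.
have k0 : (k.+1%:R : C) != 0 by rewrite pnatr_eq0.
have f0 : (k`!%:R : C) != 0 by rewrite pnatr_eq0 -lt0n fact_gt0.
by move: (tpi) => T; field; rewrite f0 addrC natr1 k0.
Qed.

(** Half of the exponential decay of the terms pays for the growth of the Taylor remainder
    in [h], the other half gives the decay in [Im z]. *)
Lemma qseries_taylor k (y0 : R) : (0 < k)%N -> 0 < y0 -> exists2 B : R, 0 <= B &
  forall z h, y0 <= complex.Im z -> 2 * cmod h <= complex.Im z ->
  cmod (qseries k (z + h) - qseries k z - h * (- k%:R * qseries k.+1 z)) <=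
    B * cmod h ^+ 2 * expR (- (pi * complex.Im z)).
Proof.
move=> k0 y00; have pg := @pi_gt0 R.
have bp : bsum (polyexp k.+1 (pi * y0)) by apply: bsum_polyexp; rewrite mulr_gt0.
exists (cmod (qcoef k) * (3 * (2 * pi) ^+ 2 * expR (pi * y0) * bbound (polyexp k.+1 (pi * y0)))).
  have P2 := sqr_ge0 (2 * pi : R).
  rewrite mulr_ge0 ?cmod_ge0//; apply: mulr_ge0; last exact: bbound_ge0.
  by apply: mulr_ge0; [exact: mulr_ge0|exact: expR_ge0].
move=> z h yz hz; have z0 := lt_le_trans y00 yz.
have zh0 : 0 < complex.Im (z + h).
  have := Im_le_cmod h; rewrite ImD ler_norml => /andP[]; lra.
have -> : qseries k (z + h) - qseries k z - h * (- k%:R * qseries k.+1 z) = qcoef k *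
   (zlim (qterm k (z + h)) - zlim (qterm k z) - tpi * h * zlim (qterm k.+1 z)).
  have alg (a b c q1 q r T g : C) : r * q1 = T * q ->
      q * a - q * b - g * (r * (q1 * c)) = q * (a - b - T * g * c).
    by move=> Q; rewrite (mulrA r) Q; ring.
  exact: alg (qcoefS k0).
have alg2 (a w b g e : R) : a * (w * b) * g * e = a * (w * g * e * b) by ring.
rewrite cmodM alg2 ler_wpM2l ?cmod_ge0//.
have S := zsumB (zsumB (qtermP k zh0) (qtermP k z0)) (zsumZ (tpi * h) (qtermP k.+1 z0)).
have P2 := sqr_ge0 (2 * pi : R).
have c0 : 0 <= 3 * (2 * pi) ^+ 2 * expR (pi * y0) * cmod h ^+ 2 * expR (- (pi * complex.Im z)).
  apply: mulr_ge0; last exact: expR_ge0.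
  apply: mulr_ge0; last by rewrite exprn_ge0// cmod_ge0.
  by apply: mulr_ge0; [exact: mulr_ge0|exact: expR_ge0].
apply: (zsum_le bp c0 _ S) => n; rewrite /qterm; case: ifP => n0; last first.
  by rewrite mulr0 !subr0 cmod0; exact: mulr_ge0 c0 (polyexp_ge0 _ _ _).
have d0 : (0 < `|n|)%N by lia.
set d := `|n|%N in d0 *; have d1 : (0 : R) <= d%:R by [].
have -> : d%:R ^+ k.-1 * ee (z + h) ^+ d - d%:R ^+ k.-1 * ee z ^+ d -
   tpi * h * (d%:R ^+ k.+1.-1 * ee z ^+ d) =
   d%:R ^+ k.-1 * ee z ^+ d * (ee (d%:R * h) - 1 - tpi * (d%:R * h)).
  by rewrite eeD eeMn exprMn -[k.+1.-1]prednK// exprS /=; ring.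
rewrite cmodM cmodM cmodX cmod_nat cmod_eeX.
have T := cexp_taylor (tpi * (d%:R * h)); rewrite -/(ee (d%:R * h)) in T.
rewrite (cmodM tpi) cmod_tpi (cmodM d%:R) cmod_nat in T.
have E : expR (2 * pi * (d%:R * cmod h)) <= expR (pi * complex.Im z * d%:R).
  rewrite ler_expR; have : 0 <= pi * d%:R * (complex.Im z - 2 * cmod h).
    by rewrite !mulr_ge0 ?subr_ge0// ltW.
  by move: (pi : R) => P; lra.
have E2 := exp_split d0 yz.
apply: le_trans (_ : d%:R ^+ k.-1 * expR (- (2 * pi * complex.Im z * d%:R)) *
  (3 * (2 * pi * (d%:R * cmod h)) ^+ 2 * expR (pi * complex.Im z * d%:R)) <= _).
  rewrite ler_wpM2l ?mulr_ge0 ?exprn_ge0 ?expR_ge0//.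
  apply: le_trans T _; rewrite ler_wpM2l// mulr_ge0//; exact: sqr_ge0.
rewrite /polyexp.
have -> : d%:R ^+ k.-1 * expR (- (2 * pi * complex.Im z * d%:R)) *
  (3 * (2 * pi * (d%:R * cmod h)) ^+ 2 * expR (pi * complex.Im z * d%:R)) =
  (d%:R ^+ k.+1 * (3 * (2 * pi) ^+ 2 * cmod h ^+ 2)) * expR (- (pi * complex.Im z * d%:R)).
  have -> : expR (- (pi * complex.Im z * d%:R)) =
    expR (- (2 * pi * complex.Im z * d%:R)) * expR (pi * complex.Im z * d%:R).
    by rewrite -expRD; congr expR; move: (pi : R) => P; ring.
  have -> : d%:R ^+ k.+1 = d%:R ^+ k.-1 * d%:R ^+ 2 :> R.
    by rewrite -exprD; congr (_ ^+ _); lia.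
  by move: (pi : R) => P; ring.
have -> : 3 * (2 * pi) ^+ 2 * expR (pi * y0) * cmod h ^+ 2 * expR (- (pi * complex.Im z)) *
   (d%:R ^+ k.+1 * expR (- (pi * y0 * d%:R))) =
  (d%:R ^+ k.+1 * (3 * (2 * pi) ^+ 2 * cmod h ^+ 2)) *
  (expR (pi * y0) * expR (- (pi * complex.Im z)) * expR (- (pi * y0 * d%:R))).
  by move: (expR _) (expR _) (expR _) => e1 e2 e3; move: (pi : R) => P; ring.
rewrite ler_wpM2l//; apply: mulr_ge0; first by rewrite exprn_ge0.
by apply: mulr_ge0; [exact: mulr_ge0|rewrite exprn_ge0// cmod_ge0].
Qed.

Lemma qseries_qderiv k z : (0 < k)%N -> 0 < complex.Im z ->
  qderiv (qseries k) z (- k%:R * qseries k.+1 z).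
Proof.
move=> k0 z0; have [B B0 HB] := qseries_taylor k0 z0.
exists (B * expR (- (pi * complex.Im z))), (complex.Im z / 2).
split; [by rewrite mulr_ge0 ?expR_ge0|by rewrite divr_gt0|move=> h hr].
by rewrite mulrAC; apply: HB => //; lra.
Qed.

Lemma psi2_qseries z : 0 < complex.Im z -> psi 2 z = qseries 2 z.
Proof.
move=> z0; have nint n : z + n%:~R != 0 by apply: im_neq_int; rewrite gt_eqF.
have u1 := ee_neq1_int nint; have SL := qtermP 2 z0.
set L := zlim _ in SL; set u := ee z in u1.
have T0 : tends (fun N : nat => N.+1%:R * u ^+ N.+1) 0.
  have := tendsB (tends_sub (phi := succn) leqnSn SL) SL; rewrite subrr; apply: tends_ext => N.
  by rewrite /= zsS addrK /qterm /= addr0 expr1.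
have U0 : tends (fun N : nat => u ^+ N.+1) 0.
  apply: (@tends_squeeze _ _ _ 1 _ _ ler01 _ T0) => N; rewrite !subr0 mul1r cmodM cmod_nat.
  by rewrite ler_peMl ?cmod_ge0// ler1n.
(* The closed form of a partial sum of the series of [n u^n]. *)
have E (N : nat) : (1 - u) ^+ 2 * zs N (qterm 2 z) =
   u - (1 - u) * (N.+1%:R * u ^+ N.+1) - u * u ^+ N.+1.
  elim: N => [|N IH]; first by rewrite zs0 /qterm /= mulr0 mul1r expr1; ring.
  rewrite zsS mulrDr IH /qterm /= addr0 expr1 -/u -[N.+2%:R]natr1 -[N.+1%:R]natr1 !exprS; ring.
have := tends_unique (tendsZ ((1 - u) ^+ 2) SL)
  (tends_ext (fun N => esym (E N)) (tendsB (tendsB (tends_cst u) (tendsZ (1 - u) T0)) (tendsZ u U0))).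
rewrite !mulr0 !subr0 => EL.
have u2 : 1 - u != 0 by rewrite subr_eq0 eq_sym.
rewrite psi2E// /qseries /qcoef /pi_csc_sqr -/u -/L sqrrN divr1 -[X in _ * X / _]EL.
by move: (tpi ^+ 2) => T; field.
Qed.

(** By repeated differentiation of the case of weight 2. *)
Lemma psi_qseries k z : (1 < k)%N -> 0 < complex.Im z -> psi k z = qseries k z.
Proof.
case: k => // -[//|k] _; elim: k z => [|k IH] z z0; first exact: psi2_qseries.
have nint n : z + n%:~R != 0 by apply: im_neq_int; rewrite gt_eqF.
have D1 := psi_qderiv (isT : (0 < k.+2)%N) nint.
have D2 : qderiv (psi k.+2) z (- k.+2%:R * qseries k.+3 z).
  apply: (qderiv_near (r := complex.Im z)) (qseries_qderiv _ z0) => // h hz.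
  rewrite IH// ImD; have := Im_le_cmod h; rewrite ler_norml => /andP[]; lra.
have k0 : - (k.+2%:R : C) != 0 by rewrite oppr_eq0 pnatr_eq0.
exact: (mulfI k0) (qderiv_unique D1 D2).
Qed.

Lemma psi_taylor_exp k (y0 : R) : (1 < k)%N -> 0 < y0 -> exists2 B : R, 0 <= B &
  forall z h, y0 <= complex.Im z -> 2 * cmod h <= complex.Im z ->
  cmod (psi k (z + h) - psi k z - h * (- k%:R * psi k.+1 z)) <=
    B * cmod h ^+ 2 * expR (- (pi * complex.Im z)).
Proof.
move=> k1 y00; have [B B0 HB] := qseries_taylor (ltnW k1) y00.
exists B => // z h yz hz; have z0 := lt_le_trans y00 yz.
rewrite !psi_qseries//; [exact: HB|exact: ltnW|].
by rewrite ImD; have := Im_le_cmod h; rewrite ler_norml => /andP[]; lra.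
Qed.

Lemma far_row (tau z : C) : 0 < complex.Im tau -> exists N : nat, forall m : nat,
  (N <= m)%N -> 1 <= m%:R * complex.Im tau - `|complex.Im z|.
Proof.
move=> t0; exists (Num.truncn ((1 + `|complex.Im z|) / complex.Im tau)).+1 => m Nm.
have : (1 + `|complex.Im z|) / complex.Im tau < m%:R.
  by apply: lt_le_trans (truncnS_gt _) _; rewrite ler_nat.
by rewrite ltr_pdivrMr//; lra.
Qed.

(** Rows far below the real axis are reflected by [psi_opp]; finitely many rows near it only
    affect the constant. *)
Lemma psi_decay k (tau z : C) : (1 < k)%N -> 0 < complex.Im tau -> exists K c : R,
  [/\ 0 <= K, 0 < c & forall m : int, cmod (psi k (z + m%:~R * tau)) <= K * expR (- (c * `|m|%N%:R))].
Proof.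
move=> k1 t0; have pg := @pi_gt0 R; have [N HN] := far_row z t0.
have [B B0 HB] := qseries_bound k (ltr01 : 0 < 1 :> R).
pose c := pi * complex.Im tau.
pose S := \sum_(m <- zr N) cmod (psi k (z + m%:~R * tau)) * expR (c * `|m|%N%:R).
have S0 : 0 <= S by apply: sumr_ge0 => m _; rewrite mulr_ge0 ?cmod_ge0 ?expR_ge0.
exists (B * expR (pi * `|complex.Im z|) + S), c; split.
- by rewrite addr_ge0// mulr_ge0 ?expR_ge0.
- by rewrite mulr_gt0.
move=> m; have [Nm|/ltnW mN] := leqP N `|m|; last first.
  apply: le_trans (_ : S * expR (- (c * `|m|%N%:R)) <= _); last first.
    by rewrite ler_wpM2r ?expR_ge0// lerDr mulr_ge0 ?expR_ge0.
  rewrite expRN ler_pdivlMr ?expR_gt0// /S (bigD1_seq m) ?zr_uniq ?mem_zr//=.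
  by rewrite lerDl; apply: sumr_ge0 => i _; rewrite mulr_ge0 ?cmod_ge0 ?expR_ge0.
apply: le_trans (_ : B * expR (pi * `|complex.Im z|) * expR (- (c * `|m|%N%:R)) <= _); last first.
  by rewrite ler_wpM2r ?expR_ge0// lerDl.
rewrite -mulrA -expRD.
have H w : `|m|%N%:R * complex.Im tau - `|complex.Im z| <= complex.Im w ->
    cmod (psi k w) <= B * expR (pi * `|complex.Im z| + - (c * `|m|%N%:R)).
  move=> Hw; have w1 : 1 <= complex.Im w by have := HN _ Nm; lra.
  rewrite psi_qseries//; last by lra.
  apply: le_trans (HB _ w1) _; rewrite ler_wpM2l// ler_expR /c.
  have := ler_wpM2l (ltW pg) Hw; move: (pi : R) => P; lra.
have mE : m%:~R * tau = (m%:~R : R)%:C * tau by rewrite rmorph_int.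
have := ler_norm (complex.Im z); have := ler_norm (- complex.Im z); rewrite normrN => n1 n2.
case: (leP 0 m) => m0.
  apply: H; rewrite ImD mE Im_realM.
  have -> : (m%:~R : R) = `|m|%N%:R by rewrite -{1}(gez0_abs m0) pmulrn.
  lra.
rewrite -[cmod _]mul1r -[X in X * _](_ : cmod ((-1) ^+ k) = 1); last first.
  by rewrite cmodX cmodN cmod1 expr1n.
rewrite -cmodM -psi_opp; last exact: ltnW.
apply: H; rewrite ImN ImD mE Im_realM.
have -> : (m%:~R : R) = - `|m|%N%:R.
  by rewrite -[in LHS](opprK m) -(lez0_abs (ltW m0)) mulrNz pmulrn.
lra.
Qed.

(** With [u = exp (2 pi i z)], the left hand side is the modulus of [2 pi i u / (u - 1)],
    and [|u| <= 1/2]. *)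
Lemma psi1_exp_bound z : 1 <= complex.Im z ->
  cmod (psi 1 z + tpi / 2) <= 4 * pi * expR (- (2 * pi * complex.Im z)).
Proof.
move=> z1; have pg := @pi_gt0 R; have p2 := @pi_ge2 R.
rewrite psi1E; last by rewrite gt_eqF// (lt_le_trans ltr01).
rewrite -cmod_ee; set u := ee z.
have u12 : cmod u <= 1 / 2.
  rewrite /u cmod_ee expRN div1r.
  have E := expR_ge1Dx (2 * pi * complex.Im z).
  have p1 : 1 <= 2 * pi * complex.Im z by nra.
  by rewrite lef_pV2 ?posrE ?expR_gt0//; lra.
have u1 : 1 / 2 <= cmod (u - 1).
  by have := cmod_sub_ge 1 u; rewrite cmod1 cmod_subC; lra.
have u0 : u - 1 != 0 by rewrite -cmod_gt0; lra.
have -> : pi_cot z + tpi / 2 = tpi * u / (u - 1).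
  by rewrite /pi_cot -/u; move: (tpi) => T; field.
rewrite cmodM (cmodM tpi) cmod_tpi cmodV ler_pdivrMr; last by lra.
have := cmod_ge0 u; have : 0 <= pi * cmod u by rewrite mulr_ge0 ?cmod_ge0 ?ltW.
move: (pi : R) => P; nra.
Qed.

(** Far above the real axis [psi 1] tends to [- pi i], and by oddness to [pi i] far below.
    This jump is the source of the Legendre relation. *)
Lemma psi1_tends (tau z : C) : 0 < complex.Im tau ->
  tends (fun M : nat => psi 1 (z + M%:R * tau)) (- (tpi / 2)).
Proof.
move=> t0; have pg := @pi_gt0 R; have [N HN] := far_row z t0.
pose c := 2 * pi * complex.Im tau; have c0 : 0 < c by rewrite !mulr_gt0.
pose E := 4 * pi * expR (2 * pi * `|complex.Im z|).
have E0 : 0 <= E by rewrite !mulr_ge0 ?expR_ge0// ltW.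
have bE := bsumZ E0 (bsum_polyexp 0 c0).
have H : tends (fun M : nat => if (N <= M)%N then psi 1 (z + M%:R * tau) + tpi / 2 else 0) 0.
  apply: (bsum_tends0 bE) => M; case: ifP => NM; last by rewrite cmod0 mulr_ge0// polyexp_ge0.
  have ImE : complex.Im (z + M%:R * tau) = complex.Im z + M%:R * complex.Im tau.
    by rewrite ImD natC Im_realM.
  have := ler_norm (- complex.Im z); rewrite normrN => n2.
  have Hw : 1 <= complex.Im (z + M%:R * tau) by rewrite ImE; have := HN _ NM; lra.
  apply: le_trans (psi1_exp_bound Hw) _; rewrite /E /polyexp expr0 mul1r -(mulrA (4 * pi)) -expRD.
  rewrite ler_wpM2l//; first by rewrite mulr_ge0// ltW.
  rewrite ler_expR ImE /c; have : 0 <= pi * (`|complex.Im z| + complex.Im z) by rewrite mulr_ge0//; lra.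
  by move: (pi : R) => P; lra.
have := tendsB H (tends_cst (tpi / 2)); rewrite sub0r; apply: (@tends_eventually _ _ _ _ N) => M NM.
by rewrite NM addrK.
Qed.

Lemma psi1_bounded (tau z : C) : 0 < complex.Im tau -> exists2 K : R, 0 <= K &
  forall m : int, cmod (psi 1 (z + m%:~R * tau)) <= K.
Proof.
move=> t0.
have [K [K0 HK]] := tends_bounded (psi1_tends z t0).
have [L [L0 HL]] := tends_bounded (psi1_tends (- z) t0).
exists (K + L) => [|m]; first by rewrite addr_ge0.
case: m => m; first by have := HK m; rewrite -pmulrn; lra.
have := HL m.+1; rewrite NegzE mulrNz -pmulrn mulNr -[z - _]opprK opprB addrC.
by rewrite psi_opp// expr1 mulN1r cmodN; lra.
Qed.

End FourierSeries.

(** * Unordered and row-by-row summation *)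

Section LatticeSums.
Variable R : realType.
Local Notation C := R[i].
Implicit Types (x y z : C) (k : nat).
Local Notation tpi := (two_pi_i R).

Definition zbox (N : nat) : seq (int * int) := [seq (m, n) | m <- zr N, n <- zr N].

Lemma mem_zbox N (i : int * int) : (i \in zbox N) = (`|i.1| <= N)%N && (`|i.2| <= N)%N.
Proof.
case: i => m n; rewrite -!mem_zr; apply/allpairsP/andP => [[[a b] [/= ha hb [-> ->]]]|[hm hn]].
  by [].
by exists (m, n).
Qed.

Lemma zbox_uniq N : uniq (zbox N).
Proof. by rewrite allpairs_uniq ?zr_uniq// => -[a b] [c d]. Qed.

Lemma zbox_sum (V : nmodType) N (f : int * int -> V) :
  \sum_(i <- zbox N) f i = \sum_(m <- zr N) \sum_(n <- zr N) f (m, n).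
Proof. by rewrite big_allpairs. Qed.

Lemma sum_filter_sub (V : nmodType) (T : choiceType) (s t : seq T) (P : pred T) (f : T -> V) :
  uniq s -> uniq t -> (forall i, P i -> i \in s -> i \in t) ->
  \sum_(i <- t | P i) f i = \sum_(i <- s | P i) f i + \sum_(i <- t | P i && (i \notin s)) f i.
Proof.
move=> us ut st; rewrite (bigID (mem s)) /=; congr (_ + _).
rewrite -[LHS]big_filter -[RHS]big_filter; apply: perm_big.
apply: uniq_perm; rewrite ?filter_uniq// => i; rewrite !mem_filter.
by case: (boolP (P i)) => //= Pi; case: (boolP (i \in s)) => //= /(st _ Pi) ->.
Qed.

(** Unordered sums over the lattice can be computed by rows: on finite sets that contain a
    large box, the partial sums of [f] differ from those over the box by at most a tail of
    the majorant. *)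
Lemma sum_iterated (f : int * int -> C) b c : bsum b -> bsum c ->
  zdom2 (fun m n => f (m, n)) b c ->
  @summability.sum _ C C^o f = zlim (fun m => zlim (fun n => f (m, n))).
Proof.
move=> bb bc fbc; set L := zlim _; apply: cvg_lim; first exact: norm_hausdorff.
have SL : tends (fun N => \sum_(i <- zbox N) f i) L.
  have H := tannery2 bb bc (fun _ => fbc) (fun m n => tends_cst (f (m, n))).
  by apply: tends_ext H => N; rewrite zbox_sum.
pose B (i : int * int) : R := b `|i.1|%N * c `|i.2|%N.
have B0 i : 0 <= B i by rewrite mulr_ge0 ?bsum_ge0.
pose T N := \sum_(i <- zbox N) B i.
have [LT HT] : exists l, tends (fun N => (T N)%:C) l.
  have dB : zdom2 (fun m n => (B (m, n))%:C) b c.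
    by move=> m n; rewrite cmod_real ger0_norm.
  exists (zlim (fun m => zlim (fun n => (B (m, n))%:C))).
  have H := tannery2 bb bc (fun _ => dB) (fun m n => tends_cst (B (m, n))%:C).
  by apply: tends_ext H => N; rewrite /T rmorph_sum /= zbox_sum.
apply/cvgrPdist_lt => e; rewrite ltcE => /andP[/= /eqP Ie e0].
have e4 : 0 < complex.Re e / 4 by rewrite divr_gt0.
have [N1 HN1] := SL _ e4; have [N2 HN2] := HT _ e4.
pose N := maxn N1 N2.
exists [fset i | i in zbox N]%fset => // A /= /fsubsetP subA.
rewrite cmodE ltcE /= Ie eqxx /=.
have -> : summability.partial_sum f A = \sum_(i <- A) f i.
  by rewrite /summability.partial_sum big_seq_fsetE.
have boxA i : i \in zbox N -> i \in A by move=> iN; apply: subA; rewrite !inE.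
have -> : \sum_(i <- A) f i = \sum_(i <- zbox N) f i + \sum_(i <- A | i \notin zbox N) f i.
  by rewrite (sum_filter_sub (s := zbox N)) ?zbox_uniq ?fset_uniq// => i _; exact: boxA.
pose nm (i : int * int) := (`|i.1| + `|i.2|)%N.
pose X := \max_(i <- A) nm i.
pose M := (N + X)%N.
have AM (i : int * int) : i \in A -> i \in zbox M.
  move=> iA; have : (nm i <= X)%N by exact: (@leq_bigmax_seq _ (enum_fset A) xpredT nm i iA isT).
  by rewrite mem_zbox /M /nm; clearbody X => ?; apply/andP; split; lia.
have tail : cmod (\sum_(i <- A | i \notin zbox N) f i) <= T M - T N.
  apply: le_trans (_ : \sum_(i <- A | i \notin zbox N) B i <= _).
    by apply: le_trans (cmod_sum _ _ _) _; apply: ler_sum => -[m n] _; exact: fbc.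
  rewrite /T (sum_filter_sub (s := zbox N) (t := zbox M)) ?zbox_uniq//; last first.
    by move=> i _; rewrite !mem_zbox /M => /andP[? ?]; apply/andP; split; lia.
  rewrite addrC addKr.
  rewrite (sum_filter_sub (s := A) (t := zbox M)) ?zbox_uniq ?fset_uniq//; last by move=> i _ /AM.
  by rewrite lerDl sumr_ge0.
have TM : T M - T N < complex.Re e / 2.
  have H1 := HN2 M; have H2 := HN2 N (leq_maxr _ _).
  have {}H1 : cmod ((T M)%:C - LT) < complex.Re e / 4.
    by apply: H1; rewrite /M /N; lia.
  apply: le_lt_trans (ler_norm _) _; rewrite -cmod_real.
  have -> : (T M - T N)%:C = ((T M)%:C - LT) - ((T N)%:C - LT) by rewrite rmorphB; ring.
  by apply: le_lt_trans (cmodB _ _) _; lra.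
have := HN1 N (leq_maxl _ _); rewrite cmod_subC opprD addrA => H1.
by apply: le_lt_trans (cmodB _ _) _; lra.
Qed.

Section Tau.
Variable tau : C.
Hypothesis htau : 0 < complex.Im tau.

(** For [k > 2] this is the absolutely convergent sum of [(z + g)^-k] over the lattice, for
    [k = 2] it is Eisenstein summation. *)
Definition row_series k z : C := zlim (fun m => psi k (z + m%:~R * tau)).

Lemma row_seriesP k z : (1 < k)%N ->
  zsum (fun m => psi k (z + m%:~R * tau)) (row_series k z).
Proof.
move=> k1; have [K [c [K0 c0 H]]] := psi_decay z k1 htau.
apply: (zlimP (bsumZ K0 (bsum_polyexp 0 c0))) => m.
by rewrite /polyexp expr0 mul1r; exact: H.
Qed.

Lemma lattice_pt0 (m n : int) : m%:~R * tau + n%:~R = 0 -> m = 0 /\ n = 0.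
Proof.
have [K K0 H] := lattice_lower htau; move=> g0; have := H m n.
rewrite g0 cmod0 mulr0 -natrD lern0; lia.
Qed.

Lemma lattice_wt (m n : int) : m%:~R * tau + n%:~R = 0 -> (wt R m n)^-1 = 1.
Proof. by move=> /lattice_pt0[-> ->]; rewrite /wt /= invr1. Qed.

End Tau.
End LatticeSums.

(** * The Weierstrass zeta function by rows *)

Section Weierstrass.
Variable R : realType.
Local Notation C := R[i].
Implicit Types (x y z w : C) (k : nat).
Local Notation tpi := (two_pi_i R).
Variable tau : C.
Hypothesis htau : 0 < complex.Im tau.
Local Notation psum := (row_series tau).

Lemma wt3_dom2 (f : int -> int -> C) (K : R) : 0 <= K ->
  (forall m n, cmod (f m n) <= K * (wt R m n)^-1 ^+ 3) ->
  zdom2 f (fun j => K * b32 R j) (b32 R).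
Proof.
move=> K0 H m n; apply: le_trans (H m n) _.
by rewrite -mulrA ler_wpM2l// wt3_le.
Qed.

(** Up to sign each term is [w / g] times [(g - w)^-1 - g^-1]. For [g] equal to 0 or to [w],
    where inverses of 0 occur, the bound holds by the choice of the constant. *)
Lemma weierstrass_bound w : exists2 K : R, 0 <= K & forall m n,
  cmod ((w - lattice_pt tau (m, n))^-1 + (lattice_pt tau (m, n))^-1 +
        w / lattice_pt tau (m, n) ^+ 2) <= K * (wt R m n)^-1 ^+ 3.
Proof.
have [K K0 HK] := inv_bound htau (- w); have [L L0 HL] := inv_bound htau (0 : C).
pose B := cmod (- w) * L * (K + L) + cmod (- w)^-1.
have B0 : 0 <= B by rewrite addr_ge0 ?cmod_ge0// mulr_ge0 ?addr_ge0 ?(ltW K0) ?(ltW L0)// mulr_ge0 ?cmod_ge0// ltW.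
exists (2 * cmod w * L * B + cmod w^-1) => [|m n].
  by rewrite addr_ge0 ?cmod_ge0// mulr_ge0// mulr_ge0 ?(ltW L0)// mulr_ge0 ?cmod_ge0.
have HLn : cmod (m%:~R * tau + n%:~R)^-1 <= L * (wt R m n)^-1.
  by have := HL m n; rewrite add0r.
have HKn : cmod (- w + (m%:~R * tau + n%:~R))^-1 <= K * (wt R m n)^-1.
  by have := HK m n; rewrite addrA.
have H := inv_sub_bound (wtV_ge0 R m n) HKn HLn (@lattice_wt _ _ htau m n).
rewrite -/B in H; rewrite /lattice_pt /=.
move: H HLn (@lattice_wt _ _ htau m n) (wtV_ge0 R m n).
set g := (_ * _ + _); set v := (wt R m n)^-1 => H HLn Hw v0.
have [g0|g0] := eqVneq g 0.
  rewrite (Hw g0) g0 subr0 invr0 expr0n invr0 mulr0 !addr0 expr1n mulr1.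
  by rewrite lerDr mulr_ge0// mulr_ge0 ?(ltW L0)// mulr_ge0 ?cmod_ge0.
have step : cmod ((w - g)^-1 + g^-1 + w / g ^+ 2) <=
    2 * (cmod w * cmod g^-1 * cmod ((- w + g)^-1 - g^-1)).
  have ge : cmod w * cmod g^-1 * cmod ((- w + g)^-1 - g^-1) =
    cmod (w * g^-1 * ((- w + g)^-1 - g^-1)) by rewrite !cmodM.
  rewrite ge; have [wg|wg] := eqVneq (w - g) 0.
    have -> : w = g by apply/eqP; rewrite -subr_eq0 wg.
    have -> : (g - g)^-1 + g^-1 + g / g ^+ 2 = 2 * g^-1 by rewrite subrr invr0 add0r; field.
    rewrite addNr invr0 mulfV// mul1r sub0r cmodN cmodM cmod_nat.
    by [].
  have wg' : - w + g != 0 by rewrite -oppr_eq0 opprD opprK.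
  have -> : (w - g)^-1 + g^-1 + w / g ^+ 2 = - (w * g^-1 * ((- w + g)^-1 - g^-1)).
    by field; rewrite g0 wg wg'.
  by rewrite cmodN; have := cmod_ge0 (w * g^-1 * ((- w + g)^-1 - g^-1)); lra.
have step2 : cmod w * cmod g^-1 * cmod ((- w + g)^-1 - g^-1) <= cmod w * (L * v) * (B * v ^+ 2).
  by rewrite ler_pM ?mulr_ge0 ?cmod_ge0// ler_wpM2l ?cmod_ge0.
have := mulr_ge0 (cmod_ge0 w^-1) (exprn_ge0 3 v0).
have -> : (2 * cmod w * L * B + cmod w^-1) * v ^+ 3 =
  2 * (cmod w * (L * v) * (B * v ^+ 2)) + cmod w^-1 * v ^+ 3 by ring.
lra.
Qed.

(** Summed by rows, the correction terms [1 / g] cancel and the terms [w / g^2] add up to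
    [w E_2], so that only the sum of [1 / (w + g)] remains. *)
Lemma weierstrass_rows w :
  zsum (fun m => psi 1 (w + m%:~R * tau)) (weierstrass_zeta tau w - w * psum 2 0).
Proof.
have [K K0 HK] := weierstrass_bound w.
pose f (m n : int) : C := (w - lattice_pt tau (m, n))^-1 + (lattice_pt tau (m, n))^-1 +
        w / lattice_pt tau (m, n) ^+ 2.
have fdom := wt3_dom2 K0 HK; rewrite -/f in fdom.
pose g (m n : int) : C := if (m, n) == (0, 0) then 0 else f m n.
have gdom : zdom2 g (fun j => K * b32 R j) (b32 R).
  move=> m n; rewrite /g; case: ifP => _; last exact: fdom.
  by rewrite cmod0 !mulr_ge0// b32_ge0.
have bK := bsumZ K0 (bsum_b32 R); have bb := bsum_b32 R.
have zetaE : weierstrass_zeta tau w = w^-1 + zlim (fun m => zlim (g m)).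
  rewrite /weierstrass_zeta /lattice_sum (sum_iterated bK bb)//.
have rowsP (h : int -> int -> C) : zdom2 h (fun j => K * b32 R j) (b32 R) ->
    forall m, zsum (h m) (zlim (h m)).
  move=> hd m; apply: (zlimP (b := fun j => K * b32 R `|m|%N * b32 R j)) => //.
    by apply: bsumZ => //; rewrite mulr_ge0// b32_ge0.
have fg m : zlim (f m) = zlim (g m) + (if m == 0 then w^-1 else 0).
  apply: zlim_eq; have [->|m0] := eqVneq m 0; last first.
    rewrite addr0; apply: zsum_ext (rowsP _ gdom m) => n.
    by rewrite /g xpair_eqE (negbTE m0).
  have H1 : zsum (fun n : int => if n == 0 then w^-1 else 0) w^-1.
    apply: tends_ext (tends_cst _) => N.
    by rewrite (zs_pred1 (n0 := 0)) ?eqxx// => n /negbTE ->.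
  apply: zsum_ext (zsumD (rowsP _ gdom 0) H1) => n.
  rewrite /g xpair_eqE eqxx /=; case: eqVneq => [->|_]; last by rewrite addr0.
  by rewrite add0r /f /lattice_pt /= mul0r addr0 subr0 invr0 addr0 expr0n invr0 mulr0 addr0.
have frow m : zlim (f m) = psi 1 (w - m%:~R * tau) + psi 1 (m%:~R * tau) + w * psi 2 (m%:~R * tau).
  apply: zlim_eq.
  have P1 := zsum_opp (psiP (w - m%:~R * tau) (isT : (0 < 1)%N)).
  have P2 := psiP (m%:~R * tau) (isT : (0 < 1)%N).
  have P3 := zsumZ w (psiP (m%:~R * tau) (isT : (0 < 2)%N)).
  apply: zsum_ext (zsumD (zsumD P1 P2) P3) => n.
  by rewrite /f /lattice_pt /= !expr1 exprVn mulrNz opprD addrA.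
have S0 : zsum (fun m => zlim (f m)) (weierstrass_zeta tau w).
  have H1 : zsum (fun m : int => if m == 0 then w^-1 else 0) w^-1.
    apply: tends_ext (tends_cst _) => N.
    by rewrite (zs_pred1 (n0 := 0)) ?eqxx// => n /negbTE ->.
  have bg : bsum (fun j => bbound (b32 R) * (K * b32 R j)).
    by apply: bsumZ => //; exact: bbound_ge0.
  have H2 := zlimP bg (zdom2_zlim bK bb gdom).
  rewrite zetaE addrC; apply: zsum_ext (zsumD H2 H1) => m.
  by rewrite fg.
have S1 : zsum (fun m : int => psi 1 (m%:~R * tau)) 0.
  by apply: zsum_odd => m; rewrite mulrNz mulNr psi_opp// expr1 mulN1r.
have S2 : zsum (fun m : int => w * psi 2 (m%:~R * tau)) (w * psum 2 0).
  by apply: zsumZ; apply: zsum_ext (row_seriesP htau 0 (isT : (1 < 2)%N)) => m; rewrite add0r.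
have := zsum_opp (zsumB (zsumB S0 S1) S2); rewrite subr0; apply: zsum_ext => m.
by rewrite frow mulrNz mulNr opprK; ring.
Qed.

(** The function of [weierstrass_rows], the function [E_1] of Eisenstein, with [E_2] in the form of
    [eisenstein2_rows]. *)
Definition zhat w : C := weierstrass_zeta tau w - w * psum 2 0.

Lemma zhat_eq w l : zsum (fun m => psi 1 (w + m%:~R * tau)) l -> zhat w = l.
Proof. exact: tends_unique (weierstrass_rows w). Qed.

Lemma zhat_opp w : zhat (- w) = - zhat w.
Proof.
apply: zhat_eq; have := zsumZ (-1) (zsum_opp (weierstrass_rows w)); rewrite mulN1r.
apply: zsum_ext => m; rewrite mulN1r mulrNz mulNr -[in LHS](opprK w) -opprD.
by rewrite psi_opp// expr1 mulN1r opprK.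
Qed.

Lemma zhat0 : zhat 0 = 0.
Proof.
have := zhat_opp 0; rewrite oppr0 => /eqP; rewrite -subr_eq0 opprK -mulr2n mulrn_eq0 /=.
by move/eqP.
Qed.

Lemma zhat_addz w (n : int) : zhat (w + n%:~R) = zhat w.
Proof.
apply: zhat_eq; apply: zsum_ext (weierstrass_rows w) => m.
by rewrite addrAC psi_addz.
Qed.

(** The Legendre relation: adding [tau] moves the window of rows by one, which exchanges a
    row near [+ i oo] with one near [- i oo]. *)
Lemma zhat_addtau w : zhat (w + tau) = zhat w - tpi.
Proof.
apply: zhat_eq.
have H1 := tends_sub (phi := succn) leqnSn (psi1_tends w htau).
have H2 := psi1_tends (- w) htau.
have := tendsD (tendsD (weierstrass_rows w) H1) H2.
have -> : weierstrass_zeta tau w - w * psum 2 0 + - (tpi / 2) + - (tpi / 2) = zhat w - tpi.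
  by rewrite /zhat; move: (tpi) => T; field.
apply: tends_ext => N /=; pose F (m : int) := psi 1 (w + m%:~R * tau).
have -> : zs N (fun m => psi 1 (w + tau + m%:~R * tau)) = zs N (fun m => F (m + 1)).
  by apply: eq_zs => m; rewrite /F intrD mulrDl mul1r [in RHS](addrC _ tau) addrA.
rewrite zs_shift /F -pmulrn mulrNz -pmulrn mulNr.
have -> : psi 1 (- w + N%:R * tau) = - psi 1 (w - N%:R * tau).
  by rewrite -[- w + _]opprK opprD opprK psi_opp// expr1 mulN1r.
ring.
Qed.

Lemma zhat_addtauz w (m : int) : zhat (w + m%:~R * tau) = zhat w - tpi * m%:~R.
Proof.
have nat1 v (j : nat) : zhat (v + j%:R * tau) = zhat v - tpi * j%:R.
  elim: j => [|j IH]; first by rewrite mul0r mulr0 addr0 subr0.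
  rewrite -natr1 mulrDl mul1r addrA zhat_addtau IH; ring.
case: m => m; first exact: nat1.
rewrite NegzE mulrNz -pmulrn -[in RHS](subrK (m.+1%:R * tau) w) mulNr nat1; ring.
Qed.

End Weierstrass.

(** * Derivatives of the Weierstrass zeta function *)

Section ZetaDerivatives.
Variable R : realType.
Local Notation C := R[i].
Implicit Types (x y z w : C) (k : nat).
Variable tau : C.
Hypothesis htau : 0 < complex.Im tau.
Local Notation psum := (row_series tau).

Definition off_lattice z := forall m n : int, z + m%:~R * tau + n%:~R != 0.

Lemma off_lattice_lower z : off_lattice z -> exists2 r : R, 0 < r &
  forall h, 2 * cmod h < r -> (forall m n : int, 2 * cmod h <= cmod (z + m%:~R * tau + n%:~R)) /\
    off_lattice (z + h).
Proof.
move=> z0; have [K K0 HK] := inv_bound htau z.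
exists K^-1 => [|h hr]; first by rewrite invr_gt0.
have lower m n : K^-1 <= cmod (z + m%:~R * tau + n%:~R).
  by apply: inv_lower (HK m n) => //; rewrite ?invr_gt0 ?wt_gt0 ?wtV_le1.
split=> m n; first by rewrite (le_trans (ltW hr)).
rewrite -cmod_gt0; have -> : z + h + m%:~R * tau + n%:~R = (z + m%:~R * tau + n%:~R) + h by ring.
apply: lt_le_trans (cmod_add_ge _ _); have := lower m n; have := cmod_ge0 h; lra.
Qed.

(** Stated for any [F] because for [k = 1], where it is applied to [zhat], the rows do not
    converge absolutely; the remainders do in all cases. *)
Lemma row_qderiv k (F : C -> C) z : (0 < k)%N ->
  (forall w, zsum (fun m => psi k (w + m%:~R * tau)) (F w)) -> off_lattice z ->
  qderiv F z (- k%:R * psum k.+1 z).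
Proof.
move=> k0 HF z0; have [r r0 Hr] := off_lattice_lower z0.
have [B B0 HB] := psi_taylor R k0; have [K K0 HK] := inv_bound htau z.
have bb := bsum_b32 R; have K2 : 0 < K ^+ k.+2 by rewrite exprn_gt0.
exists (B * K ^+ k.+2 * bbound (b32 R)), (r / 2).
split; [by rewrite mulr_ge0 ?bbound_ge0// mulr_ge0// ltW|by rewrite divr_gt0|move=> h hr].
have [|Hh _] := Hr h; first by lra.
have -> : B * K ^+ k.+2 * bbound (b32 R) * cmod h ^+ 2 =
  (B * cmod h ^+ 2 * K ^+ k.+2) * bbound (b32 R) by ring.
have -> : F (z + h) - F z - h * (- k%:R * psum k.+1 z) =
   F (z + h) - F z - (h * - k%:R) * psum k.+1 z by rewrite mulrA.
have c0 : 0 <= B * cmod h ^+ 2 * K ^+ k.+2 by rewrite mulr_ge0 ?(ltW K2)// mulr_ge0// exprn_ge0 ?cmod_ge0.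
have S := zsumB (zsumB (HF (z + h)) (HF z)) (zsumZ (h * - k%:R) (row_seriesP htau z (k0 : (1 < k.+1)%N))).
apply: (zsum_le bb c0 _ S) => m; rewrite (addrAC z h) -mulrA.
apply: (HB (K ^+ k.+2) (b32 R `|m|) _ h) => //.
- exact: b32_ge0.
- move=> n; rewrite -cmodX; apply: le_trans (cmodVX_le k.+2 (wtV_ge0 R m n) (HK m n)) _.
  rewrite ler_wpM2l ?(ltW K2)//.
  by apply: le_trans (wt3_le R m n); rewrite wtVX_le// !ltnS.
Qed.

Lemma off_lattice_derive1 (f g : C -> C^o) (l : C) z : (forall w, off_lattice w -> f w = g w) ->
  off_lattice z -> qderiv g z l -> @derive1 C C^o f z = l.
Proof.
move=> fg z0 gl; apply: qderiv_derive1; have [r r0 Hr] := off_lattice_lower z0.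
apply: (qderiv_near (r := r / 2)) gl; first by rewrite divr_gt0.
by move=> h hr; rewrite fg//; have [] := Hr h => //; lra.
Qed.

(** The first derivative still contains the constant [E_2]; from the second one on, only
    powers of [z + g] remain. *)
Lemma zeta_derivE k z : off_lattice z ->
  weierstrass_zeta_deriv k.+2 tau z = (-1) ^+ k * k.+2`!%:R * psum k.+3 z.
Proof.
elim: k z => [|k IH] z z0.
  have D1 w : off_lattice w -> @derive1 C C^o (weierstrass_zeta tau) w = -1 * psum 2 w + psum 2 0.
    move=> w0; apply: (off_lattice_derive1 (g := fun w => zhat tau w + psum 2 0 * w) _ w0).
      by move=> v _; rewrite /zhat; ring.
    have := qderivD (row_qderiv (isT : (0 < 1)%N) (weierstrass_rows htau) w0)
       (qderivZ (psum 2 0) (qderiv_id w)).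
    by rewrite mulr1.
  rewrite /weierstrass_zeta_deriv /=.
  apply: (off_lattice_derive1 (g := fun w => -1 * psum 2 w + psum 2 0) _ z0) => //.
  have := qderivD (qderivZ (-1) (row_qderiv (isT : (0 < 2)%N) (fun w => row_seriesP htau w (isT : (1 < 2)%N)) z0))
    (qderiv_cst (psum 2 0) z).
  by rewrite addr0 mulrA mulrNN mul1r.
rewrite /weierstrass_zeta_deriv derive1nS.
apply: (off_lattice_derive1 (g := fun w => (-1) ^+ k * k.+2`!%:R * psum k.+3 w) _ z0); first exact: IH.
have := qderivZ ((-1) ^+ k * k.+2`!%:R)
  (row_qderiv (isT : (0 < k.+3)%N) (fun w => row_seriesP htau w (isT : (1 < k.+3)%N)) z0).
suff -> : (-1) ^+ k * k.+2`!%:R * (- k.+3%:R * psum k.+4 z) =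
  (-1) ^+ k.+1 * k.+3`!%:R * psum k.+4 z by [].
by rewrite [k.+3`!]factS natrM [(-1) ^+ k.+1]exprS; ring.
Qed.

End ZetaDerivatives.

(** * Eisenstein series by rows *)

Section Eisenstein.
Variable R : realType.
Local Notation C := R[i].
Implicit Types (x y z w : C) (k : nat).
Local Notation tpi := (two_pi_i R).

Lemma eisenstein_lattice n (tau : C) : 0 < complex.Im tau -> (1 < n)%N ->
  eisenstein n tau = row_series tau (2 * n) 0.
Proof.
move=> htau n1; rewrite /eisenstein gtn_eqF//.
have [K K0 HK] := inv_bound htau (0 : C).
have n0 : (2 * n != 0)%N by lia.
have E (m j : int) : (if (m, j) == (0, 0) then 0 else lattice_pt tau (m, j) ^- (2 * n)) =
   (0 + m%:~R * tau + j%:~R)^-1 ^+ (2 * n).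
  rewrite add0r -exprVn /lattice_pt /=; case: ifP => // /eqP[-> ->].
  by rewrite mul0r addr0 invr0 expr0n (negbTE n0).
have K2 : 0 <= K ^+ (2 * n) by rewrite exprn_ge0// ltW.
rewrite /lattice_sum (sum_iterated (bsumZ K2 (bsum_b32 R)) (bsum_b32 R)); last first.
  apply: (wt3_dom2 (f := fun m j => _)) => // m j; rewrite E.
  apply: le_trans (cmodVX_le (2 * n) (wtV_ge0 R m j) (HK m j)) _.
  by rewrite ler_wpM2l// wtVX_le//; lia.
congr zlim; apply/funext => m; congr zlim; apply/funext => j.
by rewrite E.
Qed.

Lemma riemann_zeta2 : psi 2 (0 : C) = 2 * (riemann_zeta R 2)%:C.
Proof.
have S := psiP (0 : C) (isT : (0 < 2)%N).
pose b (n : nat) : R := n.+1%:R ^- 2.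
have bE : riemannR (2%:R : R) = b.
  by apply/funext => n; rewrite /riemannR /b powR_mulrn.
have E N : zs N (fun n => (0 + n%:~R)^-1 ^+ 2) = (2 * series b N)%:C.
  elim: N => [|N IH]; first by rewrite zs0 addr0 invr0 expr0n seriesEord /= big_ord0 mulr0.
  rewrite zsS IH seriesEord /= big_ord_recr /= !add0r mulrNz invrN sqrrN -pmulrn.
  have -> : (N.+1%:R : C)^-1 ^+ 2 = (b N)%:C by rewrite /b fmorphV rmorphXn /= rmorph_nat exprVn.
  by rewrite -!rmorphD /=; congr (_%:C); ring.
have bs : bsum b.
  split=> [n|]; first by rewrite invr_ge0 exprn_ge0.
  have [B [B0 HB]] := tends_bounded S; exists B => N.
  have := HB N; rewrite E cmod_real => /(le_trans (ler_norm _)); rewrite seriesEord.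
  have : 0 <= \sum_(k < N) b k by apply: sumr_ge0 => k _; rewrite invr_ge0 exprn_ge0.
  by rewrite /=; lra.
have cb : series b @ \oo --> limn (series b).
  apply: nondecreasing_is_cvgn.
    by apply: nondecreasing_series => n _ _; case: bs.
  by case: bs => _ [B HB]; exists B => _ [N _ <-]; rewrite seriesEord; exact: HB.
apply: (tends_unique S); rewrite /riemann_zeta bE.
have H : tends (fun N => (series b N)%:C) (limn (series b))%:C.
  by apply: (@tends_of_ReIm R (fun N => (series b N)%:C)) => //=; exact: cvg_cst.
by apply: tends_ext (tendsZ 2 H) => N; rewrite E rmorphM /= rmorph_nat.
Qed.

Lemma divisor_sigma1 (k N : nat) : (k < N)%N ->
  (divisor_sigma 1 k.+1)%:R =
  \sum_(m < N) \sum_(d < N) (if (m.+1 * d.+1 == k.+1)%N then d.+1%:R else 0) :> C.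
Proof.
move=> kN; rewrite exchange_big /=.
have -> : divisor_sigma 1 k.+1 = (\sum_(d < N | (d.+1 %| k.+1)%N) d.+1)%N.
  rewrite /divisor_sigma.
  have -> : (\sum_(d <- divisors k.+1) d ^ 1 = \sum_(d <- [seq d <- iota 1 N | (d %| k.+1)%N]) d)%N.
    under eq_bigr do rewrite expn1.
    apply: perm_big; apply: uniq_perm; rewrite ?divisors_uniq ?filter_uniq ?iota_uniq// => d.
    rewrite mem_filter mem_iota -dvdn_divisors//.
    case: (boolP (d %| k.+1)%N) => //= dk; apply/esym/andP; split.
      exact: dvdn_gt0 dk.
    by have := dvdn_leq (ltn0Sn k) dk; lia.
  have -> : iota 1 N = index_iota 1 N.+1 by rewrite /index_iota subn1.
  rewrite big_filter big_add1 /= big_mkord.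
  by [].
rewrite natr_sum big_mkcond /=; apply: eq_bigr => d _.
case: ifP => dk; last first.
  rewrite big1// => m _; case: eqP => // H.
  by move: dk; rewrite -H dvdn_mull.
have dk' := divnK dk; have q0 : (0 < k.+1 %/ d.+1)%N by rewrite divn_gt0// dvdn_leq.
have qN : ((k.+1 %/ d.+1).-1 < N)%N by have := leq_div k.+1 d.+1; lia.
rewrite (bigD1 (Ordinal qN)) //= prednK// dk' eqxx big1 ?addr0// => m mq.
case: eqP => // H; move: mq; rewrite -val_eqE /= => /negP[]; apply/eqP.
by rewrite -H mulnK.
Qed.

Lemma zs_pos (f : int -> C) N : (forall n, n <= 0 -> f n = 0) ->
  zs N f = \sum_(m < N) f m.+1%:Z.
Proof.
move=> f0; elim: N => [|N IH]; first by rewrite zs0 big_ord0 f0.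
by rewrite zsS IH big_ord_recr /= [f (- _)]f0 ?addr0 1?addrC.
Qed.

(** The pairs [(m, d)] with [m d <= N] exhaust those of the double series. The majorant is a
    product since [m d >= m + d - 1] for positive integers. *)
Lemma lambert_rearranged (tau : C) : 0 < complex.Im tau ->
  tends (fun N => \sum_(k < N) (divisor_sigma 1 k.+1)%:R * ee tau ^+ k.+1)
    (zlim (fun m : int => if (0 < m)%R then zlim (qterm 2 (m%:~R * tau)) else 0)).
Proof.
move=> t0; have pg := @pi_gt0 R; pose c := 2 * pi * complex.Im tau.
have c0 : 0 < c by rewrite !mulr_gt0.
pose X (m d : int) : C := `|d|%N%:R * ee tau ^+ (`|m| * `|d|)%N.
pose G (m d : int) : C := if (0 < m)%R && (0 < d)%R then X m d else 0.
pose F (N : nat) (m d : int) : C := if (`|m| * `|d| <= N)%N then G m d else 0.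
have GX m d : cmod (G m d) <= polyexp 0 c `|m| * (expR c * polyexp 1 c `|d|).
  rewrite /G; case: ifP => [/andP[m0 d0]|_]; last first.
    by rewrite cmod0 mulr_ge0 ?polyexp_ge0// mulr_ge0 ?polyexp_ge0 ?expR_ge0.
  rewrite /X cmodM cmod_nat cmod_eeX -/c /polyexp expr0 mul1r expr1.
  have -> : expR (- (c * `|m|%N%:R)) * (expR c * (`|d|%N%:R * expR (- (c * `|d|%N%:R)))) =
     `|d|%N%:R * (expR (- (c * `|m|%N%:R)) * expR c * expR (- (c * `|d|%N%:R))) by ring.
  rewrite ler_wpM2l// -!expRD ler_expR.
  have m1 : (1 : R) <= `|m|%N%:R by rewrite ler1n; lia.
  have d1 : (1 : R) <= `|d|%N%:R by rewrite ler1n; lia.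
  have : 0 <= c * ((`|m|%N%:R - 1) * (`|d|%N%:R - 1)).
    by rewrite mulr_ge0 ?(ltW c0)// mulr_ge0// subr_ge0.
  rewrite natrM; clearbody c; lra.
have b0 := bsum_polyexp 0 c0; have b1 := bsumZ (expR_ge0 c) (bsum_polyexp 1 c0).
have := @tannery2 R F G _ _ b0 b1 _ _.
have -> : (fun m : int => if (0 < m)%R then zlim (qterm 2 (m%:~R * tau)) else 0) =
    (fun m => zlim (G m)).
  apply/funext => m; case: ifP => m0; last first.
    by apply/esym/zlim_eq; apply: tends_ext (tends_cst 0) => N; rewrite /zs big1// => d _; rewrite /G m0.
  congr zlim; apply/funext => d; rewrite /qterm /G m0 /=; case: ifP => // d0.
  rewrite /X expr1 exprM; congr (_ * _ ^+ _).
  by rewrite -eeMn; congr ee; rewrite -{1}(gez0_abs (ltW m0)) -pmulrn.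
move=> H; apply: tends_ext (H _ _) => [N|N m d|m d].
- rewrite zs_pos; last first.
    by move=> m m0; rewrite /zs big1// => d _; rewrite /F /G ltNge m0 /= if_same.
  transitivity (\sum_(m < N) \sum_(d < N) F N m.+1%:Z d.+1%:Z).
    apply: eq_bigr => m _; rewrite zs_pos// => d d0.
    by rewrite /F /G [(0 < d)%R]ltNge d0 andbF if_same.
  transitivity (\sum_(k < N) \sum_(m < N) \sum_(d < N)
     (if (m.+1 * d.+1 == k.+1)%N then d.+1%:R * ee tau ^+ k.+1 else 0)).
    rewrite [RHS]exchange_big; apply: eq_bigr => m _ /=.
    rewrite [RHS]exchange_big; apply: eq_bigr => d _ /=.
    rewrite /F /= /G /= /X /=; case: ifP => mdN; last first.
      rewrite big1// => k _; case: eqP => // H2.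
      by move: mdN; rewrite H2 ltn_ord.
    have kN : ((m.+1 * d.+1).-1 < N)%N by rewrite prednK ?muln_gt0.
    have [j jE] : exists j : 'I_N, (j.+1 = m.+1 * d.+1)%N.
      by exists (Ordinal kN); rewrite [LHS]prednK ?muln_gt0.
    rewrite (bigD1 j) //= jE eqxx big1 ?addr0// => k kj.
    case: eqP => // H2; move: kj; rewrite -val_eqE => /negP[]; apply/eqP => /=.
    by apply: succn_inj; rewrite jE.
  apply: eq_bigr => k _; rewrite (divisor_sigma1 (ltn_ord k)) mulr_suml.
  apply: eq_bigr => m _; rewrite mulr_suml; apply: eq_bigr => d _.
  by case: ifP => _; rewrite ?mul0r.
- rewrite /F; case: ifP => _; first exact: GX.
  by rewrite cmod0 (le_trans _ (GX m d)) ?cmod_ge0.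
- apply: (@tends_eventually _ (fun=> G m d) _ _ (`|m| * `|d|)%N); last exact: tends_cst.
  by move=> N HN; rewrite /F HN.
Qed.

(** The row [m = 0] is twice the zeta value; the rows [m] and [- m] are equal, and the
    Lipschitz formula turns them into a Lambert series. *)
Lemma eisenstein2_rows (tau : C) : 0 < complex.Im tau -> eisenstein 1 tau = row_series tau 2 0.
Proof.
move=> t0; rewrite /eisenstein /= /eisenstein_fourier.
have L := lambert_rearranged t0; set S := zlim _ in L.
have -> : limn (series (fun k : nat =>
    (divisor_sigma (2 * 1).-1 k.+1)%:R * cexp (tpi * k.+1%:R * tau)) : nat -> C^o) = S.
  apply: cvg_lim; first exact: norm_hausdorff.
  apply: tends_cvg; apply: tends_ext L => N; rewrite seriesEord /=.
  by apply: eq_bigr => k _; rewrite -eeMn /ee mulrA.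
have -> : 2 * (riemann_zeta R (2 * 1))%:C = psi 2 (0 : C) by rewrite riemann_zeta2.
pose r (m : int) : C := if (0 < m)%R then zlim (qterm 2 (m%:~R * tau)) else 0.
have rS : zsum r S.
  have [K [c [K0 c0 H]]] := psi_decay 0 (isT : (1 < 2)%N) t0.
  have q0 : qcoef R 2 != 0.
    by rewrite /qcoef sqrrN mulf_neq0 ?invr_neq0 ?oner_neq0// expf_neq0// tpi_neq0.
  apply: (zlimP (b := fun j => cmod (qcoef R 2)^-1 * (K * polyexp 0 c j))).
    by apply: bsumZ; rewrite ?cmod_ge0//; apply: bsumZ => //; exact: bsum_polyexp.
  move=> m; rewrite /r; case: ifP => m0; last first.
    by rewrite cmod0 mulr_ge0 ?cmod_ge0// mulr_ge0// polyexp_ge0.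
  have -> : zlim (qterm 2 (m%:~R * tau)) = (qcoef R 2)^-1 * psi 2 (0 + m%:~R * tau).
    rewrite psi_qseries ?add0r// ?mulKf// intC Im_realM mulr_gt0// ltr0z//.
  by rewrite cmodM ler_wpM2l ?cmod_ge0// /polyexp expr0 mul1r.
apply/esym/zlim_eq.
have H0 : zsum (fun m : int => if m == 0 then psi 2 (0 : C) else 0) (psi 2 0).
  apply: tends_ext (tends_cst _) => N.
  by rewrite (zs_pred1 (n0 := 0)) ?eqxx// => n /negbTE ->.
have := zsumD H0 (zsumZ (qcoef R 2) (zsumD rS (zsum_opp rS))).
have -> : psi 2 0 + qcoef R 2 * (S + S) = psi 2 0 + 2 * tpi ^+ (2 * 1) / ((2 * 1).-1)`!%:R * S.
  by rewrite /qcoef sqrrN; ring.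
apply: zsum_ext => m; rewrite add0r.
have E v : 0 < complex.Im v -> qcoef R 2 * zlim (qterm 2 v) = psi 2 v.
  by move=> v0; rewrite psi_qseries.
have [m0|m0|->] := ltgtP m 0.
- rewrite /r oppr_gt0 m0 ltNge (ltW m0) /= !add0r E.
    by rewrite mulrNz mulNr psi_opp// sqrrN expr1n mul1r.
  by rewrite intC Im_realM mulr_gt0// ltr0z oppr_gt0.
- rewrite /r oppr_gt0 m0 ltNge (ltW m0) /= !addr0 add0r E//.
  by rewrite intC Im_realM mulr_gt0// ltr0z.
- by rewrite /r oppr0 ltxx mul0r !addr0 mulr0 addr0.
Qed.

Lemma eisenstein_rows n (tau : C) : 0 < complex.Im tau -> (0 < n)%N ->
  eisenstein n tau = row_series tau (2 * n) 0.
Proof.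
by case: n => // -[|n] t0 _; [exact: eisenstein2_rows|exact: eisenstein_lattice].
Qed.

(** The weight [m] is harmless in view of the exponential decay of the rows. *)
Lemma moment_sum k (tau : C) : 0 < complex.Im tau -> (1 < k)%N ->
  zsum (fun m : int => m%:~R * psi k (m%:~R * tau)) (zlim (fun m : int => m%:~R * psi k (m%:~R * tau))).
Proof.
move=> t0 k1; have [K [c [K0 c0 H]]] := psi_decay 0 k1 t0.
apply: (zlimP (bsumZ K0 (bsum_polyexp 1 c0))) => m.
have := H m; rewrite add0r /polyexp expr1 cmodM cmod_int mulrCA => Hm.
by rewrite ler_wpM2l.
Qed.

(** Rows are differentiated one by one, the argument [m tau] moving with speed [m]; the
    Taylor remainder of the row [m] is of order [m^2 |h|^2], times an exponential. *)
Lemma eisenstein_derive1 n (tau : C) : 0 < complex.Im tau -> (0 < n)%N ->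
  @derive1 C C^o (eisenstein n) tau =
  - (2 * n)%:R * zlim (fun m : int => m%:~R * psi (2 * n).+1 (m%:~R * tau)).
Proof.
move=> t0 n0; apply: qderiv_derive1.
have k1 : (1 < 2 * n)%N by lia.
have [B B0 HB] := psi_taylor_exp k1 t0.
have p0 : 0 < pi * complex.Im tau by rewrite mulr_gt0// pi_gt0.
have bb := bsum_polyexp 2 p0.
exists (B * bbound (polyexp 2 (pi * complex.Im tau))), (complex.Im tau / 2).
split; [by rewrite mulr_ge0 ?bbound_ge0|by rewrite divr_gt0|move=> h hr].
have th0 : 0 < complex.Im (tau + h).
  by rewrite ImD; have := Im_le_cmod h; rewrite ler_norml => /andP[]; lra.
rewrite !eisenstein_rows// [leRHS]mulrAC (mulrA h).
have S := zsumB (zsumB (row_seriesP th0 0 k1) (row_seriesP t0 0 k1))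
  (zsumZ (h * - (2 * n)%:R) (moment_sum t0 (ltnW k1 : (1 < (2 * n).+1)%N))).
have c0 : 0 <= B * cmod h ^+ 2 by rewrite mulr_ge0// exprn_ge0// cmod_ge0.
apply: (zsum_le bb c0 _ S); set f := fun m : int => _.
have fpos (j : nat) : cmod (f j%:Z) <= B * cmod h ^+ 2 * polyexp 2 (pi * complex.Im tau) j.
  have ImE : complex.Im (j%:R * tau) = j%:R * complex.Im tau by rewrite natC Im_realM.
  case: j ImE => [_|j ImE].
    by rewrite /f !mul0r !addr0 mulr0 subrr subr0 cmod0 mulr_ge0// polyexp_ge0.
  have j1 : (1 : R) <= j.+1%:R by rewrite ler1n.
  have /HB : complex.Im tau <= complex.Im (j.+1%:R * tau) by rewrite ImE ler_peMl// ltW.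
  move=> /(_ (j.+1%:R * h)); rewrite cmodM cmod_nat ImE.
  have -> : f j.+1%:Z = psi (2 * n) (j.+1%:R * tau + j.+1%:R * h) - psi (2 * n) (j.+1%:R * tau) -
     j.+1%:R * h * (- (2 * n)%:R * psi (2 * n).+1 (j.+1%:R * tau)).
    by rewrite /f -pmulrn !add0r mulrDr; ring.
  have -> : B * (j.+1%:R * cmod h) ^+ 2 * expR (- (pi * (j.+1%:R * complex.Im tau))) =
     B * cmod h ^+ 2 * polyexp 2 (pi * complex.Im tau) j.+1.
    rewrite /polyexp; have -> : pi * (j.+1%:R * complex.Im tau) = pi * complex.Im tau * j.+1%:R by rewrite mulrCA mulrC.
    by rewrite exprMn; ring.
  by apply; rewrite mulrCA ler_wpM2l//; lra.
case=> j; first exact: fpos.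
have -> : f (Negz j) = f j.+1%:Z; last exact: fpos.
have even w : psi (2 * n) (- w) = psi (2 * n) w.
  by rewrite psi_opp ?(ltnW k1)// exprM sqrrN expr1n expr1n mul1r.
have odd w : psi (2 * n).+1 (- w) = - psi (2 * n).+1 w.
  by rewrite psi_opp// exprS exprM sqrrN expr1n expr1n mulr1 mulN1r.
by rewrite /f NegzE mulrNz !mulNr !add0r !even odd ; ring.
Qed.

End Eisenstein.

(** * The addition formula *)

Section PartialFractions.
Variable R : realType.
Local Notation C := R[i].
Implicit Types (X Y a b c : C) (k : nat).

(** A geometric sum when [X], [Y] are distinct and nonzero. With inverses of 0 equal to 0 it
    holds without exception, at the cost of the three boundary terms. *)
Lemma partial_fractions k X Y : (0 < k)%N ->
  \sum_(i < k) X^-1 ^+ i.+1 * Y^-1 ^+ (k - i) =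
  (Y - X)^-1 * X^-1 ^+ k - (Y - X)^-1 * Y^-1 ^+ k + (X == 0)%:R * Y^-1 ^+ k.+1 +
  (Y == 0)%:R * X^-1 ^+ k.+1 + k%:R * ((Y - X == 0)%:R * X^-1 ^+ k.+1).
Proof.
move=> k0; have kn : (k == 0)%N = false by case: k k0.
have [->|X0] := eqVneq X 0.
  rewrite invr0 big1 => [|i _]; last by rewrite expr0n mul0r.
  by rewrite subr0 !expr0n kn /= exprS; ring.
have [->|Y0] := eqVneq Y 0.
  rewrite invr0 big1 => [|i _]; last by rewrite expr0n subn_eq0 leqNgt ltn_ord mulr0.
  by rewrite sub0r oppr_eq0 (negbTE X0) !expr0n kn /= !mulr0 !mul0r mulr0 invrN mul1r exprS; ring.
rewrite subr_eq0; have [->|YX] := eqVneq Y X.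
  rewrite subrr !mul0r !add0r mul1r.
  rewrite (eq_bigr (fun=> X^-1 ^+ k.+1)) => [|i _]; first by rewrite sumr_const card_ord mulr_natl.
  by rewrite -exprD; congr (_ ^+ _); have := ltn_ord i; lia.
rewrite !mul0r mulr0 !addr0 -mulrBr subrXX mulrA.
have -> : (Y - X)^-1 * (X^-1 - Y^-1) = X^-1 * Y^-1.
  by field; rewrite X0 Y0 subr_eq0 YX.
rewrite mulr_sumr (reindex_inj rev_ord_inj); apply: eq_bigr => i _ /=.
rewrite -{1}[(k - (k - i.+1))%N](_ : i.+1 = _); last by have := ltn_ord i; lia.
rewrite exprS [Y^-1 ^+ i.+1]exprS.
have -> : (k - i.+1 = k.-1 - i)%N by lia.
ring.
Qed.

(** Then the boundary terms of [partial_fractions] occur for the integer 0 only, or not at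
    all. *)
Definition only_zero a := forall n : int, a + n%:~R = 0 -> n = 0.

Lemma zs_indicator a N : only_zero a -> zs N (fun n => (a + n%:~R == 0)%:R : C) = (a == 0)%:R.
Proof.
move=> ha; rewrite (zs_pred1 (n0 := 0)) ?addr0// => n n0.
by case: eqP => // /ha /eqP; rewrite (negbTE n0).
Qed.

(** The inner series converges conditionally and its window is off by [s n]; this costs
    [O(|n|)], which the power [k > 2] compensates. *)
Lemma dominated_product k a c (s : int -> int) : (2 < k)%N -> (forall n, `|s n|%N = `|n|%N) ->
  tends (fun N => zs N (fun n => (a + n%:~R)^-1 ^+ k *
                                 zs N (fun j => (c + (j + s n)%:~R)^-1)))
        (psi k a * psi 1 c).
Proof.
move=> k2 hs; have [K K0 HK] := inv_bound1 a; have [L L0 HL] := inv_bound1 c.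
pose f (j : int) : C := (c + j%:~R)^-1.
have Sf (m : int) : zsum (fun j => f (j + m)) (psi 1 c).
  rewrite -(psi_addz c m (isT : (0 < 1)%N)); apply: zsum_ext (psiP (c + m%:~R) (isT : (0 < 1)%N)) => j.
  by rewrite /f expr1 intrD addrA addrAC.
have [M [M0 HM]] := tends_bounded (Sf 0).
have fL j : cmod (f j) <= L.
  by apply: le_trans (HL j) _; rewrite ler_piMr ?wtV_le1// ltW.
have -> : psi k a * psi 1 c = zlim (fun n => (a + n%:~R)^-1 ^+ k * psi 1 c).
  apply/esym/zlim_eq; rewrite mulrC; apply: zsum_ext (zsumZ (psi 1 c) (psiP a (ltn_trans (isT : (0 < 2)%N) k2))) => n.
  by rewrite mulrC.
have C0 : 0 <= K ^+ k * (M + 2 * L) by rewrite mulr_ge0 ?exprn_ge0 ?(ltW K0)// addr_ge0// mulr_ge0// ltW.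
apply: (@tannery R _ _ _ (bsumZ C0 (bsum_b32 R))) => [N n|n]; last exact: tendsZ (Sf (s n)).
have w1 := wt_ge1 R 0 n; have wn : wt R 0 n = 1 + `|n|%N%:R by rewrite /wt /= addn0 natrD.
have H1 := cmodVX_le k (wtV_ge0 R 0 n) (HK n).
have H2 : cmod (zs N (fun j => f (j + s n))) <= (M + 2 * L) * wt R 0 n.
  have := zs_shift_bound N (s n) fL; rewrite hs => Hs.
  have := HM N; rewrite (eq_zs N (g := f)) => [HMN|j]; last by rewrite addr0.
  have := cmodD (zs N (fun j => f (j + s n)) - zs N f) (zs N f); rewrite subrK.
  have n0 : (0 : R) <= `|n|%N%:R by [].
  have := mulr_ge0 M0 n0; have := mulr_ge0 (ltW L0) n0; rewrite wn; lra.
rewrite cmodM; apply: le_trans (ler_pM (cmod_ge0 _) (cmod_ge0 _) H1 H2) _.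
have -> : K ^+ k * (wt R 0 n)^-1 ^+ k * ((M + 2 * L) * wt R 0 n) =
  K ^+ k * (M + 2 * L) * (wt R 0 n)^-1 ^+ k.-1.
  have -> : k = k.-1.+1 by lia.
  by rewrite [_^-1 ^+ k.-1.+1]exprSr /=; field; rewrite gt_eqF// wt_gt0.
rewrite ler_wpM2l//; apply: le_trans (wt2_le R n); rewrite wtVX_le//; lia.
Qed.

(** [partial_fractions] for [X = a + n] and [Y = b + m], summed over [n] and [m]. *)
Lemma psi_addition k a b : (2 < k)%N -> only_zero a -> only_zero b -> only_zero (b - a) ->
  \sum_(i < k) psi i.+1 a * psi (k - i) b =
  psi 1 (b - a) * psi k a - psi 1 (b - a) * psi k b + (a == 0)%:R * psi k.+1 b +
  (b == 0)%:R * psi k.+1 a + k%:R * ((b - a == 0)%:R * psi k.+1 a).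
Proof.
move=> k2 ha hb hba; have k0 : (0 < k)%N by lia.
pose Xn (n : int) := a + n%:~R; pose Yn (n : int) := b + n%:~R.
have L : tends (fun N => \sum_(i < k) zs N (fun n => (Xn n)^-1 ^+ i.+1) * zs N (fun n => (Yn n)^-1 ^+ (k - i)))
   (\sum_(i < k) psi i.+1 a * psi (k - i) b).
  apply: tends_sum => i; apply: tendsM; apply: psiP => //.
  by rewrite subn_gt0.
apply: (tends_unique L).
have T1 := @dominated_product k a (b - a) (fun n => - n) k2 abszN.
have T2 := @dominated_product k b (b - a) id k2 (fun _ => erefl).
have T3 := tendsZ (a == 0)%:R (psiP b (ltn0Sn k)).
have T4 := tendsZ (b == 0)%:R (psiP a (ltn0Sn k)).
have T5 := tendsZ k%:R (tendsZ (b - a == 0)%:R (psiP a (ltn0Sn k))).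
rewrite [psi 1 (b - a) * psi k a]mulrC [psi 1 (b - a) * psi k b]mulrC.
have := tendsD (tendsD (tendsD (tendsB T1 T2) T3) T4) T5; apply: tends_ext => N.
transitivity (zs N (fun n => zs N (fun m => \sum_(i < k) (Xn n)^-1 ^+ i.+1 * (Yn m)^-1 ^+ (k - i)))); last first.
  rewrite (eq_zs N (g := fun n => \sum_(i < k) (Xn n)^-1 ^+ i.+1 * zs N (fun m => (Yn m)^-1 ^+ (k - i)))).
    by rewrite zs_sum; apply: eq_bigr => i _; rewrite zsZr.
  by move=> n; rewrite zs_sum; apply: eq_bigr => i _; rewrite zsZ.
rewrite [RHS](eq_zs N (g := fun n => zs N (fun m =>
  (Yn m - Xn n)^-1 * (Xn n)^-1 ^+ k - (Yn m - Xn n)^-1 * (Yn m)^-1 ^+ k +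
  (Xn n == 0)%:R * (Yn m)^-1 ^+ k.+1 + (Yn m == 0)%:R * (Xn n)^-1 ^+ k.+1 +
  k%:R * ((Yn m - Xn n == 0)%:R * (Xn n)^-1 ^+ k.+1)))); last first.
  by move=> n; apply: eq_zs => m; exact: partial_fractions.
have YX n m : Yn m - Xn n = b - a + (m - n)%:~R by rewrite /Yn /Xn intrB; ring.
have split5 (A B D E F : int -> int -> C) :
    zs N (fun n => zs N (fun m => A n m - B n m + D n m + E n m + F n m)) =
    zs N (fun n => zs N (A n)) - zs N (fun n => zs N (B n)) + zs N (fun n => zs N (D n)) +
    zs N (fun n => zs N (E n)) + zs N (fun n => zs N (F n)).
  by rewrite -zsB -!zsD; apply: eq_zs => n; rewrite -zsB -!zsD.
rewrite split5; congr (_ - _ + _ + _ + _).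
- apply: eq_zs => n; rewrite zsZr mulrC; congr (_ * _).
  by apply: eq_zs => m; rewrite YX.
- rewrite zs_exchange; apply: eq_zs => m; rewrite zsZr mulrC; congr (_ * _).
  rewrite -zs_opp; apply: eq_zs => n.
  by rewrite YX (addrC m).
- rewrite -(zs_indicator N ha) -zsZr; apply: eq_zs => n.
  by rewrite zsZ.
- rewrite -(zs_indicator N hb) -zsZ; apply: eq_zs => n.
  by rewrite zsZr.
- rewrite -!zsZ; apply: eq_big_seq => n; rewrite mem_zr => nN.
  rewrite zsZ zsZr; congr (_ * (_ * _)).
  rewrite (zs_pred1 (n0 := n))// ?YX ?subrr ?addr0// => m mn.
  rewrite YX; case: eqP => // /hba /eqP; rewrite subr_eq0.
  by rewrite (negbTE mn).
Qed.

End PartialFractions.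

(** * Sums over division points *)

Section Reciprocity.
Variable R : realType.
Local Notation C := R[i].
Implicit Types (x y z w : C) (k : nat).
Local Notation tpi := (two_pi_i R).
Variable tau : C.
Hypothesis htau : 0 < complex.Im tau.
Local Notation psum := (row_series tau).
Local Notation zh := (zhat tau).

(** The rows [m] extend over all integers, so that [m] is not reduced modulo [p]; the
    residue [r] is, [psi] being periodic. *)
Definition tors (p : nat) (m : int) (r : nat) : C := (m%:~R * tau + r%:R) / p%:R.

Lemma natC_neq0 (p : nat) : (0 < p)%N -> (p%:R : C) != 0.
Proof. by rewrite pnatr_eq0 -lt0n. Qed.

Lemma tors_eq0 p (m : int) (r : nat) (j : int) : (0 < p)%N -> tors p m r + j%:~R = 0 ->
  m = 0 /\ r%:Z + p%:Z * j = 0.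
Proof.
move=> p0 H; apply: (lattice_pt0 htau); have pn := natC_neq0 p0.
have := congr1 (fun w => w * p%:R) H; rewrite mul0r mulrDl divfK// => <-.
by rewrite intrD intrM -!pmulrn; ring.
Qed.

Lemma tors_only_zero p (m : int) (r : nat) : (r < p)%N -> only_zero (tors p m r).
Proof. by move=> rp j /tors_eq0 [|_]; [exact: leq_ltn_trans rp|nia]. Qed.

Lemma tors_add p (m s : int) (r : nat) : (0 < p)%N ->
  tors p (s + p%:Z * m) r = tors p s r + m%:~R * tau.
Proof.
move=> p0; rewrite /tors intrD intrM -pmulrn; field.
exact: natC_neq0.
Qed.

(** The bracket of the Dedekind sum at the point [tors p m r]. The last term makes up for the
    quasi-period of [zhat]. *)
Definition zper (p : nat) (q m : int) (r : nat) : C :=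
  zh (q%:~R * tors p m r) + tpi * (q%:~R * m%:~R / p%:R).

Lemma zper_periodic p (q s m : int) (r : nat) : (0 < p)%N ->
  zper p q (s + p%:Z * m) r = zper p q s r.
Proof.
move=> p0; rewrite /zper tors_add// mulrDr mulrA -intrM zhat_addtauz//.
have pn := natC_neq0 p0; rewrite !intrD !intrM -pmulrn.
by move: (tpi) => T; field.
Qed.

Lemma zper0 p q : zper p q 0 0 = 0.
Proof. by rewrite /zper /tors !mulr0z !(mul0r, mulr0, addr0) zhat0. Qed.

Lemma zper_addp p (q m : int) (r : nat) : (0 < p)%N -> zper p (q + p%:Z) m r = zper p q m r.
Proof.
move=> p0; have pn := natC_neq0 p0; rewrite /zper.
have -> : (q + p%:Z)%:~R * tors p m r = q%:~R * tors p m r + r%:Z%:~R + m%:~R * tau.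
  by rewrite intrD -!pmulrn /tors; field.
rewrite zhat_addtauz// zhat_addz// intrD -pmulrn.
by move: (tpi) => T; field.
Qed.

Lemma zper_opp p (q m : int) (r : nat) : zper p (- q) m r = - zper p q m r.
Proof. by rewrite /zper mulrNz !mulNr zhat_opp// mulrN -opprD. Qed.

(** The excluded point [(0, 0)] may be included because [zper] vanishes there. *)
Lemma dedekind_D_rows n p (q : int) : (0 < n)%N -> (0 < p)%N ->
  dedekind_D n p q tau = (tpi ^+ 2 * p%:R)^-1 *
    \sum_(r < p) \sum_(m < p) psum (2 * n).+1 (tors p m%:Z r) * zper p q m%:Z r.
Proof.
move=> n0 p0; rewrite /dedekind_D.
have f0 : ((2 * n)`!%:R : C) != 0 by rewrite pnatr_eq0 -lt0n fact_gt0.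
rewrite [X in X * _]invfM -[LHS]mulrA; congr (_ * _).
rewrite mulr_sumr; apply: eq_bigr => r _; rewrite mulr_sumr big_mkcond; apply: eq_bigr => m _.
case: ifPn => rm; last first.
  move: rm; rewrite negbK xpair_eqE => /andP[/eqP -> /eqP ->].
  by rewrite zper0 mulr0.
have -> : (r%:R + m%:R * tau) / p%:R = tors p m%:Z r by rewrite /tors addrC.
have off : off_lattice tau (tors p m%:Z r).
  move=> a b; apply/eqP; rewrite -tors_add// => /(tors_eq0 p0)[H1 H2].
  have rp := ltn_ord r; have mp := ltn_ord m.
  have a0 : a = 0 by nia.
  have b0 : b = 0 by nia.
  move: rm H1 H2; rewrite xpair_eqE a0 b0; lia.
have [j jE] : exists j, (2 * n = j.+2)%N by exists (2 * n).-2; lia.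
rewrite jE zeta_derivE// -jE.
have -> : (-1) ^+ j = 1 :> C.
  have -> : j = (2 * n.-1)%N by lia.
  by rewrite exprM sqrrN expr1n expr1n.
rewrite mul1r mulrA mulrA mulVf// mul1r; congr (_ * _).
by rewrite /zper /zhat eisenstein2_rows// -pmulrn (mulrC (psum 2 0)).
Qed.

Lemma tors_tau p (m : int) (r : nat) : tors p m r = r%:R / p%:R + m%:~R * (tau / p%:R).
Proof. by rewrite /tors mulrDl addrC mulrA. Qed.

Lemma Im_div_nat z (p : nat) : complex.Im (z / p%:R) = complex.Im z / p%:R.
Proof. by rewrite natC -fmorphV mulrC Im_realM mulrC. Qed.

Lemma tau_div_gt0 p : (0 < p)%N -> 0 < complex.Im (tau / p%:R).
Proof. by move=> p0; rewrite Im_div_nat divr_gt0// ltr0n. Qed.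

(** Reducing [m] modulo [p] changes the argument by a multiple of [tau], that is, moves the
    window of rows by at most [q |m|], and each step costs a bounded amount. *)
Lemma window_bound p (q : nat) r : (0 < p)%N -> exists2 K : R, 0 <= K &
  forall (m : int) (M : nat), cmod (zs M (fun j => psi 1 (- (q%:R * tors p m r) + j%:~R * tau))) <=
    K * (1 + `|m|%N%:R).
Proof.
move=> p0.
have /choice[f Hf] (s : 'I_p) : exists c : R, 0 <= c /\ forall (u : int) (M : nat),
  cmod (zs M (fun j => psi 1 (- (q%:R * tors p s%:Z r) + (j + u)%:~R * tau))) <= c * (1 + `|u|%N%:R).
  set w := - _; have [K K0 HK] := psi1_bounded w htau.
  have [B [B0 HB]] := tends_bounded (weierstrass_rows htau w).
  exists (B + 2 * K); split=> [|u M]; first by rewrite addr_ge0// mulr_ge0.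
  have := zs_shift_bound M u HK; have := HB M.
  set A := zs M _; set D := zs M _ => HA HD.
  have := cmodD (D - A) A; rewrite subrK => HDA.
  have u0 : (0 : R) <= `|u|%N%:R by [].
  have := mulr_ge0 B0 u0; lra.
exists (q.+1%:R * \sum_s f s) => [|m M].
  by rewrite mulr_ge0// sumr_ge0// => s _; case: (Hf s).
pose u := (m %/ p%:Z)%Z; pose s0 := `|(m %% p%:Z)%Z|%N.
have pz : p%:Z != 0 by lia.
have s0p : (s0 < p)%N by have := ltz_pmod m (_ : 0 < p%:Z); have := modz_ge0 m pz; rewrite /s0; lia.
have mE : m = s0%:Z + p%:Z * u by rewrite {1}(divz_eq m p%:Z) /s0 gez0_abs ?modz_ge0// addrC mulrC.
have [fs0 Hs] := Hf (Ordinal s0p).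
have -> : zs M (fun j => psi 1 (- (q%:R * tors p m r) + j%:~R * tau)) =
  zs M (fun j => psi 1 (- (q%:R * tors p (Ordinal s0p)%:Z r) + (j + - (q%:Z * u))%:~R * tau)).
  apply: eq_zs => j; congr (psi 1 _); rewrite [in LHS]mE tors_add//= intrD mulrNz intrM -pmulrn; ring.
apply: le_trans (Hs _ M) _; rewrite abszN abszM /=.
have um : (`|u|%N%:R : R) <= `|m|%N%:R.
  rewrite ler_nat; move: mE; clearbody u s0 => mE; nia.
have fsum : f (Ordinal s0p) <= \sum_s f s.
  by rewrite (bigD1 (Ordinal s0p))//= lerDl sumr_ge0// => s _; case: (Hf s).
have -> : q.+1%:R * (\sum_s f s) * (1 + `|m|%N%:R) = (\sum_s f s) * (q.+1%:R * (1 + `|m|%N%:R)) :> R by ring.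
apply: ler_pM => //; rewrite natrM -natr1.
have q0 : (0 : R) <= q%:R by []; have m0 : (0 : R) <= `|m|%N%:R by [].
have := ler_wpM2l q0 um; nra.
Qed.

Lemma bsumD b c : @bsum R b -> bsum c -> bsum (fun n => b n + c n).
Proof.
move=> [b0 [B HB]] [c0 [D HD]]; split=> [n|]; first by rewrite addr_ge0.
by exists (B + D) => N; rewrite big_split lerD.
Qed.

Lemma tors_decay k p r : (1 < k)%N -> (0 < p)%N -> exists K c : R, [/\ 0 <= K, 0 < c &
  forall m : int, cmod (psi k (tors p m r)) <= K * expR (- (c * `|m|%N%:R))].
Proof.
move=> k1 p0; have [K [c [K0 c0 H]]] := psi_decay (r%:R / p%:R) k1 (tau_div_gt0 p0).
by exists K, c; split=> // m; rewrite tors_tau.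
Qed.

Lemma zper_bounded p (q : int) r : (0 < p)%N -> exists2 K : R, 0 <= K &
  forall m : int, cmod (zper p q m r) <= K.
Proof.
move=> p0; exists (\sum_(s < p) cmod (zper p q s%:Z r)) => [|m].
  by apply: sumr_ge0 => s _; exact: cmod_ge0.
have pz : p%:Z != 0 by lia.
have s0p : (`|(m %% p%:Z)%Z| < p)%N.
  by have := ltz_pmod m (_ : 0 < p%:Z); have := modz_ge0 m pz; lia.
have -> : zper p q m r = zper p q (Ordinal s0p)%:Z r.
  rewrite -[RHS](zper_periodic q _ (m %/ p%:Z)%Z)//=; congr zper.
  by rewrite gez0_abs ?modz_ge0// addrC mulrC -divz_eq.
by rewrite (bigD1 (Ordinal s0p))//= lerDl sumr_ge0// => s _; exact: cmod_ge0.
Qed.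

(** The products of the Dedekind sum without the term [2 pi i q m / p], spread out over all
    rows. *)
Definition twisted k p (q r : nat) (m : int) : C := psi k (tors p m r) * zh (q%:R * tors p m r).

Definition torsion_sum k p (q : nat) : C := \sum_(r < p) zlim (twisted k p q r).

(** The rows congruent to [s] modulo [p] see the same value of [zper], hence contribute
    its product with the full row sum at [tors p s r]. *)
Lemma twistedP k p (q : nat) r : (1 < k)%N -> (0 < p)%N ->
  [/\ zsum (twisted k p q r) (zlim (twisted k p q r)),
      zsum (fun m : int => m%:~R * psi k (tors p m r)) (zlim (fun m : int => m%:~R * psi k (tors p m r))) &
      \sum_(s < p) psum k (tors p s%:Z r) * zper p q%:Z s%:Z r =
      zlim (twisted k p q r) + tpi * (q%:R / p%:R) * zlim (fun m : int => m%:~R * psi k (tors p m r))].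
Proof.
move=> k1 p0; have [K [c [K0 c0 HK]]] := tors_decay r k1 p0.
have [L L0 HL] := zper_bounded q%:Z r p0.
set Y := fun m : int => m%:~R * _.
have SY : zsum Y (zlim Y).
  apply: (zlimP (bsumZ K0 (bsum_polyexp 1 c0))) => m.
  by rewrite /Y cmodM cmod_int /polyexp expr1 mulrCA ler_wpM2l.
pose h (m : int) := psi k (tors p m r) * zper p q%:Z m r.
have hdom m : cmod (h m) <= K * L * polyexp 0 c `|m|.
  by rewrite /h cmodM /polyexp expr0 mul1r mulrAC ler_pM ?cmod_ge0.
have bh := bsumZ (mulr_ge0 K0 L0) (bsum_polyexp 0 c0).
have Sh := zlimP bh hdom.
have St : zsum (twisted k p q r) (zlim h - tpi * (q%:R / p%:R) * zlim Y).
  apply: zsum_ext (zsumB Sh (zsumZ (tpi * (q%:R / p%:R)) SY)) => m.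
  rewrite /h /Y /twisted /zper -pmulrn; ring.
rewrite (zlim_eq St); split=> //; rewrite subrK.
have h0 : tends (fun m : nat => h m%:Z) 0 by apply: (bsum_tends0 bh) => m; exact: hdom.
apply: (tends_unique _ (zsum_regroup p0 h0 Sh)).
have Srow (s : 'I_p) : zsum (fun m => h (s%:Z + p%:Z * m)) (psum k (tors p s%:Z r) * zper p q%:Z s%:Z r).
  rewrite mulrC; apply: zsum_ext (zsumZ (zper p q%:Z s%:Z r) (row_seriesP htau (tors p s%:Z r) k1)) => m.
  by rewrite /h tors_add// zper_periodic// mulrC.
exact: zsum_sum Srow.
Qed.

(** The last summand is the contribution of the term [2 pi i q m / p]; by
    [eisenstein_derive1] it is a derivative of an Eisenstein series. *)
Lemma torsion_sumE k p (q : nat) : (1 < k)%N -> (0 < p)%N ->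
  \sum_(r < p) \sum_(s < p) psum k (tors p s%:Z r) * zper p q%:Z s%:Z r =
  torsion_sum k p q + tpi * q%:R * p%:R ^+ k.-1 * zlim (fun m : int => m%:~R * psi k (m%:~R * tau)).
Proof.
move=> k1 p0; have k0 : (0 < k)%N := ltnW k1; have pn := natC_neq0 p0.
transitivity (\sum_(r < p) (zlim (twisted k p q r) +
    tpi * (q%:R / p%:R) * zlim (fun m : int => m%:~R * psi k (tors p m r)))).
  by apply: eq_bigr => r _; have [] := twistedP q r k1 p0.
rewrite big_split /=; congr (_ + _).
rewrite -mulr_sumr.
have SY : zsum (fun m : int => \sum_(r < p) m%:~R * psi k (tors p m r))
    (\sum_(r < p) zlim (fun m : int => m%:~R * psi k (tors p m r))).
  by apply: zsum_sum => r; have [] := twistedP q r k1 p0.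
have -> : \sum_(r < p) zlim (fun m : int => m%:~R * psi k (tors p m r)) =
   p%:R ^+ k * zlim (fun m : int => m%:~R * psi k (m%:~R * tau)).
  apply: (tends_unique SY); apply: zsum_ext (zsumZ (p%:R ^+ k) (moment_sum htau k1)) => m.
  by rewrite -mulr_sumr psi_dist// mulrCA.
rewrite mulrA; congr (_ * _); rewrite -{1}(prednK k0) exprS -!mulrA; congr (_ * (_ * _)).
by rewrite mulKf.
Qed.

(** The inner windows tend to [zhat (- q X)] at the division point [X = tors p m r]; the
    exponential decay in [m] dominates the linear bound [window_bound]. *)
Lemma window_limit k p (q : nat) : (1 < k)%N -> (0 < p)%N ->
  tends (fun M => zs M (fun m => \sum_(r < p) psi k (tors p m r) *
     zs M (fun j => psi 1 (- (q%:R * tors p m r) + j%:~R * tau)))) (- torsion_sum k p q).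
Proof.
move=> k1 p0; rewrite /torsion_sum -sumrN.
have Hr (r : 'I_p) : tends (fun M => zs M (fun m => psi k (tors p m r) *
     zs M (fun j => psi 1 (- (q%:R * tors p m r) + j%:~R * tau)))) (- zlim (twisted k p q r)).
  have [K [c [K0 c0 HK]]] := tors_decay r k1 p0; have [L L0 HL] := window_bound q r p0.
  have [St _ _] := twistedP q r k1 p0.
  have -> : - zlim (twisted k p q r) =
     zlim (fun m => psi k (tors p m r) * zh (- (q%:R * tors p m r))).
    rewrite -mulN1r; apply/esym/zlim_eq; apply: zsum_ext (zsumZ (-1) St) => m.
    by rewrite /twisted zhat_opp// mulN1r mulrN.
  have bb := bsumZ (mulr_ge0 K0 L0) (bsumD (bsum_polyexp 0 c0) (bsum_polyexp 1 c0)).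
  apply: (tannery bb) => [M m|m].
    rewrite cmodM; apply: le_trans (ler_pM (cmod_ge0 _) (cmod_ge0 _) (HK m) (HL m M)) _.
    by rewrite /polyexp expr0 expr1 le_eqVlt; apply/orP; left; apply/eqP; ring.
  exact: tendsZ (weierstrass_rows htau _).
have := tends_sum (index_enum 'I_p) Hr; apply: tends_ext => M.
by rewrite zs_sum.
Qed.

End Reciprocity.

(** * The addition formula summed over boxes of rows *)

Section BoxSum.
Variable R : realType.
Local Notation C := R[i].
Implicit Types (x y z w : C) (k : nat).
Local Notation tpi := (two_pi_i R).
Variable tau : C.
Hypothesis htau : 0 < complex.Im tau.
Variables p q : nat.
Hypotheses (p0 : (0 < p)%N) (q0 : (0 < q)%N) (pq : coprime p q).
Local Notation psum := (row_series tau).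
Local Notation ta := (tors tau p).
Local Notation tb := (tors tau q).

Definition box (M : nat) (phi : int -> int -> 'I_p -> 'I_q -> C) : C :=
  zs M (fun m => zs M (fun l => \sum_r \sum_s phi m l r s)).

Lemma eq_box M phi psi :
  (forall m l r s, (`|m| <= M)%N -> phi m l r s = psi m l r s) -> box M phi = box M psi.
Proof.
move=> H; apply: eq_big_seq => m; rewrite mem_zr => mM; apply: eq_zs => l.
by apply: eq_bigr => r _; apply: eq_bigr => s _; exact: H.
Qed.

Lemma boxD M phi psi :
  box M (fun m l r s => phi m l r s + psi m l r s) = box M phi + box M psi.
Proof.
rewrite /box -zsD; apply: eq_zs => m; rewrite -zsD; apply: eq_zs => l.
by rewrite -big_split; apply: eq_bigr => r _; rewrite -big_split.
Qed.

Lemma boxZ M c phi : box M (fun m l r s => c * phi m l r s) = c * box M phi.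
Proof.
rewrite /box -zsZ; apply: eq_zs => m; rewrite -zsZ; apply: eq_zs => l.
by rewrite mulr_sumr; apply: eq_bigr => r _; rewrite mulr_sumr.
Qed.

Lemma box_sum M (I : Type) (e : seq I) (phi : I -> int -> int -> 'I_p -> 'I_q -> C) :
  box M (fun m l r s => \sum_(i <- e) phi i m l r s) = \sum_(i <- e) box M (phi i).
Proof.
rewrite /box -zs_sum; apply: eq_zs => m; rewrite -zs_sum; apply: eq_zs => l.
rewrite [RHS]exchange_big; apply: eq_bigr => r _.
by rewrite [RHS]exchange_big.
Qed.

Lemma box_row M (f : int -> 'I_p -> C) (g : int -> int -> 'I_p -> 'I_q -> C) :
  box M (fun m l r s => f m r * g m l r s) =
  zs M (fun m => \sum_r f m r * zs M (fun l => \sum_s g m l r s)).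
Proof.
apply: eq_zs => m; rewrite zs_sum; apply: eq_bigr => r _.
by rewrite -zsZ; apply: eq_zs => l; rewrite mulr_sumr.
Qed.

Lemma box_col M (f : int -> 'I_q -> C) (g : int -> int -> 'I_p -> 'I_q -> C) :
  box M (fun m l r s => f l s * g m l r s) =
  zs M (fun l => \sum_s f l s * zs M (fun m => \sum_r g m l r s)).
Proof.
rewrite /box zs_exchange; apply: eq_zs => l.
transitivity (zs M (fun m => \sum_s \sum_r f l s * g m l r s)).
  by apply: eq_zs => m; rewrite exchange_big.
by rewrite zs_sum; apply: eq_bigr => s _; rewrite -zsZ; apply: eq_zs => m; rewrite mulr_sumr.
Qed.

Lemma box_prod M (f : int -> 'I_p -> C) (g : int -> 'I_q -> C) :
  box M (fun m l r s => f m r * g l s) =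
  zs M (fun m => \sum_r f m r) * zs M (fun l => \sum_s g l s).
Proof.
rewrite (box_row M f (fun _ l _ s => g l s)) -zsZr; apply: eq_zs => m.
by rewrite mulr_suml.
Qed.

(** If two division points differ by an integer, then [p l = q m] and [p (s + q j) = q r];
    coprimality and [r < p] leave only [r = 0]. *)
Lemma tors_diff_eq0 (m l : int) (r s : nat) (j : int) : (r < p)%N -> (s < q)%N ->
  tb l s - ta m r + j%:~R = 0 -> [/\ p%:Z * l = q%:Z * m, r = 0%N, s = 0%N & j = 0].
Proof.
move=> rp sq H; have pn := natC_neq0 R p0; have qn := natC_neq0 R q0.
have [E1 E2] : p%:Z * l - q%:Z * m = 0 /\ p%:Z * s%:Z - q%:Z * r%:Z + p%:Z * q%:Z * j = 0.
  apply: (lattice_pt0 htau).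
  have <- : (tb l s - ta m r + j%:~R) * (p%:R * q%:R) = 0 by rewrite H mul0r.
  by rewrite !intrD !mulrNz !intrM -!pmulrn /tors; field; rewrite pn qn.
have xE : p%:Z * (s%:Z + q%:Z * j) = q%:Z * r%:Z by lia.
have x0 : 0 <= s%:Z + q%:Z * j by nia.
have pr : (p %| q * r)%N.
  by apply/dvdnP; exists (absz (s%:Z + q%:Z * j)%R); nia.
have r0 : r = 0%N.
  move: pr; rewrite Gauss_dvdr// => /dvdn_leq; case: (r) rp => // r' rp /(_ isT); lia.
have j0 : j = 0 by move: xE; rewrite r0 mulr0; nia.
split=> //; [lia| move: xE; rewrite r0 j0; nia].
Qed.

Lemma diag_indicator M (m l : int) (r : 'I_p) (s : 'I_q) : (`|m| <= M)%N ->
  (tb l s - ta m r == 0)%:R = \sum_(k <- zr M)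
    ((m == p%:Z * k)%:R * ((l == q%:Z * k)%:R * ((r == 0 :> nat)%:R * (s == 0 :> nat)%:R))) :> C.
Proof.
move=> mM; case: eqP => [H|H].
  have H0 : tb l s - ta m r + 0%:~R = 0 by rewrite mulr0z addr0.
  have [E r0 s0 _] := tors_diff_eq0 (ltn_ord r) (ltn_ord s) H0.
  have pm : (p %| `|m|)%N.
    rewrite -(Gauss_dvdr _ pq); apply/dvdnP; exists `|l|%N.
    by have := congr1 absz E; rewrite !abszM /= mulnC => ->.
  have pm' : (p%:Z %| m)%Z by [].
  pose k0 := (m %/ p%:Z)%Z; have mk : m = p%:Z * k0 by rewrite mulrC divzK.
  have lk : l = q%:Z * k0 by move: E; rewrite mk; clearbody k0; nia.
  rewrite (bigD1_seq k0) ?zr_uniq//=; last by rewrite mem_zr; move: mM; rewrite mk; clearbody k0; nia.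
  rewrite -mk -lk !eqxx r0 s0 !eqxx !mul1r big1 ?addr0// => k kk0.
  case: eqP => [mk'|_]; last by rewrite mul0r.
  by move: kk0 => /eqP[]; move: mk'; rewrite mk; clearbody k0; nia.
rewrite big1// => k _.
case: eqP => [mk|_]; last by rewrite mul0r.
case: eqP => [lk|_]; last by rewrite mul0r mulr0.
case: eqP => [r0|_]; last by rewrite mul0r !mulr0.
case: eqP => [s0|_]; last by rewrite !mulr0.
case: H; rewrite /tors mk lk r0 s0 !intrM -!pmulrn.
by field; rewrite !natC_neq0.
Qed.

Lemma sum_ord_eq0 (N : nat) : (0 < N)%N -> \sum_(r < N) (r == 0 :> nat)%:R = 1 :> C.
Proof.
move=> N0; rewrite (bigD1 (Ordinal N0))//= big1 ?addr0// => r.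
by rewrite -val_eqE /= => /negbTE ->.
Qed.

(** The pairs with [X = Y] are the [(m, l) = (p j, q j)] with [r = s = 0], where [X = Y] is
    the lattice point [j tau]: they make up one Eisenstein series. *)
Lemma diag_limit k : (1 < k)%N ->
  tends (fun M => box M (fun m l r s => (tb l s - ta m r == 0)%:R * psi k (ta m r))) (psum k 0).
Proof.
move=> k1; have [K [c [K0 c0 HK]]] := psi_decay 0 k1 htau.
have bb := bsumZ K0 (bsum_polyexp 0 c0).
pose F (M : nat) (j : int) : C :=
  if (absz (p%:Z * j)%R <= M)%N && (absz (q%:Z * j)%R <= M)%N then psi k (0 + j%:~R * tau) else 0.
have HF : tends (fun M => zs M (F M)) (psum k 0).
  apply: (tannery bb) => [M j|j].
    rewrite /F /polyexp expr0 mul1r; case: ifP => _; first exact: HK.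
    by rewrite cmod0 mulr_ge0 ?expR_ge0.
  apply: (@tends_eventually _ (fun=> psi k (0 + j%:~R * tau)) _ _ (absz (p%:Z * j)%R + absz (q%:Z * j)%R)%N); last exact: tends_cst.
  by move=> M HM; rewrite /F !ifT//; lia.
apply: tends_ext HF => M; apply/esym.
transitivity (box M (fun m l r s => \sum_(j <- zr M) psi k (0 + j%:~R * tau) *
  (((m == p%:Z * j)%:R * (r == 0 :> nat)%:R) * ((l == q%:Z * j)%:R * (s == 0 :> nat)%:R)))).
  apply: eq_box => m l r s mM; rewrite (diag_indicator l r s mM) mulr_suml; apply: eq_bigr => j _.
  case: (m =P p%:Z * j) => [->|_]; last by rewrite !(mul0r, mulr0).
  case: (l =P q%:Z * j) => [_|_]; last by rewrite !(mul0r, mulr0).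
  case: (r =P 0%N :> nat) => [->|_]; last by rewrite !(mul0r, mulr0).
  rewrite add0r; have -> : ta (p%:Z * j) 0 = j%:~R * tau.
    by rewrite /tors intrM -pmulrn; field; rewrite natC_neq0.
  ring.
rewrite box_sum; apply: eq_bigr => j _.
rewrite boxZ (box_prod M (fun m r => (m == p%:Z * j)%:R * (r == 0 :> nat)%:R)
  (fun l s => (l == q%:Z * j)%:R * (s == 0 :> nat)%:R)).
have E (N : nat) (t : int) : (0 < N)%N ->
    zs M (fun m => \sum_(r < N) (m == t)%:R * (r == 0 :> nat)%:R) = (`|t| <= M)%N%:R :> C.
  move=> N0; rewrite (eq_zs M (g := fun m => (m == t)%:R : C)); last first.
    by move=> m; rewrite -mulr_sumr sum_ord_eq0// mulr1.
  case: leqP => tM; first by rewrite (zs_pred1 (n0 := t)) ?eqxx// => m /negbTE ->.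
  rewrite /zs big_seq big1// => m; rewrite mem_zr => mM.
  by case: eqP => // mt; move: mM; rewrite mt leqNgt tM.
rewrite !E// /F; case: (_ <= M)%N; case: (_ <= M)%N => /=; rewrite ?(mul0r, mulr0, mulr1)//.
Qed.

Lemma zs_tors_eq0 (N M : nat) : (0 < N)%N ->
  zs M (fun m => \sum_(r < N) (tors tau N m r == 0)%:R) = 1 :> C.
Proof.
move=> N0.
have E (m : int) (r : 'I_N) : (tors tau N m r == 0) = (m == 0) && (r == 0 :> nat).
  apply/eqP/andP => [H|[/eqP -> /eqP ->]]; last by rewrite /tors mulr0z mul0r addr0 mul0r.
  have H0 : tors tau N m r + 0%:~R = 0 by rewrite mulr0z addr0.
  by have [-> r0] := tors_eq0 htau N0 H0; split=> //; lia.
rewrite (zs_pred1 (n0 := 0))//; last by move=> m /negbTE m0; rewrite big1// => r _; rewrite E m0.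
by rewrite -[RHS](sum_ord_eq0 N0); apply: eq_bigr => r _; rewrite E eqxx.
Qed.

Lemma sum_odd_index (F : nat -> C) n :
  \sum_(i < (2 * n).+1) (if odd i then F i else 0) = \sum_(1 <= j < n.+1) F (2 * j).-1.
Proof.
elim: n => [|n IH]; first by rewrite big_ord1 big_geq.
rewrite big_nat_recr//= -IH mulnS !add2n !big_ord_recr /= negbK.
have -> : odd (2 * n) = false by rewrite oddM.
rewrite /= !addr0; congr (_ + F _); lia.
Qed.

Lemma zs_tors k M (N : nat) : (0 < k)%N -> (0 < N)%N ->
  zs M (fun m => \sum_(r < N) psi k (tors tau N m r)) = N%:R ^+ k * zs M (fun m => psi k (m%:~R * tau)).
Proof. by move=> k0 N0; rewrite -zsZ; apply: eq_zs => m; rewrite psi_dist. Qed.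

Lemma psum0P k : (1 < k)%N -> tends (fun M => zs M (fun m => psi k (m%:~R * tau))) (psum k 0).
Proof.
by move=> k1; apply: tends_ext (row_seriesP htau 0 k1) => M; apply: eq_zs => m; rewrite add0r.
Qed.

(** The double sum factors. In odd weight already the sums over windows vanish, by symmetry;
    this includes weight 1, where the rows do not tend to 0. *)
Lemma product_limit n : (0 < n)%N ->
  tends (fun M => box M (fun m l r s => \sum_(i < (2 * n).+1) psi i.+1 (ta m r) * psi ((2 * n).+1 - i) (tb l s)))
    (\sum_(1 <= j < n.+1) p%:R ^+ (2 * j) * q%:R ^+ (2 * n + 2 - 2 * j) *
        (psum (2 * j) 0 * psum (2 * (n.+1 - j)) 0)).
Proof.
move=> n0; set k := (2 * n).+1.
pose F i := p%:R ^+ i.+1 * q%:R ^+ (k - i) * (psum i.+1 0 * psum (k - i) 0).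
have -> : \sum_(1 <= j < n.+1) p%:R ^+ (2 * j) * q%:R ^+ (2 * n + 2 - 2 * j) *
        (psum (2 * j) 0 * psum (2 * (n.+1 - j)) 0) = \sum_(i < k) (if odd i then F i else 0).
  rewrite sum_odd_index; apply: eq_big_nat => j /andP[j1 jn]; rewrite /F /k.
  have -> : ((2 * j).-1.+1 = 2 * j)%N by lia.
  have -> : ((2 * n).+1 - (2 * j).-1 = 2 * n + 2 - 2 * j)%N by lia.
  by have -> : (2 * (n.+1 - j) = 2 * n + 2 - 2 * j)%N by lia.
have Hi (i : 'I_k) : tends (fun M => box M (fun m l r s => psi i.+1 (ta m r) * psi (k - i) (tb l s)))
    (if odd i then F i else 0).
  have ik : (0 < k - i)%N by rewrite subn_gt0.
  have E M : box M (fun m l r s => psi i.+1 (ta m r) * psi (k - i) (tb l s)) =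
     p%:R ^+ i.+1 * q%:R ^+ (k - i) *
     (zs M (fun m => psi i.+1 (m%:~R * tau)) * zs M (fun m => psi (k - i) (m%:~R * tau))).
    by rewrite (box_prod M (fun m r => psi i.+1 (ta m r)) (fun l s => psi (k - i) (tb l s))) !zs_tors//; ring.
  apply: tends_ext (fun M => esym (E M)) _; case: ifP => iodd.
    apply: tendsZ; apply: tendsM; apply: psum0P; first by case: (nat_of_ord i) iodd.
    have : odd k by rewrite /k /= oddM.
    by have := ltn_ord i; have := odd_double_half i; rewrite iodd /k -muln2; lia.
  apply: tends_ext (tends_cst 0) => M; rewrite zs_odd ?mul0r ?mulr0// => m.
  by rewrite mulrNz mulNr psi_opp// exprS -signr_odd iodd expr0 mulr1 mulN1r.
apply: tends_ext (tends_sum (index_enum _) Hi) => M.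
by rewrite -box_sum.
Qed.

(** The distribution relation turns the sum over the [N] points of a row into one value. *)
Lemma window_row (a : C) M (N : nat) : (0 < N)%N ->
  zs M (fun l => \sum_(s < N) psi 1 (tors tau N l s - a)) =
  N%:R * zs M (fun j => psi 1 (- (N%:R * a) + j%:~R * tau)).
Proof.
move=> N0; have Nn := natC_neq0 R N0; rewrite -zsZ; apply: eq_zs => l.
rewrite (addrC (- _)) -[in RHS](expr1 N%:R) -psi_dist//; apply: eq_bigr => s _.
by congr (psi 1 _); rewrite /tors; field.
Qed.

(** The limit of [psi_addition] summed over all pairs of division points in a box of rows.
    The two first terms on the right come from the quotients by [Y - X], by
    [window_row]; the other ones are the boundary terms. *)
Lemma box_identity n : (0 < n)%N -> let k := (2 * n).+1 in
  \sum_(1 <= j < n.+1) p%:R ^+ (2 * j) * q%:R ^+ (2 * n + 2 - 2 * j) *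
        (psum (2 * j) 0 * psum (2 * (n.+1 - j)) 0) =
  - q%:R * torsion_sum tau k p q - p%:R * torsion_sum tau k q p +
  q%:R ^+ k.+1 * psum k.+1 0 + p%:R ^+ k.+1 * psum k.+1 0 + k%:R * psum k.+1 0.
Proof.
move=> n0 k; have k2 : (2 < k)%N by rewrite /k; lia.
have k1 : (1 < k)%N := ltnW k2.
apply: (tends_unique (product_limit n0)).
have T1 := tendsZ q%:R (window_limit htau q k1 p0).
have T2 := tendsZ p%:R (window_limit htau p k1 q0).
have T3 := tendsZ (q%:R ^+ k.+1) (psum0P (ltnW k1 : (1 < k.+1)%N)).
have T4 := tendsZ (p%:R ^+ k.+1) (psum0P (ltnW k1 : (1 < k.+1)%N)).
have T5 := tendsZ k%:R (diag_limit (ltnW k1 : (1 < k.+1)%N)).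
have := tendsD (tendsD (tendsD (tendsD T1 T2) T3) T4) T5.
rewrite !mulrN -mulNr; apply: tends_ext => M.
transitivity (box M (fun m l r s =>
  psi k (ta m r) * psi 1 (tb l s - ta m r) + psi k (tb l s) * - psi 1 (tb l s - ta m r) +
  (ta m r == 0)%:R * psi k.+1 (tb l s) + psi k.+1 (ta m r) * (tb l s == 0)%:R +
  k%:R * ((tb l s - ta m r == 0)%:R * psi k.+1 (ta m r)))); last first.
  apply: eq_box => m l r s _.
  have ha : only_zero (ta m r) by apply: tors_only_zero.
  have hb : only_zero (tb l s) by apply: tors_only_zero.
  have hba : only_zero (tb l s - ta m r).
    by move=> j /(tors_diff_eq0 (ltn_ord r) (ltn_ord s))[].
  by rewrite (psi_addition k2 ha hb hba); ring.
rewrite !boxD boxZ; congr (_ + _ + _ + _ + _).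
- rewrite (box_row M (fun m r => psi k (ta m r)) (fun m l r s => psi 1 (tb l s - ta m r))) -zsZ.
  by apply: eq_zs => m; rewrite mulr_sumr; apply: eq_bigr => r _; rewrite window_row// mulrCA.
- rewrite (box_col M (fun l s => psi k (tb l s)) (fun m l r s => - psi 1 (tb l s - ta m r))) -zsZ.
  apply: eq_zs => l; rewrite mulr_sumr; apply: eq_bigr => s _.
  rewrite mulrCA -window_row//; congr (_ * _).
  apply: eq_zs => m; apply: eq_bigr => r _.
  by rewrite -(opprB (tb l s)) psi_opp// expr1 mulN1r.
- by rewrite (box_prod M (fun m r => (ta m r == 0)%:R) (fun l s => psi k.+1 (tb l s))) zs_tors_eq0// mul1r zs_tors.
- by rewrite (box_prod M (fun m r => psi k.+1 (ta m r)) (fun l s => (tb l s == 0)%:R)) zs_tors_eq0// mulr1 zs_tors.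
Qed.

End BoxSum.

(** * The reciprocity law *)

Section Main.
Variable R : realType.
Variables (n : nat) (tau : R[i]).
Hypotheses (n0 : (0 < n)%N) (htau : 0 < complex.Im tau).

Lemma dedekind_D_addp p (q : int) : (0 < p)%N ->
  dedekind_D n p q tau = dedekind_D n p (q + p%:Z) tau.
Proof.
move=> p0; rewrite !dedekind_D_rows//; congr (_ * _).
by apply: eq_bigr => r _; apply: eq_bigr => m _; rewrite zper_addp.
Qed.

Lemma dedekind_D_opp p (q : int) : (0 < p)%N ->
  dedekind_D n p (- q) tau = - dedekind_D n p q tau.
Proof.
move=> p0; rewrite !dedekind_D_rows// -mulrN; congr (_ * _).
rewrite -sumrN; apply: eq_bigr => r _; rewrite -sumrN; apply: eq_bigr => m _.
by rewrite zper_opp// mulrN.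
Qed.

Lemma dedekind_reciprocity p q : (0 < p)%N -> (0 < q)%N -> coprime p q ->
  dedekind_D n p q%:Z tau + dedekind_D n q p%:Z tau = dedekind_R n p q tau.
Proof.
move=> p0 q0 pq; have k1 : (1 < (2 * n).+1)%N by lia.
rewrite !dedekind_D_rows// !torsion_sumE//= /dedekind_R eisenstein_derive1//.
set Q := zlim _.
have -> : \sum_(1 <= j < n.+1) eisenstein j tau * eisenstein (n.+1 - j) tau
        * p%:R ^+ (2 * j) * q%:R ^+ (2 * n + 2 - 2 * j) =
  \sum_(1 <= j < n.+1) p%:R ^+ (2 * j) * q%:R ^+ (2 * n + 2 - 2 * j) *
        (row_series tau (2 * j) 0 * row_series tau (2 * (n.+1 - j)) 0).
  apply: eq_big_nat => j /andP[j1 jn]; rewrite !eisenstein_rows//; last by lia.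
  ring.
rewrite (box_identity htau p0 q0 pq n0) eisenstein_rows//.
have -> : (2 * n.+1 = (2 * n).+2)%N by lia.
have -> : (2 * n + 2 = (2 * n).+2)%N by lia.
have pn := natC_neq0 R p0; have qn := natC_neq0 R q0; have nn := natC_neq0 R n0.
have T0 := tpi_neq0 R.
rewrite (natrD _ _ 1) (natrM _ 2 n) -(natr1 (2 * n)) (natrM _ 2 n).
have e2n (x : R[i]) : x ^+ (2 * n) = x * x ^+ (2 * n - 1).
  by rewrite -exprS; congr (_ ^+ _); lia.
rewrite !e2n.
set A := torsion_sum _ _ p q; set B := torsion_sum _ _ q p; set E := row_series _ _ 0.
have alg (T x y N a b e xs ys x1 y1 Q' : R[i]) : T != 0 -> x != 0 -> y != 0 -> N != 0 ->
  (T ^+ 2 * x)^-1 * (a + T * y * (x * x1) * Q') + (T ^+ 2 * y)^-1 * (b + T * x * (y * y1) * Q') =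
  - (T ^+ 2 * x * y)^-1 * (- y * a - x * b + ys * e + xs * e + (2 * N + 1) * e -
     e * (xs + ys) - (2 * N + 1) * e) - (2 * T * N)^-1 * (- (2 * N) * Q') * (x1 * y + x * y1).
  by move=> T1 x0 y0 N0; field; rewrite T1 x0 y0 N0.
exact: alg.
Qed.

End Main.

Theorem theorem1p1 (R : realType) (n : nat) (hn : (0 < n)%N)
    (tau : R[i]) (htau : upper_half_plane tau) :
  (forall (p : nat) (q : int), in_V p q ->
     dedekind_D n p q tau = dedekind_D n p (q + p%:Z) tau /\
     dedekind_D n p (- q) tau = - dedekind_D n p q tau) /\
  (forall p q : nat, in_U p q ->
     dedekind_D n p q%:Z tau + dedekind_D n q p%:Z tau = dedekind_R n p q tau).
Proof.
split=> [p q [p0 _]|p q [p0 q0 pq]]; last exact: dedekind_reciprocity.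
by split; [exact: dedekind_D_addp|exact: dedekind_D_opp].
Qed.
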